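(* Let $\mathbb{K}$ be a non-trivially valued algebraically closed field, and let $\mathbf{f}:(\mathbb{A}^2_{\mathbb{K}},0)\to(\mathbb{A}^2_{\mathbb{K}},0)$ be a germ of a contracting automorphism. Denote by $\mathbf{X}(\mathbf{f})$ the analytic Hopf surface associated to $\mathbf{f}$. Then $\mathbf{X}(\mathbf{f})$ retracts to a tropical Hopf surface, which is non-compact if $\mathbf{f}$ is a resonant germ.
   Context: $\mathbb{K}$ has characteristic $0$ and its valuation $\nu_0$ is non-archimedean of rank one with value group $\mathbb{R}$. A germ $\mathbf{f}$ of automorphism of $(\mathbb{A}^2,0)$ is contracting if the eigenvalues of its linear part have strictly positive valuation. By the Poincaré–Dulac theorem such an $\mathbf{f}$ is analytically conjugate to a global automorphism $\mathbf{f}(x_1,x_2)=(\lambda x_1,\mu x_2+\epsilon x_1^m)$ with $\epsilon(\mu-\lambda^m)=0$, $m\in\mathbb{N}^*$; $\mathbf{f}$ is resonant if $\epsilon\neq0$ (so $\mu=\lambda^m$), i.e. if it is not conjugate to a diagonal linear map. Analytic Hopf surface. $\mathcal{V}(\mathbb{A}^2)=\mathbb{A}^2_{an}$ denotes the Berkovich analytification of $\mathbb{A}^2$, seen as the space of semivaluations $\mathbb{K}[x_1,x_2]\to(-\infty,+\infty]$ extending $\nu_0$. An automorphism $\mathbf{f}$ acts by $(\mathbf{f}_*\mu)(\phi)=\mu(\phi\circ\mathbf{f})$. $\mathbf{X}(\mathbf{f})$ is the quotient of $\mathbb{A}^2_{an}\setminus\{0\}$ by the group generated by $\mathbf{f}_*$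 (with $\mathbf{f}$ in Poincaré–Dulac normal form). Tropical Hopf surfaces. $\mathbb{T}=\mathbb{R}\cup\{\infty\}$ with min-plus operations, topologized by Euclidean open sets and the sets $(a,\infty]$; $\infty$ also denotes $(\infty,\dots,\infty)$. A (compact) tropical Hopf surface is the quotient of $X\setminus\{\infty\}$ by $F$, where $X\subset\mathbb{T}^n$ is a (non-singular) tropical surface obtained from $\mathbb{T}^2$ by tropical modifications, and $F:\mathbb{T}^n\to\mathbb{T}^n$ is a coordinate permutation composed with a translation, contracting at $\infty$ (every neighborhood $U$ of $\infty$ contains a neighborhood $V$ of $\infty$ with $\overline{F(V)}\subset V$), with $F(X)=X$. A non-compact tropical Hopf surface is the quotient of $X_\infty\setminus\{\infty\}$ (or of a pointed neighborhood of $\infty$ in it) by an automorphism $F_\infty$, where $X_\infty$ is the inverse limit of an infinite sequence of tropical modifications starting from $\mathbb{T}^2$, and $F_\infty$ is an integer affine automorphism of $X_\infty$ (such as the shift of coordinates composed with a translation). Here the regular modification of a tropical variety $V\subset\mathbb{T}^n$ along a tropical polynomial $P$ is the projection to $V$ of the graph of $P|_V$ completed in $\mathbb{T}^{n+1}$, at each codimension-one face where balancing fails, by a facet in direction $e_{n+1}$ with the unique positive weight restoring balancing. ''Retracts to a tropical Hopf surface $S$'' means: there is a continuous map $\rho:\mathbf{X}(\mathbf{f})\to S$ (induced by tropicalization with respect to an embedding, or an inverse limit of embeddings, of $\mathbb{A}^2$) and a continuous section $s:S\to\mathbf{X}(\mathbf{f})$ of $\rho$, so that $s\circ\rho$ is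 a retraction of $\mathbf{X}(\mathbf{f})$ onto $s(S)$. *)

(* Defs.v *)
From HB Require Import structures.
From mathcomp Require Import all_boot all_order all_algebra all_fingroup.
From mathcomp Require Import mpoly.
From mathcomp Require Import all_classical all_reals.
From mathcomp Require Import ereal topology.

Set Implicit Arguments.
Unset Strict Implicit.
Unset Printing Implicit Defensive.

Import Order.TTheory GRing.Theory Num.Theory.

Local Open Scope classical_set_scope.
Local Open Scope ring_scope.

Section OrbitSpace.
Context {T : topologicalType} (D : set T) (F : T -> T).

(* When F restricts to a bijection of D, these are the orbits of the group
   generated by F; in this form it is an equivalence for every F. *)
Definition same_orbit (x y : D) : bool :=
  `[< exists j k : nat, iter j F (set_val x) = iter k F (set_val y) >].

Lemma same_orbit_refl : reflexive same_orbit.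
Proof. by move=> x; apply/asboolP; exists 0%N, 0%N. Qed.

Lemma same_orbit_sym : ssrbool.symmetric same_orbit.
Proof.
by move=> x y; apply/asboolP/asboolP => -[j [k e]]; exists k, j.
Qed.

Lemma same_orbit_trans : transitive same_orbit.
Proof.
move=> y x z /asboolP[j [k xy]] /asboolP[l [m yz]]; apply/asboolP.
by exists (l + j)%N, (k + m)%N; rewrite !iterD xy -iterD addnC iterD yz -iterD.
Qed.

Definition orbit_rel : equiv_rel D :=
  EquivRel same_orbit same_orbit_refl same_orbit_sym same_orbit_trans.

Definition orbit_quotient : quotType D := {eq_quot orbit_rel}%qT.

(* D has the subspace topology of T. *)
Definition orbit_space : topologicalType := quotient_topology orbit_quotient.

Definition orbit_of (x : D) : orbit_space := (\pi_orbit_quotient x)%qT.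

(* Every neighbourhood U of p in D contains a neighbourhood V of p in D such
   that the closure in D of F(V) is contained in V. *)
Definition contracting_at (p : T) : Prop :=
  forall U : set T, within D (nbhs p) U ->
  exists V : set T, [/\ within D (nbhs p) V, V `<=` D `&` U
                      & D `&` closure (F @` V) `<=` V].

End OrbitSpace.

(* Functions I -> [-oo, +oo] with the topology of pointwise convergence. All
   the subsets considered below avoid the value -oo, and the subspace topology
   of (-oo, +oo] is that of T: Euclidean open sets and the sets (a, +oo]. *)
Definition efun (R : realType) (I : Type) : topologicalType :=
  prod_topology (fun _ : I => \bar R).

Section Analytic.
Context (R : realType) (K : closedFieldType) (nu : K -> \bar R).

Definition valuation : Prop :=
  [/\ forall x, nu x != -oo%E,
      forall x, nu x = +oo%E <-> x = 0,
      forall x y, nu (x * y) = (nu x + nu y)%E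
    & forall x y, (Order.min (nu x) (nu y) <= nu (x + y)%R)%E].

Definition nontrivial_valuation : Prop := exists2 x, x != 0 & nu x != 0%E.

Definition A2an : set (efun R {mpoly K[2]}) :=
  [set mu : {mpoly K[2]} -> \bar R |
    [/\ forall p, mu p != -oo%E,
        forall c : K, mu c%:MP = nu c,
        forall p q, mu (p * q) = (mu p + mu q)%E
      & forall p q, (Order.min (mu p) (mu q) <= mu (p + q)%R)%E]].

Definition A2an_origin : efun R {mpoly K[2]} :=
  fun p : {mpoly K[2]} => nu p.@[fun=> 0].

Definition push (g : 2.-tuple {mpoly K[2]}) (mu : efun R {mpoly K[2]}) :
    efun R {mpoly K[2]} :=
  fun p : {mpoly K[2]} => mu (p \mPo g).

Definition analytic_hopf (g : 2.-tuple {mpoly K[2]}) : topologicalType :=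
  orbit_space (A2an `\ A2an_origin) (push g).

Definition series2 : Type := 'X_{1..2} -> K.

Definition series_trunc (d : nat) (a : series2) : {mpoly K[2]} :=
  \sum_(m : 'X_{1..2 < d.+1}) a m *: 'X_[m].

(* Composition of formal power series when h has no constant term: the terms of
   degree larger than mdeg m of a and h do not contribute to the coefficient
   of 'X_[m]. *)
Definition series_comp (a : series2) (h : 'I_2 -> series2) : series2 :=
  fun m => (series_trunc (mdeg m) a
              \mPo [tuple series_trunc (mdeg m) (h i) | i < 2])@_m.

(* For a series without constant term: the radius of convergence is positive. *)
Definition convergent (a : series2) : Prop :=
  exists B : R, forall m, ((B *+ mdeg m)%:E <= nu (a m))%E.

Definition jacobian (h : 'I_2 -> series2) : 'M[K]_2 :=
  \matrix_(i, j) h i U_(j)%MM.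

Definition germ_automorphism (h : 'I_2 -> series2) : Prop :=
  [/\ forall i, h i 0%MM = 0, forall i, convergent (h i)
    & jacobian h \in unitmx].

Definition contracting_germ (f : 'I_2 -> series2) : Prop :=
  germ_automorphism f /\
  forall a, eigenvalue (jacobian f) a -> (0 < nu a)%E.

Definition analytically_conjugate (f g : 'I_2 -> series2) : Prop :=
  exists2 phi, germ_automorphism phi &
    forall i m, series_comp (phi i) f m = series_comp (g i) phi m.

Definition global_germ (g : 2.-tuple {mpoly K[2]}) : 'I_2 -> series2 :=
  fun i m => (tnth g i)@_m.

Definition normal_form_map (lam mu eps : K) (m : nat) :
    2.-tuple {mpoly K[2]} :=
  [tuple lam *: 'X_ord0; mu *: 'X_ord_max + eps *: 'X_ord0 ^+ m].

(* The eigenvalues lam and mu are those of the linear part of f; f is resonant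
   when eps is not 0. *)
Definition poincare_dulac (f : 'I_2 -> series2) (lam mu eps : K) (m : nat) :
    Prop :=
  [/\ (0 < m)%N, eps * (mu - lam ^+ m) = 0
    & analytically_conjugate f (global_germ (normal_form_map lam mu eps m))].

(* The polynomials h define a closed embedding of the affine plane. *)
Definition embedding (n : nat) (h : n.-tuple {mpoly K[2]}) : Prop :=
  forall p : {mpoly K[2]}, exists q : {mpoly K[n]}, p = q \mPo h.

Definition tropicalization (I : Type) (h : I -> {mpoly K[2]})
    (mu : efun R {mpoly K[2]}) : efun R I :=
  fun i : I => mu (h i).

End Analytic.

Section Polyhedra.
Context {R : realType}.

Definition intr_row n (v : 'rV[int]_n) : 'rV[R]_n := map_mx intr v.

Definition rational_polyhedron n (s : set 'rV[R]_n) : Prop :=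
  s !=set0 /\ exists r (A : 'M[int]_(n, r)) (b : 'rV[R]_r),
    s = [set x | forall j, (x *m map_mx intr A) 0 j <= b 0 j].

Definition face n (t s : set 'rV[R]_n) : Prop :=
  t !=set0 /\ exists u : 'cV[R]_n,
    t = [set x | s x /\ forall y, s y -> (x *m u) 0 0 <= (y *m u) 0 0].

(* The linear space parallel to the affine span of s, for s convex. *)
Definition direction n (s : set 'rV[R]_n) : set 'rV[R]_n :=
  [set v | exists c x y, [/\ s x, s y & v = c *: (x - y)]].

Definition has_dim n (s : set 'rV[R]_n) (k : nat) : Prop :=
  exists2 B : 'M[R]_(k, n), row_free B &
    direction s = [set v | (v <= B)%MS].

(* v generates the lattice of s modulo that of its face t, and points from t
   into s. *)
Definition primitive_normal n (t s : set 'rV[R]_n) (v : 'rV[int]_n) : Prop :=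
  [/\ direction s (intr_row v),
      forall u : 'rV[int]_n, direction s (intr_row u) ->
        exists k : int, direction t (intr_row (u - k *: v))
    & exists2 x, t x & exists2 e, 0 < e & s (x + e *: intr_row v)].

(* A weighted complex is given by the weights of its facets; all other sets
   have weight 0. *)
Definition wcomplex n : Type := set 'rV[R]_n -> nat.

Definition facets n (C : wcomplex n) : set (set 'rV[R]_n) :=
  [set s | C s != 0%N].

Definition supp n (C : wcomplex n) : set 'rV[R]_n :=
  \bigcup_(s in facets C) s.

Definition polyhedral_surface n (C : wcomplex n) : Prop :=
  [/\ finite_set (facets C),
      forall s, facets C s -> rational_polyhedron s /\ has_dim s 2
    & forall s s', facets C s -> facets C s' ->
        s `&` s' = set0 \/ face (s `&` s') s /\ face (s `&` s') s'].

Definition edges n (C : wcomplex n) : set (set 'rV[R]_n) :=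
  [set t | has_dim t 1 /\ exists2 s, facets C s & face t s].

Definition refines n (D C : wcomplex n) : Prop :=
  supp D = supp C /\
  forall s, facets D s -> exists2 s', facets C s' & s `<=` s' /\ D s = C s'.

Definition balanced_at n (C : wcomplex n) (t : set 'rV[R]_n) : Prop :=
  exists2 v : set 'rV[R]_n -> 'rV[int]_n,
    (forall s, facets C s -> t `<=` s -> primitive_normal t s (v s)) &
    direction t
      (\sum_(s \in [set s | facets C s /\ t `<=` s])
         (C s)%:R *: intr_row (v s)).

Record tpoly n : Type := TPoly {
  tp_size : nat;
  tp_coef : 'I_tp_size.+1 -> R;
  tp_expo : 'I_tp_size.+1 -> 'X_{1..n} }.

Definition tp_term n (P : tpoly n) (i : 'I_(tp_size P).+1) (x : 'rV[R]_n) : R :=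
  tp_coef i + \sum_j x 0 j *+ tp_expo i j.
Arguments tp_term {n} P i x.

Definition tp_eval n (P : tpoly n) (x : 'rV[R]_n) : R :=
  \big[Num.min/tp_term P ord0 x]_i tp_term P i x.

Definition append n (x : 'rV[R]_n) (y : R) : 'rV[R]_n.+1 :=
  \row_j oapp (fun k => x 0 k) y (unlift ord_max j).

Definition truncate n (x : 'rV[R]_n.+1) : 'rV[R]_n :=
  \row_j x 0 (lift ord_max j).

Definition graph_map n (P : tpoly n) (x : 'rV[R]_n) : 'rV[R]_n.+1 :=
  append x (tp_eval P x).

Definition graph_complex n (C : wcomplex n) (P : tpoly n) : wcomplex n.+1 :=
  fun s' => let s := @truncate n @` s' in
            if `[< s' = graph_map P @` s >] then C s else 0%N.

(* The facet that starts at the graph over t, in direction e_{n+1}. *)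
Definition up_facet n (P : tpoly n) (t : set 'rV[R]_n) : set 'rV[R]_n.+1 :=
  [set z | exists x y, [/\ t x, tp_eval P x <= y & z = append x y]].

Definition unbalanced_edge n (C : wcomplex n) (P : tpoly n) :
    set (set 'rV[R]_n) :=
  [set t | edges C t /\ ~ balanced_at (graph_complex C P) (graph_map P @` t)].

(* P is affine on every facet of C, and C' is the graph of P completed at the
   edges where it is not balanced. *)
Definition completed_graph n (C : wcomplex n) (P : tpoly n)
    (C' : wcomplex n.+1) : Prop :=
  [/\ forall s, facets C s ->
        exists i, forall x, s x -> tp_eval P x = tp_term P i x,
      forall s, facets C s -> C' (graph_map P @` s) = C s,
      forall t, unbalanced_edge C P t ->
        (0 < C' (up_facet P t))%N /\ balanced_at C' (graph_map P @` t)
    & forall s', facets C' s' ->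
        (exists2 s, facets C s & s' = graph_map P @` s) \/
        (exists2 t, unbalanced_edge C P t & s' = up_facet P t)].

Definition modification n (C : wcomplex n) (P : tpoly n) (C' : wcomplex n.+1) :
    Prop :=
  exists D, [/\ polyhedral_surface D, refines D C & completed_graph D P C'].

(* At least one facet has been added. *)
Definition proper_modification n (C : wcomplex n) (P : tpoly n)
    (C' : wcomplex n.+1) : Prop :=
  modification C P C' /\ ~ supp C' `<=` range (graph_map P).

Definition tropical_plane : wcomplex 2 := fun s => (s == setT) : nat.

Inductive iterated_modification : forall n, wcomplex n -> Prop :=
| iterated_modification0 : iterated_modification tropical_plane
| iterated_modificationS n (C : wcomplex n) (P : tpoly n) (C' : wcomplex n.+1) :
    iterated_modification C -> modification C P C' ->
    iterated_modification C'.

Definition matroid_circuits N (M : {set {set 'I_N}}) : Prop :=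
  [/\ finset.set0 \notin M,
      forall A B, A \in M -> B \in M -> A \subset B -> A = B
    & forall A B x, A \in M -> B \in M -> A != B -> x \in A :&: B ->
        exists2 E, E \in M & E \subset (A :|: B) :\ x].

(* Bergman fan (min convention) of the matroid with circuits M, before taking
   the quotient of R^N by the line spanned by (1, ..., 1). *)
Definition bergman_fan N (M : {set {set 'I_N}}) : set 'rV[R]_N :=
  [set w | forall A, A \in M -> exists i j,
    [/\ i \in A, j \in A, i != j, w 0 i = w 0 j
      & forall k, k \in A -> w 0 i <= w 0 k]].

Definition star n (X : set 'rV[R]_n) (x : 'rV[R]_n) : set 'rV[R]_n :=
  [set v | exists2 e, 0 < e & forall t, 0 <= t <= e -> X (x + t *: v)].

(* All weights are 1 and, around every point of R^n, the surface is isomorphic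
   over the integers to the Bergman fan of a matroid in R^N / (1, ..., 1): phi
   and psi induce mutually inverse bijections between the two fans. *)
Definition nonsingular n (C : wcomplex n) : Prop :=
  (forall s, (C s <= 1)%N) /\
  forall x, supp C x ->
  exists N (M : {set {set 'I_N}}) (phi : 'M[int]_(n, N)) (psi : 'M[int]_(N, n)),
    let phiR : 'M[R]_(n, N) := map_mx intr phi in
    let psiR : 'M[R]_(N, n) := map_mx intr psi in
    [/\ matroid_circuits M,
        const_mx 1 *m psiR = 0 :> 'rV[R]_n,
        forall v, star (supp C) x v ->
          bergman_fan M (v *m phiR) /\ v *m phiR *m psiR = v
      & forall w, bergman_fan M w -> star (supp C) x (w *m psiR) /\
          exists c : R, w *m psiR *m phiR = w + const_mx c].

End Polyhedra.

Arguments wcomplex : clear implicits.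

Section TropicalHopf.
Context {R : realType}.

Definition tspace (I : Type) : set (efun R I) :=
  [set w : I -> \bar R | forall i, w i != -oo%E].
Arguments tspace I : clear implicits.

Definition tinfty (I : Type) : efun R I := fun _ : I => +oo%E.
Arguments tinfty I : clear implicits.

Definition finite_point n (x : 'rV[R]_n) : efun R 'I_n :=
  fun i : 'I_n => (x 0 i)%:E.

Definition tsurface n (C : wcomplex R n) : set (efun R 'I_n) :=
  closure (@finite_point n @` supp C) `&` tspace 'I_n.

Definition perm_translation n (s : {perm 'I_n}) (c : 'I_n -> R)
    (w : efun R 'I_n) : efun R 'I_n :=
  fun i : 'I_n => (w (s i) + (c i)%:E)%E.

Definition tropical_hopf n (X : set (efun R 'I_n))
    (F : efun R 'I_n -> efun R 'I_n) : Prop :=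
  exists (C : wcomplex R n) (s : {perm 'I_n}) (c : 'I_n -> R),
    [/\ iterated_modification C /\ nonsingular C,
        X = tsurface C, F = perm_translation s c,
        contracting_at (tspace 'I_n) F (tinfty 'I_n)
      & F @` X = X].

(* The i-th surface lies in T^(i+2), and the projection to the previous one
   forgets the last coordinate: the inverse limit lies in T^nat. *)
Definition inverse_limit (C : forall i, wcomplex R i.+2) : set (efun R nat) :=
  [set w : nat -> \bar R | forall i,
    tsurface (C i) (fun j : 'I_i.+2 => w j)].

Definition integer_affine (X : set (efun R nat))
    (F : efun R nat -> efun R nat) : Prop :=
  forall i : nat, exists N (a : 'I_N -> int) (c : R),
    forall w, X w -> (forall j : nat, w j \is a fin_num) ->
      F w i = (c + \sum_(j < N) (a j)%:~R * fine (w j))%:E.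

Definition integer_affine_map (X : set (efun R nat))
    (F : efun R nat -> efun R nat) : Prop :=
  [/\ forall w, X w -> X (F w), {within X, continuous F} & integer_affine X F].

Definition integer_affine_automorphism (X : set (efun R nat))
    (F : efun R nat -> efun R nat) : Prop :=
  integer_affine_map X F /\
  exists2 G, integer_affine_map X G &
    forall w, X w -> G (F w) = w /\ F (G w) = w.

(* Non-compact refers to the infinite sequence of modifications, each of which
   adds a facet, and not to the topology of the orbit space, which is compact
   as soon as it is a retract of a compact space. *)
Definition noncompact_tropical_hopf (X : set (efun R nat))
    (F : efun R nat -> efun R nat) : Prop :=
  exists C : forall i, wcomplex R i.+2,
    [/\ C 0%N = tropical_plane,
        forall i, exists P, proper_modification (C i) P (C i.+1),
        X = inverse_limit C,
        integer_affine_automorphism X F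
      & contracting_at X F (tinfty nat)].

End TropicalHopf.

Arguments tspace {R} I _.
Arguments tinfty {R} I _.

Section Retraction.
Context (R : realType) (K : closedFieldType) (nu : K -> \bar R).

(* rho is the continuous map induced by mu |-> (mu (h i))_i and s is a
   continuous section of it. *)
Definition tropical_retraction (g : 2.-tuple {mpoly K[2]}) (I : Type)
    (h : I -> {mpoly K[2]}) (X : set (efun R I)) (F : efun R I -> efun R I) :
    Prop :=
  let Xf := analytic_hopf nu g in
  let S := orbit_space (X `\ tinfty I) F in
  exists (rho : Xf -> S) (s : S -> Xf),
    [/\ continuous rho, continuous s, cancel s rho
      & forall mu : A2an nu `\ A2an_origin nu,
          exists2 w : X `\ tinfty I,
            set_val w = tropicalization h (set_val mu) &
            rho (orbit_of (push g) mu) = orbit_of F w].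

Definition retracts_to_tropical_hopf (g : 2.-tuple {mpoly K[2]}) : Prop :=
  exists n (h : n.-tuple {mpoly K[2]}) X F,
    [/\ tropical_hopf X F, embedding h
      & tropical_retraction g (tnth h) X F].

Definition retracts_to_noncompact_tropical_hopf
    (g : 2.-tuple {mpoly K[2]}) : Prop :=
  exists (h : nat -> {mpoly K[2]}) X F,
    [/\ noncompact_tropical_hopf X F,
        forall i, embedding [tuple h j | j < i.+2]
      & tropical_retraction g h X F].

End Retraction.

(* Main.v *)
Require Import Defs.
From mathcomp Require Import all_boot all_order all_algebra all_fingroup.
From mathcomp Require Import mpoly.
From mathcomp Require Import all_classical all_reals.
From mathcomp Require Import finmap ereal topology normedtype ring lra.

(** The retraction is onto the image of a least section of tropicalization. A
    point w of the tropical surface prescribes weights for x1 and for one of the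
    curves x2 + b x1^M, hence a monomial valuation ([gauss], [monomial_val]), and
    this valuation lies below every semivaluation whose tropicalization is at
    least w in these two coordinates ([monomial_min]). The least semivaluation
    over w is the supremum of the monomial valuations obtained from the
    coordinates in use. Minimality makes the section equivariant: pushing forward
    by the automorphism and by its inverse are monotone maps between the fibres,
    so they exchange the least elements ([sec_push]), and the section and the
    tropicalization descend to the orbit spaces ([least_section_retraction]).

    Conjugate germs have similar linear parts, so lam and mu are nonzero and have
    positive value ([normal_form_contracting]). If eps = 0, the automorphism
    scales x1 and x2, the surface is T^2, and the translation by the values of
    lam and mu contracts it ([diagonal_retracts]).

    If eps is not 0, then mu = lam^M and, with c = eps / lam^M, composition with
    the automorphism turns x2 + b x1^M into lam^M (x2 + (b + c) x1^M). The curves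
    with b in Z c are thus permuted up to scalars, and their values are shifted
    and translated ([trop_normal_form]). For two centers b and b', the minimum of
    the values of the two curves and of M w_0 + nu (b - b') is attained twice.
    These relations cut out the product of a line with the tree spanned by the
    centers in the ultrametric distance ([ultra_rel], [tsurface_tree]). Adding a
    center grafts a ray on this tree, at the point where the path to the new
    center leaves the path to the nearest old one; this is a tropical
    modification along a minimum of two terms ([tree_modification]). All
    distances are bounded below by nu c, so that two coordinates control the
    neighbourhoods of infinity ([shift_contracting]).

    It remains to see that the section is continuous, although it is a supremum
    of infinitely many functions ([tower_continuous_all]). The parts of a
    polynomial that are quasihomogeneous for the weights (1, M) do not interact,
    and each is a constant times a power of x1 times curves x2 + z x1^M since K
    is algebraically closed. For one such curve, either some coordinate already
    determines the value near the given point, or an upper bound that depends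
    on w_0 only is attained at this point ([tower_continuous_parabola]). *)

Set Implicit Arguments.
Unset Strict Implicit.
Unset Printing Implicit Defensive.

Import Order.TTheory GRing.Theory Num.Theory.

Local Open Scope classical_set_scope.
Local Open Scope ring_scope.

(** * Semivaluations and monomial valuations *)

Section Valuations.
Context (R : realType) (K : closedFieldType) (nu : K -> \bar R).
Hypothesis nuP : valuation nu.

Local Notation A2 := (A2an nu).
Implicit Types (mu : efun R {mpoly K[2]}) (p q : {mpoly K[2]}).

Lemma adde_Nny (x y : \bar R) : x != -oo%E -> y != -oo%E -> (x + y)%E != -oo%E.
Proof. by rewrite adde_eq_ninfty negb_or => -> ->. Qed.

Lemma natmule_Nny (x : \bar R) n : x != -oo%E -> (x *+ n)%E != -oo%E.
Proof.
move=> xN; elim: n => [|n IH]; first by rewrite mule0n.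
by rewrite muleS adde_Nny.
Qed.

Lemma le_natmule (x y : \bar R) n : (x <= y)%E -> (x *+ n <= y *+ n)%E.
Proof.
by move=> xy; elim: n => [|n IH]; rewrite ?mule0n // !muleS leeD.
Qed.

Lemma natmuleD (x y : \bar R) n : ((x + y) *+ n = x *+ n + y *+ n)%E.
Proof. by elim: n => [|n IH]; rewrite ?mule0n ?adde0 // !muleS IH addeACA. Qed.

Lemma natmuleDr (x : \bar R) m n : (x *+ (m + n) = x *+ m + x *+ n)%E.
Proof.
by elim: m => [|m IH]; rewrite ?mule0n ?add0e // addSn !muleS IH addeA.
Qed.

Lemma nu0 : nu 0 = +oo%E. Proof. by case: nuP => _ /(_ 0)[_ ->]. Qed.

Lemma nu_neqNy x : nu x != -oo%E. Proof. by case: nuP. Qed.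

Lemma nu_fin x : x != 0 -> nu x \is a fin_num.
Proof.
move=> x0; rewrite fin_numE nu_neqNy /=.
by apply/eqP => h; case: nuP => _ /(_ x)[/(_ h) xe]; rewrite xe eqxx in x0.
Qed.

Lemma nu1 : nu 1 = 0%E.
Proof.
have := nu_fin (oner_neq0 K); case: nuP => _ _ /(_ 1 1).
rewrite mulr1; case: (nu 1) => //= r [] h _ _.
by congr (_%:E); apply: (addrI r); rewrite addr0 -h.
Qed.

Lemma nuN1 : nu (- 1) = 0%E.
Proof.
have N10 : (- 1 : K) != 0 by rewrite oppr_eq0 oner_neq0.
have := nu_fin N10; case: nuP => _ _ /(_ (-1) (-1)).
rewrite mulrNN mulr1 nu1; case: (nu (-1)) => //= r [] h _ _.
by congr (_%:E); apply/eqP; move/esym/eqP: h; rewrite -mulr2n mulrn_eq0.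
Qed.

Section OneValuation.
Variable (mu : efun R {mpoly K[2]}).
Hypothesis muA : A2 mu.

Lemma A2_Nny p : mu p != -oo%E. Proof. by case: muA. Qed.

Lemma A2C c : mu c%:MP = nu c. Proof. by case: muA. Qed.

Lemma A2M p q : mu (p * q) = (mu p + mu q)%E. Proof. by case: muA. Qed.

Lemma A2D p q : (Order.min (mu p) (mu q) <= mu (p + q)%R)%E.
Proof. by case: muA. Qed.

Lemma A20 : mu 0 = +oo%E. Proof. by rewrite -mpolyC0 A2C nu0. Qed.

Lemma A21 : mu 1 = 0%E. Proof. by rewrite -mpolyC1 A2C nu1. Qed.

Lemma A2Z c p : mu (c *: p) = (nu c + mu p)%E.
Proof. by rewrite -mul_mpolyC A2M A2C. Qed.

Lemma A2N p : mu (- p) = mu p.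
Proof. by rewrite -scaleN1r A2Z nuN1 add0e. Qed.

Lemma A2X p n : mu (p ^+ n) = (mu p *+ n)%E.
Proof.
by elim: n => [|n IH]; rewrite ?expr0 ?A21 ?mule0n // exprS A2M IH muleS.
Qed.

Lemma A2_sum (I : eqType) (s : seq I) (P : pred I) (F : I -> {mpoly K[2]}) x :
  (forall i, i \in s -> P i -> (x <= mu (F i))%E) ->
  (x <= mu (\sum_(i <- s | P i) F i)%R)%E.
Proof.
move=> h; rewrite big_seq_cond; elim/big_ind: _ => [|p q xp xq|i /andP[]].
- by rewrite A20 leey.
- by apply: le_trans (A2D p q); rewrite le_min xp.
- exact: h.
Qed.

Lemma A2_ltD p q : (mu p < mu q)%E -> mu (p + q) = mu p.
Proof.
move=> pq; apply/eqP; rewrite eq_le; apply/andP; split; last first.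
  by apply: le_trans (A2D p q); rewrite le_min lexx ltW.
have := A2D (p + q) (- q); rewrite addrK A2N minElt.
by case: ifP => // _; rewrite leNgt pq.
Qed.

Lemma A2D_neq p q : mu p != mu q -> mu (p + q) = Order.min (mu p) (mu q).
Proof.
rewrite neq_lt => /orP[] h; first by rewrite A2_ltD // min_l // ltW.
by rewrite addrC A2_ltD // min_r // ltW.
Qed.

End OneValuation.

Section Gauss.
Context (t s : \bar R).
Hypotheses (tN : t != -oo%E) (sN : s != -oo%E).

Definition weight (m : 'X_{1..2}) : \bar R :=
  (t *+ m ord0 + s *+ m ord_max)%E.

Definition gauss : efun R {mpoly K[2]} := fun p : {mpoly K[2]} =>
  \big[Order.min/+oo%E]_(m <- msupp p) (nu p@_m + weight m)%E.

Lemma weight_Nny m : weight m != -oo%E.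
Proof. by rewrite adde_Nny ?natmule_Nny. Qed.

Lemma weightD m n : weight (m + n)%MM = (weight m + weight n)%E.
Proof. by rewrite /weight !mnmDE !natmuleDr addeACA. Qed.

Lemma gauss_ge p x :
  (forall m, x <= nu p@_m + weight m)%E -> (x <= gauss p)%E.
Proof.
move=> h; rewrite /gauss; elim/big_ind: _ => [|y z xy xz|m _].
- exact: leey.
- by rewrite le_min xy.
- exact: h.
Qed.

Lemma gauss_le p m : (gauss p <= nu p@_m + weight m)%E.
Proof.
have [mp|mp] := boolP (m \in msupp p); last first.
  by rewrite (memN_msupp_eq0 mp) nu0 addye ?leey // weight_Nny.
by rewrite /gauss (big_rem m) //= ge_min lexx.
Qed.

Lemma gaussP p : gauss p = +oo%E \/
  exists2 m, m \in msupp p & gauss p = (nu p@_m + weight m)%E.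
Proof.
rewrite /gauss; have : {subset msupp p <= msupp p} by [].
move: {1 3 5}(msupp p) => l; elim: l => [|m l IH] sub.
  by left; rewrite big_nil.
rewrite big_cons minEle; case: ifP => _.
  by right; exists m => //; apply: sub; rewrite mem_head.
by apply: IH => x xl; apply: sub; rewrite in_cons xl orbT.
Qed.

Lemma gauss_Nny p : gauss p != -oo%E.
Proof.
by case: (gaussP p) => [->|[m _ ->]] //; rewrite adde_Nny ?weight_Nny ?nu_neqNy.
Qed.

Definition sub_mpoly (P : pred 'X_{1..2}) p : {mpoly K[2]} :=
  \sum_(m <- msupp p | P m) p@_m *: 'X_[m].

Lemma mcoeff_sub P p m : (sub_mpoly P p)@_m = if P m then p@_m else 0.
Proof.
rewrite /sub_mpoly linear_sum /=.
under eq_bigr do rewrite mcoeffZ mcoeffX.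
have [mp|mp] := boolP (m \in msupp p).
  rewrite big_mkcond (big_rem m) //= eqxx mulr1 big_seq big1 ?addr0 // => i.
  rewrite mem_rem_uniq // !inE => /andP[/negPf -> _].
  by rewrite mulr0 if_same.
rewrite (memN_msupp_eq0 mp) if_same big_seq_cond big1 // => i /andP[ip _].
case: eqP => [e|_]; last by rewrite mulr0.
by rewrite -e ip in mp.
Qed.

Lemma nuD_ge a b w x : (x <= nu a + w)%E -> (x <= nu b + w)%E ->
  (x <= nu (a + b)%R + w)%E.
Proof.
move=> xa xb; case: nuP => _ _ _ /(_ a b); rewrite minElt.
by case: ifP => _ h; [apply: le_trans xa _|apply: le_trans xb _];
  rewrite leeD2r.
Qed.

Lemma gaussD p q : (Order.min (gauss p) (gauss q) <= gauss (p + q)%R)%E.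
Proof.
apply: gauss_ge => m; rewrite mcoeffD; apply: nuD_ge.
  by rewrite ge_min gauss_le.
by rewrite ge_min gauss_le orbT.
Qed.

Lemma nuM x y : nu (x * y) = (nu x + nu y)%E. Proof. by case: nuP. Qed.

Lemma gaussM_ge p q : (gauss p + gauss q <= gauss (p * q)%R)%E.
Proof.
apply: gauss_ge => m; rewrite mcoeffM.
elim/big_ind: _ => [|a b|k /eqP mk].
- by rewrite nu0 addye ?leey // weight_Nny.
- exact: nuD_ge.
by rewrite [in weight _]mk nuM weightD addeACA leeD // gauss_le.
Qed.

Lemma gauss_gt p x : (x < +oo)%E ->
  (forall m, m \in msupp p -> x < nu p@_m + weight m)%E -> (x < gauss p)%E.
Proof. by move=> xy h; case: (gaussP p) => [->|[m /h + ->]]. Qed.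

(** A polynomial is the sum of its terms of least value and of a polynomial of
    larger value; the leading coefficients of the parts of least value multiply
    without cancellation. *)
Lemma gaussM p q : gauss (p * q) = (gauss p + gauss q)%E.
Proof.
apply/eqP; rewrite eq_le gaussM_ge andbT.
have [->|pf] := eqVneq (gauss p) +oo%E; first by rewrite addye ?leey ?gauss_Nny.
have [->|qf] := eqVneq (gauss q) +oo%E; first by rewrite addey ?leey ?gauss_Nny.
have fin r : gauss r != +oo%E -> gauss r \is a fin_num.
  by move=> ?; rewrite fin_numE gauss_Nny.
(* The part of least value. *)
pose least r : {mpoly K[2]} :=
  sub_mpoly (fun m => nu r@_m + weight m == gauss r)%E r.
have rest r : gauss r != +oo%E -> (gauss r < gauss (r - least r)%R)%E.
  move=> rf; apply: gauss_gt => [|m]; first by rewrite ltey.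
  rewrite mcoeff_msupp mcoeffB mcoeff_sub; case: ifP => [|ne _].
    by rewrite subrr eqxx.
  by rewrite subr0 lt_neqAle eq_sym ne gauss_le.
have leastP r : gauss r != +oo%E ->
    (nu (least r)@_(mlead (least r)) + weight (mlead (least r)))%E = gauss r.
  move=> rf; have nz : least r != 0.
    case: (gaussP r) => [e|[m mr e]]; first by rewrite e in rf.
    apply/eqP => /(congr1 (mcoeff m)); rewrite mcoeff_sub -e eqxx mcoeff0.
    by apply/eqP; rewrite -mcoeff_msupp.
  have := mlead_supp nz; rewrite mcoeff_msupp mcoeff_sub.
  by case: ifP => [/eqP ->|_]; rewrite ?eqxx.
have least_ge r : gauss r != +oo%E -> (gauss r <= gauss (least r))%E.
  move=> rf; apply: gauss_ge => m; rewrite mcoeff_sub.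
  case: ifP => [/eqP -> //|_]; by rewrite nu0 addye ?leey ?weight_Nny.
set p' := least p; set q' := least q.
have e : p * q = p' * q' + ((p - p') * q' + p * (q - q')).
  by ring.
set M := (mlead p' + mlead q')%MM.
have main : (nu (p' * q')%R@_M + weight M = gauss p + gauss q)%E.
  by rewrite mleadcM nuM weightD addeACA !leastP.
have small : (gauss p + gauss q < nu ((p - p') * q' + p * (q - q'))%R@_M + weight M)%E.
  apply: lt_le_trans (gauss_le _ _); apply: lt_le_trans (gaussD _ _).
  rewrite lt_min; apply/andP; split; apply: lt_le_trans (gaussM_ge _ _).
    by apply: lte_leD; rewrite ?rest ?least_ge ?fin.
  by apply: lee_ltD; rewrite ?rest ?fin.
(* Finiteness of the weight turns the strict inequality between the values of the
   terms into one between the values of the coefficients. *)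
have wf : weight M \is a fin_num.
  have : (gauss p + gauss q)%E \is a fin_num by rewrite fin_numD !fin.
  by rewrite -main fin_numD => /andP[].
rewrite -main; apply: le_trans (gauss_le _ M) _.
rewrite leeD2rE // {1}e mcoeffD.
have lt : (nu (p' * q')%R@_M < nu ((p - p') * q' + p * (q - q'))%R@_M)%E.
  by rewrite -(lteD2rE _ _ wf) main.
set a := (p' * q')@_M in lt *; set b := (X in nu (a + X)); rewrite -/b in lt.
case: nuP => _ _ _ /(_ (a + b) (- b)); rewrite addrK.
rewrite -mulN1r nuM nuN1 add0e minElt; case: ifP => // _.
by rewrite leNgt lt.
Qed.

Lemma A2_gauss : A2 gauss.
Proof.
split.
- exact: gauss_Nny.
- move=> c; rewrite /gauss msuppC; case: eqP => [->|_].
    by rewrite big_nil nu0.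
  rewrite big_seq1 mcoeffC eqxx mulr1 /weight !mnm0E !mule0n !adde0.
  by [].
- exact: gaussM.
- exact: gaussD.
Qed.

Lemma gaussX m : gauss 'X_[m] = weight m.
Proof. by rewrite /gauss msuppX big_seq1 mcoeffX eqxx nu1 add0e. Qed.

Lemma mpolyX2 (m : 'X_{1..2}) :
  'X_[m] = 'X_ord0 ^+ m ord0 * 'X_ord_max ^+ m ord_max :> {mpoly K[2]}.
Proof.
by rewrite mpolyXE_id big_ord_recl big_ord1; congr (_ * 'X_ _ ^+ m _); apply: val_inj.
Qed.

(** Monomial valuations are the least ones with the given values of the two
    variables; this is the source of the minimality of all sections below. *)
Lemma gauss_min mu p : A2 mu -> (t <= mu 'X_ord0)%E -> (s <= mu 'X_ord_max)%E ->
  (gauss p <= mu p)%E.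
Proof.
move=> muA tx sy; rewrite {2}(mpolyE p).
apply: A2_sum => // m _ _; apply: le_trans (gauss_le p m) _.
by rewrite A2Z // mpolyX2 A2M // !A2X // leeD2l // leeD // le_natmule.
Qed.

End Gauss.

End Valuations.

(** * Monomial valuations along parabolas *)

Section Composition.
Context (K : closedFieldType).

Lemma comp_mpoly_tuple n k l (p : {mpoly K[n]}) (g : n.-tuple {mpoly K[k]})
    (g' : k.-tuple {mpoly K[l]}) :
  (p \mPo g) \mPo g' = p \mPo [tuple tnth g i \mPo g' | i < n].
Proof.
rewrite (mpolyE p) (raddf_sum (comp_mpoly g)) (raddf_sum (comp_mpoly g')).
rewrite (raddf_sum (comp_mpoly [tuple _ | i < n])) /=; apply: eq_bigr => m _.
rewrite !comp_mpolyZ !comp_mpolyX rmorph_prod /=; congr (_ *: _).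
by apply: eq_bigr => i _; rewrite rmorphXn /= tnth_mktuple.
Qed.

Lemma eq_tuple2 (T : Type) (g g' : 2.-tuple T) :
  tnth g ord0 = tnth g' ord0 -> tnth g ord_max = tnth g' ord_max -> g = g'.
Proof.
move=> e0 e1; apply: eq_from_tnth => i.
case: (unliftP ord_max i) => [j|] -> //; rewrite ord1.
by have -> : lift ord_max ord0 = ord0 :> 'I_2 by apply: val_inj.
Qed.

Lemma comp_mpolyX0 k (f0 f1 : {mpoly K[k]}) : 'X_ord0 \mPo [tuple f0; f1] = f0.
Proof. by rewrite comp_mpolyXU. Qed.

Lemma comp_mpolyX1 k (f0 f1 : {mpoly K[k]}) : 'X_ord_max \mPo [tuple f0; f1] = f1.
Proof. by rewrite comp_mpolyXU. Qed.

Lemma comp_mpoly_id2 (p : {mpoly K[2]}) (g : 2.-tuple {mpoly K[2]}) :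
  tnth g ord0 = 'X_ord0 -> tnth g ord_max = 'X_ord_max -> p \mPo g = p.
Proof.
move=> e0 e1; rewrite -[RHS]comp_mpoly_id; congr (_ \mPo _).
by apply: eq_tuple2; rewrite tnth_mktuple.
Qed.

Lemma comp_mpoly_cancel (g g' : 2.-tuple {mpoly K[2]}) :
  tnth g ord0 \mPo g' = 'X_ord0 -> tnth g ord_max \mPo g' = 'X_ord_max ->
  forall p, (p \mPo g) \mPo g' = p.
Proof.
move=> e0 e1 p; rewrite comp_mpoly_tuple.
by apply: comp_mpoly_id2; rewrite tnth_mktuple.
Qed.

Definition shear (M : nat) (a : K) : 2.-tuple {mpoly K[2]} :=
  [tuple 'X_ord0; 'X_ord_max + a *: 'X_ord0 ^+ M].

Lemma comp_shear M a b p : (p \mPo shear M a) \mPo shear M b = p \mPo shear M (a + b).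
Proof.
rewrite comp_mpoly_tuple; congr (_ \mPo _); apply: eq_tuple2.
  by rewrite tnth_mktuple !(tnth_nth 0) /= comp_mpolyX0.
rewrite tnth_mktuple !(tnth_nth 0) /= linearD linearZ rmorphXn /=.
by rewrite comp_mpolyX0 comp_mpolyX1 scalerDl -addrA [X in _ + X]addrC.
Qed.

Lemma comp_shear0 M p : p \mPo shear M 0 = p.
Proof. by apply: comp_mpoly_id2; rewrite !(tnth_nth 0) /= ?scale0r ?addr0. Qed.

Lemma shearK M a p : (p \mPo shear M (- a)) \mPo shear M a = p.
Proof. by rewrite comp_shear addNr comp_shear0. Qed.

End Composition.

Section Push.
Context (R : realType) (K : closedFieldType) (nu : K -> \bar R).
Hypothesis nuP : valuation nu.
Local Notation A2 := (A2an nu).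

Lemma A2_push (g : 2.-tuple {mpoly K[2]}) (mu : efun R {mpoly K[2]}) :
  A2 mu -> A2 (push g mu).
Proof.
move=> muA; split; rewrite /push.
- by move=> p; apply: A2_Nny muA _.
- by move=> c; rewrite comp_mpolyC (A2C muA).
- by move=> p q; rewrite rmorphM (A2M muA).
- by move=> p q; rewrite linearD; apply: A2D muA _ _.
Qed.

Section Monomial.
Context (M : nat) (a : K) (t s : \bar R).
Hypotheses (tN : t != -oo%E) (sN : s != -oo%E).

(** The monomial valuation in the coordinates x1 and x2 + a x1^M. *)
Definition monomial_val : efun R {mpoly K[2]} :=
  push (shear M (- a)) (gauss nu t s).

Lemma A2_monomial : A2 monomial_val.
Proof. by apply: A2_push; apply: A2_gauss. Qed.

(** Transported from the two variables by the shear that straightens the curve. *)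
Lemma monomial_min mu p : A2 mu -> (t <= mu 'X_ord0)%E ->
  (s <= mu ('X_ord_max + a *: 'X_ord0 ^+ M)%R)%E -> (monomial_val p <= mu p)%E.
Proof.
move=> muA tx sy; rewrite -[in leRHS](shearK M a p).
apply: (gauss_min nuP tN sN _ (A2_push (shear M a) muA)).
  by rewrite /push comp_mpolyX0.
by rewrite /push comp_mpolyX1.
Qed.

Lemma monomial_x : monomial_val 'X_ord0 = t.
Proof.
rewrite /monomial_val /push comp_mpolyX0 gaussX // /weight.
by rewrite !mnm1E /= ?mule0n adde0.
Qed.

(** The curves with centers b and a differ by (b - a) x1^M, which is a second
    monomial in the straightened coordinates. *)
Lemma monomial_y b : monomial_val ('X_ord_max + b *: 'X_ord0 ^+ M) =
  Order.min s (t *+ M + nu (b - a)%R)%E.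
Proof.
rewrite /monomial_val /push linearD linearZ rmorphXn /= comp_mpolyX0 comp_mpolyX1.
rewrite -addrA -scalerDl [- a + b]addrC; set c := b - a.
have -> : 'X_ord0 ^+ M = 'X_[U_(ord0) *+ M] :> {mpoly K[2]} by rewrite mpolyXn.
set m0 := (U_(ord0) *+ M)%MM.
have m01 : m0 != U_(ord_max)%MM.
  apply/eqP => /mnmP /(_ ord_max).
  by rewrite mulmnE !mnm1E /=.
have w0 : weight t s m0 = (t *+ M)%E.
  by rewrite /weight !mulmnE !mnm1E /= ?mul1n ?mul0n ?mule0n adde0.
have w1 : weight t s U_(ord_max) = s.
  by rewrite /weight !mnm1E /= ?mule0n add0e.
have gA := A2_gauss nuP tN sN.
apply/eqP; rewrite eq_le; apply/andP; split.
  rewrite le_min; apply/andP; split.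
    apply: le_trans (gauss_le nuP tN sN _ U_(ord_max)%MM) _.
    rewrite w1 mcoeffD mcoeffZ !mcoeffX eqxx (negPf m01) mulr0 addr0.
    by rewrite (nu1 nuP) add0e.
  apply: le_trans (gauss_le nuP tN sN _ m0) _.
  rewrite w0 mcoeffD mcoeffZ !mcoeffX eqxx eq_sym (negPf m01) mulr1 add0r.
  by rewrite addeC.
apply: le_trans (A2D gA _ _).
by rewrite (A2Z gA) !gaussX // w0 w1 addeC.
Qed.

End Monomial.

End Push.

(** * Sections of tropicalization and orbit spaces *)

Section FunctionSpace.
Context {R : realType}.

Lemma efun_cvg (I : Type) (F : set_system (efun R I)) (w : efun R I) :
  Filter F -> (forall i, (fun v : efun R I => v i) @ F --> w i) -> F --> w.
Proof.
move=> FF h; apply/cvg_sup => i A.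
rewrite nbhsE => -[B [[C oC <-] Cw] sBA].
apply: (filterS sBA); apply: (h i); apply: open_nbhs_nbhs; split => //.
Qed.

Lemma efun_continuous (T : topologicalType) I (f : T -> efun R I) :
  (forall i, continuous (fun x => f x i)) -> continuous f.
Proof. by move=> h x; apply: efun_cvg => i; exact: h. Qed.

Lemma eval_continuous I (i : I) : continuous (fun w : efun R I => w i).
Proof.
move=> w A Aw; have FF := @nbhs_filter (efun R I) w.
have : nbhs (w : efun R I) --> (w : efun R I) by [].
move/cvg_sup => /(_ i) h; apply: h.
exact: (@initial_continuous (forall i, \bar R) (\bar R) (fun f => f i) w A Aw).
Qed.

End FunctionSpace.

Section Retract.
Context (R : realType) (K : closedFieldType) (nu : K -> \bar R).
Hypothesis nuP : valuation nu.
Local Notation A2 := (A2an nu).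
Local Notation O := (A2an_origin nu).

Lemma origin_push (g : 2.-tuple {mpoly K[2]}) :
  (forall i, (tnth g i).@[fun=> 0] = 0) -> push g O = O.
Proof.
move=> g0; apply: funext => p; rewrite /push /A2an_origin comp_mpoly_meval.
by congr (nu _); apply: meval_eq.
Qed.

Context (g g' : 2.-tuple {mpoly K[2]}) (I : Type) (h : I -> {mpoly K[2]}).
Context (X : set (efun R I)) (F F' : efun R I -> efun R I).
Context (sec : efun R I -> efun R {mpoly K[2]}).
Local Notation trop := (@tropicalization R K I h).
Local Notation oo := (tinfty I).
Hypothesis gK : forall p, (p \mPo g) \mPo g' = p.
Hypothesis g'K : forall p, (p \mPo g') \mPo g = p.
Hypothesis g'0 : forall i, (tnth g' i).@[fun=> 0] = 0.
Hypothesis h0 : forall i, (h i).@[fun=> 0] = 0.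
Hypothesis tropX : forall mu, A2 mu -> mu <> O -> X (trop mu) /\ trop mu <> oo.
Hypothesis tropF : forall mu, A2 mu -> trop (push g mu) = F (trop mu).
Hypothesis tropF' : forall mu, A2 mu -> trop (push g' mu) = F' (trop mu).
Hypothesis secA : forall w, X w -> w <> oo -> A2 (sec w).
Hypothesis secK : forall w, X w -> w <> oo -> trop (sec w) = w.
Hypothesis sec_min : forall w mu p, X w -> w <> oo -> A2 mu -> trop mu = w ->
  (sec w p <= mu p)%E.
Hypothesis sec_cts : forall p, continuous (fun w : X `\ oo => sec (set_val w) p).

Lemma trop_origin : trop O = oo.
Proof.
by apply: funext => i; rewrite /tropicalization /A2an_origin h0 (nu0 nuP).
Qed.

Lemma sec_neqO w : X w -> w <> oo -> sec w <> O.
Proof. by move=> Xw w0 e; apply: (w0); rewrite -(secK Xw w0) e trop_origin. Qed.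

Lemma pushK (mu : efun R {mpoly K[2]}) : push g' (push g mu) = mu.
Proof. by apply: funext => p; rewrite /push g'K. Qed.

Lemma push_neqO (mu : efun R {mpoly K[2]}) : mu <> O -> push g mu <> O.
Proof. by move=> m0 e; apply: m0; rewrite -[LHS]pushK e origin_push. Qed.

(** The push-forward of the least element over w lies over F w, hence above the
    least element there; applying the inverse automorphism gives the converse
    inequality. *)
Lemma sec_push w : X w -> w <> oo ->
  [/\ X (F w), F w <> oo & push g (sec w) = sec (F w)].
Proof.
move=> Xw w0; have sA := secA Xw w0; have pA := A2_push g sA.
have tp : trop (push g (sec w)) = F w by rewrite tropF // secK.
have := tropX pA (push_neqO (sec_neqO Xw w0)); rewrite tp => -[XF F0].
split=> //; apply: funext => p; apply/eqP; rewrite eq_le.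
rewrite (sec_min _ XF F0 pA tp) andbT.
have F'K : F' (F w) = w by rewrite -tp -tropF' // pushK secK.
have qA := A2_push g' (secA XF F0).
have := sec_min (p \mPo g) Xw w0 qA; rewrite tropF' ?secK //; last exact: secA.
by move=> /(_ F'K); rewrite /push gK.
Qed.

Lemma iter_trop_push (mu : efun R {mpoly K[2]}) k : A2 mu -> trop (iter k (push g) mu) = iter k F (trop mu).
Proof.
move=> muA; suff : A2 (iter k (push g) mu) /\ trop (iter k (push g) mu) = iter k F (trop mu) by case.
elim: k => //= k [kA IH]; split; first exact: A2_push.
by rewrite tropF // IH.
Qed.

Lemma iter_sec_push w k : X w -> w <> oo ->
  iter k (push g) (sec w) = sec (iter k F w).
Proof.
move=> Xw w0; suff : [/\ X (iter k F w), iter k F w <> oo &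
    iter k (push g) (sec w) = sec (iter k F w)] by case.
elim: k => //= k [Xk k0 ->]; have [XF F0 e] := sec_push Xk k0.
by split.
Qed.

Lemma least_section_retraction : tropical_retraction nu g h X F.
Proof.
rewrite /tropical_retraction /analytic_hopf.
set A := A2 `\ O; set B := X `\ oo.
have tB (mu : A) : B (trop (set_val mu)).
  by have [muA mu0] := set_valP mu; apply: tropX.
have sB (w : B) : A (sec (set_val w)).
  have [Xw w0] := set_valP w; split; first exact: secA.
  exact: sec_neqO.
pose t (mu : A) : B := SigSub (mem_set (tB mu)).
pose sg (w : B) : A := SigSub (mem_set (sB w)).
have t_cts : continuous t.
  apply: continuous_comp_initial; apply: efun_continuous => i mu.
  apply: (@continuous_comp A (efun R {mpoly K[2]}) (\bar R) set_val (fun v : efun R {mpoly K[2]} => v (h i))).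
    exact: initial_continuous.
  exact: eval_continuous.
have s_cts : continuous sg.
  by apply: continuous_comp_initial; apply: efun_continuous => p; exact: sec_cts.
pose rho0 := @orbit_of _ B F \o t; pose s0 := @orbit_of _ A (push g) \o sg.
have rho0_cts : continuous rho0.
  by move=> x; apply: continuous_comp; [exact: t_cts|exact: pi_continuous].
have s0_cts : continuous s0.
  by move=> x; apply: continuous_comp; [exact: s_cts|exact: pi_continuous].
have rho0_compat : {homo rho0 : a b / @orbit_of _ A (push g) a == @orbit_of _ A (push g) b >-> a == b}.
  move=> a b /eqP/eqmodP/asboolP[j [k e]].
  apply/eqP/eqmodP/asboolP; exists j, k => /=.
  have [aA _] := set_valP a; have [bA _] := set_valP b.
  by rewrite /= -!iter_trop_push // e.
have s0_compat : {homo s0 : a b / @orbit_of _ B F a == @orbit_of _ B F b >-> a == b}.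
  move=> a b /eqP/eqmodP/asboolP[j [k e]].
  apply/eqP/eqmodP/asboolP; exists j, k => /=.
  have [aX a0] := set_valP a; have [bX b0] := set_valP b.
  by rewrite /= !iter_sec_push // e.
have rhoE a : (rho0 \o generic_quotient.repr) (@orbit_of _ A (push g) a) = rho0 a.
  by apply/eqP/rho0_compat; rewrite /orbit_of reprK.
have sE a : (s0 \o generic_quotient.repr) (@orbit_of _ B F a) = s0 a.
  by apply/eqP/s0_compat; rewrite /orbit_of reprK.
exists (rho0 \o generic_quotient.repr), (s0 \o generic_quotient.repr); split.
- exact: repr_comp_continuous.
- exact: repr_comp_continuous.
- move=> x; rewrite -[in RHS](reprK x) /=.
  rewrite [LHS]rhoE /rho0 /=; congr orbit_of; apply: val_inj => /=.
  by have [Xw w0] := set_valP (generic_quotient.repr x); exact: secK.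
- by move=> mu; exists (t mu) => //; exact: rhoE.
Qed.

End Retract.

(** * Limits in the extended real line *)

Section ExtendedReals.
Context {R : realType}.
Implicit Types x y z : \bar R.

Lemma ereal_between x y : (x < y)%E -> exists r : R, (x < r%:E < y)%E.
Proof.
case: x y => [x| |] [y| |] //= xy.
- rewrite lte_fin in xy; exists ((x + y) / 2).
  by rewrite !lte_fin midf_lt // [_ < y]midf_lt.
- by exists (x + 1); rewrite lte_fin ltrDl ltr01 ltry.
- by exists (y - 1); rewrite ltNyr lte_fin gtrBl ltr01.
- by exists 0; rewrite ltNyr ltry.
Qed.

Lemma cvg_order {T : Type} (F : set_system T) {FF : Filter F} (f : T -> \bar R) l :
  (forall z, (z < l)%E -> \forall x \near F, (z < f x)%E) ->
  (forall z, (l < z)%E -> \forall x \near F, (f x < z)%E) -> f @ F --> l.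
Proof.
move=> lo up A; rewrite itv_nbhsE => -[[a b] [oab lab] sA].
rewrite nbhs_simpl.
suff : \forall x \near F, f x \in Interval a b by apply: filterS => x; exact: sA.
move: oab lab {sA}; case: a b => [[] a|[]] [[] b|[]] //= _;
  rewrite in_itv /= ?andbT => lab.
- case/andP: lab => /lo l1 /up l2; near=> x; rewrite in_itv /=.
  by apply/andP; split; near: x.
- by have l1 := lo _ lab; near=> x; rewrite in_itv /= andbT; near: x.
- by have l2 := up _ lab; near=> x; rewrite in_itv /=; near: x.
- by near=> x; rewrite in_itv.
Unshelve. all: by end_near. Qed.

Lemma near_lt {T : topologicalType} (f g : T -> \bar R) t :
  {for t, continuous f} -> {for t, continuous g} -> (f t < g t)%E ->
  \forall y \near t, (f y < g y)%E.
Proof.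
move=> cf cg /ereal_between[r /andP[fr rg]].
have nf : nbhs t [set y | (f y < r%:E)%E] := cf _ (open_nbhs_nbhs (conj (@open_ereal_lt_ereal _ r%:E) fr)).
have ng : nbhs t [set y | (r%:E < g y)%E] := cg _ (open_nbhs_nbhs (conj (@open_ereal_gt_ereal _ r%:E) rg)).
by apply: filterS2 nf ng => y /= h1 h2; exact: lt_trans h1 h2.
Qed.

Lemma near_neq {T : topologicalType} (f g : T -> \bar R) t :
  {for t, continuous f} -> {for t, continuous g} -> f t != g t ->
  \forall y \near t, f y != g y.
Proof.
move=> cf cg; rewrite neq_lt => /orP[/(near_lt cf cg)|/(near_lt cg cf)].
  by apply: filterS => y /lt_eqF ->.
by apply: filterS => y /gt_eqF ->.
Qed.

Lemma continuous_natmule n : continuous (fun x : \bar R => (x *+ n)%E).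
Proof.
rewrite (_ : (fun _ => _) = mule n%:R%:E); first exact: mule_continuous.
by apply: funext => x; rewrite mule_natl.
Qed.

Lemma addeNy_def x y : x != -oo%E -> y != -oo%E -> (x +? y)%E.
Proof. by case: x y => [?| |] [?| |]. Qed.

Lemma cvg_adde {T : topologicalType} (f g : T -> \bar R) t :
  f t != -oo%E -> g t != -oo%E -> {for t, continuous f} ->
  {for t, continuous g} -> {for t, continuous (fun u => f u + g u)%E}.
Proof. by move=> fN gN cf cg; apply: cvgeD => //; exact: addeNy_def. Qed.

Lemma cvg_min {T : topologicalType} (f g : T -> \bar R) t :
  {for t, continuous f} -> {for t, continuous g} ->
  {for t, continuous (fun u => Order.min (f u) (g u))}.
Proof.
move=> cf cg; have cc z : {for t, continuous (fun=> z : \bar R)} by exact: cvg_cst.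
apply: cvg_order => z.
  rewrite lt_min => /andP[/(near_lt (cc z) cf) h1 /(near_lt (cc z) cg) h2].
  by apply: filterS2 h1 h2 => u h1 h2; rewrite lt_min h1.
rewrite gt_min => /orP[/(near_lt cf (cc z))|/(near_lt cg (cc z))].
  by apply: filterS => u h1; rewrite gt_min h1.
by apply: filterS => u h1; rewrite gt_min h1 orbT.
Qed.

Lemma le_supD (I : Type) (f g : I -> \bar R) z :
  (forall i, f i != -oo%E) -> (forall i, g i != -oo%E) ->
  (forall i j, f i + g j <= z)%E -> I ->
  (ereal_sup (range f) + ereal_sup (range g) <= z)%E.
Proof.
move=> fN gN h i0.
have aux (u : I -> \bar R) y : y != -oo%E -> (forall i, u i != -oo%E) ->
    (forall i, u i + y <= z)%E -> (ereal_sup (range u) + y <= z)%E.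
  move=> yN uN hu; have [ye|yf] := eqVneq y +oo%E.
    by have := hu i0; rewrite ye addey // leye_eq => /eqP ->; rewrite leey.
  have yfin : y \is a fin_num by rewrite fin_numE yN.
  rewrite -leeBrDr //; apply/ereal_supP => _ [i _ <-].
  by rewrite leeBrDr.
apply: (aux) => // [|i].
  apply/eqP => e; have := ereal_sup_ubound (imageT g i0).
  by rewrite e leeNy_eq (negPf (gN i0)).
by rewrite addeC; apply: (aux) => // j; rewrite addeC.
Qed.

End ExtendedReals.

(** * Suprema of monomial valuations *)

(** The minimum of the three terms is attained twice: the relation not listed
    is obtained by exchanging j and l. *)
Definition ultra_rel (R : realType) (D : nat -> nat -> \bar R) (M : nat)
    (P : pred nat) (w : nat -> \bar R) : Prop :=
  forall j l, P j -> P l -> j != l ->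
    (Order.min (w j.+1) (w l.+1) <= w 0%N *+ M + D j l)%E /\
    (Order.min (w l.+1) (w 0%N *+ M + D j l) <= w j.+1)%E.

Definition ultra_space (R : realType) (D : nat -> nat -> \bar R) (M : nat) :
    set (efun R nat) :=
  [set w : nat -> \bar R | (forall i, w i != -oo%E) /\ ultra_rel D M predT w].

Section Tower.
Context (R : realType) (K : closedFieldType) (nu : K -> \bar R).
Hypothesis nuP : valuation nu.
Context (M : nat) (a : nat -> K).
Local Notation A2 := (A2an nu).
Local Notation x0 := ('X_ord0 : {mpoly K[2]}).

Definition parabola (b : K) : {mpoly K[2]} := 'X_ord_max + b *: 'X_ord0 ^+ M.

Definition parabolas (i : nat) : {mpoly K[2]} :=
  if i is j.+1 then parabola (a j) else 'X_ord0.

Definition val_dist (j l : nat) : \bar R := nu (a j - a l).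

Local Notation X := (ultra_space val_dist M).
Local Notation trop := (@tropicalization R K nat parabolas).

Lemma parabola_sub b c : parabola b = parabola c + (b - c) *: 'X_ord0 ^+ M.
Proof. by rewrite /parabola -addrA -scalerDl [c + _]addrC subrK. Qed.

Lemma A2_parabola_sub mu b c : A2 mu ->
  mu ((b - c) *: 'X_ord0 ^+ M) = (mu 'X_ord0 *+ M + nu (b - c)%R)%E.
Proof. by move=> muA; rewrite (A2Z muA) (A2X nuP muA) addeC. Qed.

(** The difference of two curves of the family is a multiple of x1^M. *)
Lemma A2_ultra (mu : efun R {mpoly K[2]}) : A2 mu -> X (trop mu).
Proof.
move=> muA; split=> [i|j l _ _ _]; first exact: A2_Nny muA _.
rewrite /tropicalization /=; split.
  rewrite -A2_parabola_sub //; set c := _ *: _.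
  have -> : c = parabola (a j) - parabola (a l).
    by rewrite [in RHS](parabola_sub (a j) (a l)) addrAC subrr add0r.
  apply: le_trans (A2D muA _ _); rewrite le_min !ge_min lexx /=.
  by rewrite (A2N nuP muA) lexx orbT.
by rewrite -A2_parabola_sub // (parabola_sub (a j) (a l)) (A2D muA).
Qed.

(** The supremum is not a maximum at the points where the value of the curves
    increases along a sequence of centers without a last term, which happens in
    positive residue characteristic. *)
Definition tower (w : efun R nat) : efun R {mpoly K[2]} :=
  fun p : {mpoly K[2]} => ereal_sup (range (fun j : nat =>
    monomial_val nu M (a j) (w 0%N) (w j.+1) p)).

Section AtPoint.
Variable (w : efun R nat).
Hypothesis Xw : X w.
Local Notation S j := (monomial_val nu M (a j) (w 0%N) (w j.+1)).

Lemma ultra_Nny i : w i != -oo%E. Proof. by case: Xw. Qed.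

Lemma A2_stage j : A2 (S j). Proof. by apply: A2_monomial => //; exact: ultra_Nny. Qed.

(** The stage of l gives to the curve of j at least the value prescribed by w,
    by the ultrametric relation; minimality of the stage of j concludes. *)
Lemma stage_le j l p : (w j.+1 <= w l.+1)%E -> (S j p <= S l p)%E.
Proof.
move=> jl; apply: monomial_min; rewrite ?ultra_Nny //; first exact: A2_stage.
  by rewrite monomial_x ?ultra_Nny.
rewrite monomial_y ?ultra_Nny // le_min jl /=.
have [->|ne] := eqVneq j l.
  by rewrite subrr (nu0 nuP) addey ?leey // natmule_Nny // ultra_Nny.
by case: Xw => _ /(_ j l isT isT ne)[+ _]; rewrite min_l.
Qed.

Lemma stage_le_tower j p : (S j p <= tower w p)%E.
Proof. by apply: ereal_sup_ubound; exists j. Qed.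

(** The stages form a chain, so that the supremum of a sum is the sum of the
    suprema. *)
Lemma A2_tower : A2 (tower w).
Proof.
split.
- move=> p; apply: contraTneq (stage_le_tower 0 p) => ->.
  by rewrite leeNy_eq (A2_Nny (A2_stage 0)).
- move=> c; apply/eqP; rewrite eq_le; apply/andP; split.
    by apply/ereal_supP => _ [j _ <-]; rewrite (A2C (A2_stage j)).
  by apply: le_trans (stage_le_tower 0 _); rewrite (A2C (A2_stage 0)).
- move=> p q; apply/eqP; rewrite eq_le; apply/andP; split.
    apply/ereal_supP => _ [j _ <-]; rewrite (A2M (A2_stage j)).
    by apply: leeD; exact: stage_le_tower.
  apply: le_supD; [| | |exact: 0%N].
  + by move=> j; exact: A2_Nny (A2_stage j) _.
  + by move=> j; exact: A2_Nny (A2_stage j) _.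
  move=> j l; have [jl|/ltW lj] := leP (w j.+1) (w l.+1).
    apply: le_trans (stage_le_tower l _); rewrite (A2M (A2_stage l)).
    by rewrite leeD2r // stage_le.
  apply: le_trans (stage_le_tower j _); rewrite (A2M (A2_stage j)).
  by rewrite leeD2l // stage_le.
- move=> p q; rewrite leNgt; apply/negP; rewrite lt_min => /andP[].
  move=> /ereal_sup_gtP[_ [j _ <-] hj] /ereal_sup_gtP[_ [l _ <-] hl].
  have key k : (S j p <= S k p)%E -> (S l q <= S k q)%E -> False.
    move=> jk lk; have := stage_le_tower k (p + q).
    rewrite leNgt => /negP; apply.
    apply: lt_le_trans (A2D (A2_stage k) p q).
    by rewrite lt_min (lt_le_trans hj) // (lt_le_trans hl).
  have [jl|/ltW lj] := leP (w j.+1) (w l.+1).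
    by apply: (key l) => //; exact: stage_le.
  by apply: (key j) => //; exact: stage_le.
Qed.

Lemma tower_x : tower w 'X_ord0 = w 0%N.
Proof.
apply/eqP; rewrite eq_le; apply/andP; split.
  by apply/ereal_supP => _ [j _ <-]; rewrite monomial_x ?ultra_Nny.
by apply: le_trans (stage_le_tower 0 _); rewrite monomial_x ?ultra_Nny.
Qed.

Lemma tower_y l : tower w (parabola (a l)) = w l.+1.
Proof.
apply/eqP; rewrite eq_le; apply/andP; split.
  apply/ereal_supP => _ [j _ <-]; rewrite monomial_y ?ultra_Nny //.
  have [->|ne] := eqVneq j l; first by rewrite ge_min lexx.
  by rewrite eq_sym in ne; case: Xw => _ /(_ l j isT isT ne)[].
apply: le_trans (stage_le_tower l _); rewrite monomial_y ?ultra_Nny //.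
rewrite subrr (nu0 nuP) addey ?min_l ?leey //.
by rewrite natmule_Nny // ultra_Nny.
Qed.

Lemma trop_tower : trop (tower w) = w.
Proof. by apply: funext => -[|l]; [exact: tower_x|exact: tower_y]. Qed.

Lemma tower_min (mu : efun R {mpoly K[2]}) p :
  A2 mu -> trop mu = w -> (tower w p <= mu p)%E.
Proof.
move=> muA muw; apply/ereal_supP => _ [j _ <-].
apply: monomial_min; rewrite ?ultra_Nny //.
  by rewrite -muw.
by rewrite -[in leLHS]muw.
Qed.

End AtPoint.

Local Notation B := (X `\ tinfty nat).

Definition tower_continuous (p : {mpoly K[2]}) : Prop :=
  continuous (fun w : B => tower (set_val w) p).

Lemma coord_continuous i : continuous (fun w : B => (set_val w : nat -> \bar R) i).
Proof.
move=> w; apply: (@continuous_comp B (efun R nat) (\bar R) set_val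
  (fun v : efun R nat => v i)); first exact: initial_continuous.
exact: eval_continuous.
Qed.

Lemma punctured_ultra (w : B) : X (set_val w). Proof. by case: (set_valP w). Qed.

Lemma punctured_Nny (w : B) i : (set_val w : nat -> \bar R) i != -oo%E.
Proof. exact: ultra_Nny (punctured_ultra w) i. Qed.

Lemma tower_continuousM p q :
  tower_continuous p -> tower_continuous q -> tower_continuous (p * q).
Proof.
move=> cp cq; rewrite /tower_continuous.
rewrite (_ : (fun w : B => _) =
  fun w : B => (tower (set_val w) p + tower (set_val w) q)%E); last first.
  by apply: funext => w; rewrite (A2M (A2_tower (punctured_ultra w))).
move=> w; have tN := A2_Nny (A2_tower (punctured_ultra w)).
apply: (cvg_adde (tN p) (tN q) (cp w) (cq w)).
Qed.

Lemma tower_continuousC c : tower_continuous c%:MP.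
Proof.
rewrite /tower_continuous (_ : (fun w : B => _) = fun=> nu c).
  exact: cst_continuous.
by apply: funext => w; rewrite (A2C (A2_tower (punctured_ultra w))).
Qed.

Lemma tower_continuous_x : tower_continuous 'X_ord0.
Proof.
rewrite /tower_continuous (_ : (fun w : B => _) = fun w => (set_val w : nat -> \bar R) 0%N).
  exact: coord_continuous.
by apply: funext => w; rewrite tower_x.
Qed.

Lemma tower_continuousX p n : tower_continuous p -> tower_continuous (p ^+ n).
Proof.
move=> cp; elim: n => [|n IH]; first by rewrite expr0 -mpolyC1; exact: tower_continuousC.
by rewrite exprS; exact: tower_continuousM.
Qed.

Lemma weighted_continuous b : b != -oo%E ->
  continuous (fun w : B => ((set_val w : nat -> \bar R) 0%N *+ M + b)%E).
Proof.
move=> bN w.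
apply: (@cvg_adde R B (fun v => (set_val v : nat -> \bar R) 0%N *+ M)%E (fun=> b)).
- by rewrite natmule_Nny ?punctured_Nny.
- exact: bN.
- apply: (@continuous_comp B (\bar R) (\bar R) _ (fun x => (x *+ M)%E)).
    exact: coord_continuous.
  exact: continuous_natmule.
- exact: cst_continuous.
Qed.

(** If w_j differs from M w_0 + nu (b - a_j) for some j, then the value of the
    curve is the smaller of the two, near w as well. If they agree for all j, the
    value at w is the supremum over j of M w_0 + nu (b - a_j), which is an upper
    bound at every point and depends continuously on w_0; lower semicontinuity is
    that of a supremum of continuous functions. *)
Lemma tower_continuous_parabola b : tower_continuous (parabola b).
Proof.
move=> w; set f := fun v : B => tower (set_val v) (parabola b).
pose u j (v : B) := (set_val v : nat -> \bar R) j.+1.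
pose q c (v : B) := ((set_val v : nat -> \bar R) 0%N *+ M + c)%E.
have cu j : {for w, continuous (u j)} by exact: coord_continuous.
have cq c : c != -oo%E -> {for w, continuous (q c)}.
  by move=> cN; exact: weighted_continuous.
have nuN c : nu c != -oo%E by exact: nu_neqNy nuP c.
have fE v : f v = ereal_sup (range (fun j => Order.min (u j v) (q (nu (b - a j)) v))).
  rewrite /f /tower; congr ereal_sup; congr (_ @` _); apply: funext => j.
  by rewrite monomial_y ?punctured_Nny.
have [[j uq]|uq] := pselect (exists j, u j w != q (nu (b - a j)) w).
  have near_f : \forall v \near w, Order.min (u j v) (q (nu (b - a j)) v) = f v.
    have := near_neq (cu j) (cq _ (nuN _)) uq; apply: filterS => v ne.
    have tA := A2_tower (punctured_ultra v).
    rewrite /f (parabola_sub b (a j)) (A2D_neq nuP tA) (A2_parabola_sub _ _ tA);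
      rewrite tower_x (tower_y (punctured_ultra v)) //.
  apply: (cvg_trans (near_eq_cvg near_f)).
  have <- : Order.min (u j w) (q (nu (b - a j)) w) = f w by exact: nbhs_singleton near_f.
  by apply: cvg_min; [exact: cu|exact: cq].
(* From here on, the two terms agree at w for all j. *)
have {}uq j : u j w = q (nu (b - a j)) w.
  by apply/eqP/negPn/negP => h; apply: uq; exists j.
pose c := ereal_sup (range (fun j => nu (b - a j))).
have cN : c != -oo%E.
  apply/eqP => e; have := ereal_sup_ubound (imageT (fun j => nu (b - a j)) 0%N).
  by rewrite -/c e leeNy_eq (negPf (nuN _)).
have f_le v : (f v <= q c v)%E.
  rewrite fE; apply/ereal_supP => _ [j _ <-].
  rewrite ge_min; apply/orP; right; rewrite leeD2l //.
  by apply: ereal_sup_ubound; exists j.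
have f_ge : (q c w <= f w)%E.
  have w0N := punctured_Nny w 0; pose k (j : nat) := ((set_val w : nat -> \bar R) 0%N *+ M)%E.
  have <- : (ereal_sup (range k) + c)%E = q c w.
    by rewrite [ereal_sup (range k)]ereal_sup_cst //; apply/set0P; exists 0%N.
  apply: (le_supD _ _ _ 0%N) => [j|j|i j]; [by rewrite natmule_Nny|exact: nuN|].
  rewrite fE; apply: le_trans (ereal_sup_ubound (imageT _ j)).
  by rewrite uq minxx.
have fw : f w = q c w by apply/eqP; rewrite eq_le f_le.
apply: (@cvg_order R B (nbhs w) (nbhs_filter w)) => z.
  rewrite fE => /ereal_sup_gtP[_ [j _ <-] zj].
  have := near_lt (@cst_continuous B (\bar R) z w) (cvg_min (cu j) (cq _ (nuN (b - a j)))) zj.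
  apply: filterS => v h; apply: (lt_le_trans h); rewrite fE.
  exact: (ereal_sup_ubound (imageT _ j)).
rewrite fw => h; have := near_lt (cq c cN) (@cst_continuous B (\bar R) z w) h.
by apply: filterS => v; apply: le_lt_trans.
Qed.

End Tower.

(** * Quasihomogeneous polynomials *)

Section Quasihomogeneous.
Context (K : closedFieldType) (M : nat).
Hypothesis M_gt0 : (0 < M)%N.
Implicit Types (p q : {mpoly K[2]}) (m : 'X_{1..2}).

Definition wdeg m : nat := (m ord0 + M * m ord_max)%N.

Definition quasihomog (d : nat) p : Prop := forall m, wdeg m != d -> p@_m = 0.

Lemma wdegD m n : wdeg (m + n)%MM = (wdeg m + wdeg n)%N.
Proof. by rewrite /wdeg !mnmDE mulnDr addnACA. Qed.

Lemma quasihomogM d e p q :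
  quasihomog d p -> quasihomog e q -> quasihomog (d + e) (p * q).
Proof.
move=> hp hq m; rewrite mcoeffM => mde; apply: big1 => k /eqP mk.
have [kd|/hp ->] := eqVneq (wdeg k.1) d; last by rewrite mul0r.
have [ke|/hq ->] := eqVneq (wdeg k.2) e; last by rewrite mulr0.
by rewrite mk wdegD kd ke eqxx in mde.
Qed.

Lemma quasihomog0 d : quasihomog d 0. Proof. by move=> m _; rewrite mcoeff0. Qed.

Lemma quasihomogD d p q :
  quasihomog d p -> quasihomog d q -> quasihomog d (p + q).
Proof. by move=> hp hq m h; rewrite mcoeffD hp ?hq ?addr0. Qed.

Lemma quasihomogZ d c p : quasihomog d p -> quasihomog d (c *: p).
Proof. by move=> hp m h; rewrite mcoeffZ hp ?mulr0. Qed.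

Lemma quasihomogX m : quasihomog (wdeg m) 'X_[m].
Proof. by move=> n nm; rewrite mcoeffX; case: (m =P n) nm => [->|//]; rewrite eqxx. Qed.

Lemma quasihomog_x0 : quasihomog 1 'X_ord0.
Proof. by have := @quasihomogX U_(ord0); rewrite /wdeg !mnm1E /= muln0 addn0. Qed.

Lemma quasihomog_x1 : quasihomog M 'X_ord_max.
Proof. by have := @quasihomogX U_(ord_max); rewrite /wdeg !mnm1E /= muln1 add0n. Qed.

Lemma quasihomog_exp d p n : quasihomog d p -> quasihomog (d * n) (p ^+ n).
Proof.
move=> hp; elim: n => [|n IH]; last by rewrite exprS mulnS; exact: quasihomogM.
rewrite muln0 expr0 => m m0; rewrite mcoeff1; case: (m =P 0%MM) m0 => // ->.
by rewrite /wdeg !mnm0E muln0.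
Qed.

Lemma quasihomog_shear b d p : quasihomog d p -> quasihomog d (p \mPo shear M b).
Proof.
move=> hp; rewrite {1}(mpolyE p) (raddf_sum (comp_mpoly (shear M b))) /=.
rewrite big_seq; elim/big_ind: _ => [|q r|m mp].
- exact: quasihomog0.
- exact: quasihomogD.
rewrite comp_mpolyZ; apply: quasihomogZ.
have <- : wdeg m = d.
  by apply/eqP; apply: contraTT mp => /hp; rewrite mcoeff_msupp => ->; rewrite eqxx.
rewrite mpolyX2 rmorphM !rmorphXn /= comp_mpolyX0 comp_mpolyX1 -/(parabola M b).
apply: quasihomogM.
  by rewrite -[X in quasihomog X]mul1n; apply: quasihomog_exp; exact: quasihomog_x0.
apply: quasihomog_exp; apply: quasihomogD; first exact: quasihomog_x1.
apply: quasihomogZ; rewrite -[X in quasihomog X]mul1n.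
by apply: quasihomog_exp; exact: quasihomog_x0.
Qed.

Definition homog_part (d : nat) p : {mpoly K[2]} :=
  sub_mpoly (fun m => wdeg m == d) p.

Lemma quasihomog_part d p : quasihomog d (homog_part d p).
Proof. by move=> m /negPf md; rewrite mcoeff_sub md. Qed.

Definition wbound p : nat := \max_(m <- msupp p) (wdeg m).+1.

Lemma sum_homog_part p : p = \sum_(d < wbound p) homog_part d p.
Proof.
apply/mpolyP => m; rewrite linear_sum /=.
under eq_bigr do rewrite mcoeff_sub.
have [mp|mp] := boolP (m \in msupp p); last first.
  by rewrite (memN_msupp_eq0 mp) big1 // => i _; rewrite if_same.
have lt : (wdeg m < wbound p)%N by exact: (@leq_bigmax_seq _ _ _ (fun m => (wdeg m).+1) m).
by rewrite (bigD1 (Ordinal lt)) //= eqxx big1 ?addr0 // => i /negPf; rewrite -val_eqE /= eq_sym => ->.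
Qed.

(** Since x2 and x1^M have the same weight, shears preserve the weighted degree
    and commute with the extraction of quasihomogeneous parts. *)
Lemma mcoeff_homog_part_shear b d p m :
  (homog_part d p \mPo shear M b)@_m =
  if wdeg m == d then (p \mPo shear M b)@_m else 0.
Proof.
have qh e := quasihomog_shear b (@quasihomog_part e p).
case: eqP => [<-|/eqP md]; last exact: qh.
have -> : p \mPo shear M b = \sum_(e < wbound p) (homog_part e p \mPo shear M b).
  rewrite {1}(sum_homog_part p) (raddf_sum (comp_mpoly (shear M b))).
  by apply: eq_bigr.
rewrite [in RHS](raddf_sum (mcoeff m)) /=.
have [lt|ge] := ltnP (wdeg m) (wbound p).
  rewrite (bigD1 (Ordinal lt)) //= big1 ?addr0 // => i.
  by rewrite -val_eqE /= => ne; apply: qh; rewrite eq_sym.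
rewrite big1 => [|i _]; last first.
  by apply: qh; rewrite gtn_eqF // (leq_trans (ltn_ord i)).
have -> : homog_part (wdeg m) p = 0; last by rewrite comp_mpoly0 mcoeff0.
apply/mpolyP => n; rewrite mcoeff_sub mcoeff0; case: eqP => // e.
apply: memN_msupp_eq0; apply/negP => np.
have : (wdeg n < wbound p)%N by exact: (@leq_bigmax_seq _ _ _ (fun m => (wdeg m).+1) n).
by rewrite e ltnNge ge.
Qed.

(** Homogenization of a univariate polynomial of degree at most n in x2 / x1^M. *)
Definition homogenize n (E : {poly K}) : {mpoly K[2]} :=
  \sum_(b < n.+1) E`_b *: ('X_ord0 ^+ (M * (n - b)) * 'X_ord_max ^+ b).

(** The exponent of x1 drops by M each time that of x2 grows by 1, so a linear
    factor becomes one curve. *)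
Lemma homogenizeM n b (E : {poly K}) : (size E <= n.+1)%N ->
  homogenize n.+1 (E * ('X - b%:P)) = parabola M (- b) * homogenize n E.
Proof.
move=> sE; rewrite mulrBr /homogenize.
under eq_bigr => i _ do rewrite coefB coefMX coefMC scalerBl.
rewrite sumrB /parabola mulrDl scaleNr mulNr !mulr_sumr; congr (_ - _).
  rewrite big_ord_recl /= scale0r add0r; apply: eq_bigr => i _.
  by rewrite /bump add1n subSS -scalerAr exprS mulrCA.
rewrite big_ord_recr /= nth_default // mul0r scale0r addr0.
apply: eq_bigr => i _; rewrite -scalerAr -scalerAl scalerA mulrA -exprD.
by rewrite subSn ?mulnS // -ltnS.
Qed.

Lemma homogenize_prod c (rs : seq K) :
  homogenize (size rs) (c *: \prod_(z <- rs) ('X - z%:P)) =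
  c *: \prod_(z <- rs) parabola M (- z).
Proof.
elim: rs => [|z rs IH].
  by rewrite !big_nil /homogenize big_ord1 muln0 !expr0 mulr1 alg_polyC coefC.
rewrite !big_cons /= mulrC scalerAl homogenizeM ?IH ?scalerAr //.
by rewrite (leq_trans (size_scale_leq _ _)) // size_prod_XsubC.
Qed.

(** Setting x1 = 1 gives a univariate polynomial, which splits; its degree may be
    smaller than d / M, and the difference is the power of x1. *)
Lemma quasihomog_factor d p : quasihomog d p ->
  exists c r (rs : seq K), p = c *: ('X_ord0 ^+ r * \prod_(z <- rs) parabola M z).
Proof.
move=> hp.
pose mn x y : 'X_{1..2} := (U_(ord0) *+ x + U_(ord_max) *+ y)%MM.
have mnE m : m = mn (m ord0) (m ord_max).
  apply/mnmP => i; rewrite mnmDE !mulmnE !mnm1E.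
  case: (unliftP ord_max i) => [j|] ->.
    rewrite ord1 (_ : lift ord_max ord0 = ord0) /= ?muln1 ?muln0 ?mul1n ?mul0n ?addn0 //.
    exact: val_inj.
  by rewrite /= ?muln1 ?muln0 ?mul1n ?mul0n.
pose E : {poly K} := \poly_(b < d.+1)
  (if (M * b <= d)%N then p@_(mn (d - M * b)%N b) else 0).
have [E0|E0] := eqVneq E 0.
  exists 0, 0%N, [::]; rewrite scale0r; apply/mpolyP => m; rewrite mcoeff0.
  have [md|/hp //] := eqVneq (wdeg m) d.
  have le1 : (M * m ord_max <= d)%N by rewrite -md leq_addl.
  have := congr1 (fun q : {poly K} => q`_(m ord_max)) E0.
  rewrite coef_poly coef0 ltnS le1 (leq_trans _ le1) ?leq_pmull //.
  by rewrite -md addnK -mnE.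
have [rs Ers] := closed_field_poly_normal E.
have sE : size E = (size rs).+1.
  by rewrite Ers size_scale ?lead_coef_eq0 // size_prod_XsubC.
(* The leading coefficient is not 0, so its exponent occurs in p. *)
have MB : (M * size rs <= d)%N.
  move: E0; rewrite -lead_coef_eq0 lead_coefE sE /= coef_poly.
  by case: ltnP => // _; case: leqP => //; rewrite eqxx.
exists (lead_coef E), (d - M * size rs)%N, [seq - z | z <- rs].
rewrite big_map scalerAr -homogenize_prod -Ers.
rewrite /homogenize mulr_sumr; apply/mpolyP => m; rewrite linear_sum /=.
have term (b : 'I_(size rs).+1) :
    'X_ord0 ^+ (d - M * size rs) * (E`_b *: ('X_ord0 ^+ (M * (size rs - b)) * 'X_ord_max ^+ b))
    = E`_b *: 'X_[mn (d - M * b)%N b].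
  have bB : (b <= size rs)%N by rewrite -ltnS ltn_ord.
  have e : (d - M * size rs + M * (size rs - b) = d - M * b)%N.
    by rewrite mulnBr addnBA ?leq_mul // subnK.
  by rewrite -scalerAr mulrA -exprD e mpolyXD !mpolyXn.
under eq_bigr => b _ do rewrite term mcoeffZ mcoeffX.
have [md|md] := eqVneq (wdeg m) d; last first.
  rewrite hp // big1 // => b _; case: eqP => [e|]; last by rewrite mulr0.
  case/eqP: md; rewrite -e /wdeg !mnmDE !mulmnE !mnm1E /= ?muln1 ?muln0 ?mul1n ?mul0n.
  rewrite addn0 add0n subnK // (leq_trans _ MB) // leq_mul2l.
  by rewrite -ltnS ltn_ord orbT.
have le1 : (M * m ord_max <= d)%N by rewrite -md leq_addl.
have coefE : E`_(m ord_max) = p@_m.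
  rewrite coef_poly ltnS le1 (leq_trans _ le1) ?leq_pmull //.
  by rewrite -md addnK -mnE.
have [lt|ge] := ltnP (m ord_max) (size rs).+1; last first.
  rewrite -coefE nth_default ?sE // big1 // => b _; case: eqP => [e|]; last by rewrite mulr0.
  move: ge; rewrite leqNgt -e !mnmDE !mulmnE !mnm1E /= ?muln1 ?muln0 ?mul1n ?mul0n add0n.
  by rewrite ltn_ord.
have mm : mn (d - M * m ord_max)%N (m ord_max) = m by rewrite [RHS]mnE -md addnK.
rewrite (bigD1 (Ordinal lt)) //= mm eqxx mulr1 coefE.
rewrite big1 ?addr0 // => b ne; case: eqP => [e|]; last by rewrite mulr0.
case/eqP: ne; apply: val_inj; rewrite /= -e !mnmDE !mulmnE !mnm1E /=.
by rewrite ?muln1 ?muln0 ?mul1n ?mul0n.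
Qed.

End Quasihomogeneous.

(** * Continuity of the suprema *)

Section TowerContinuity.
Context (R : realType) (K : closedFieldType) (nu : K -> \bar R).
Hypothesis nuP : valuation nu.
Context (M : nat) (a : nat -> K).
Hypothesis M_gt0 : (0 < M)%N.
Local Notation X := (ultra_space (val_dist nu a) M).
Local Notation B := (X `\ tinfty nat).

Lemma tower_homog_le w p d : X w ->
  (tower nu M a w p <= tower nu M a w (homog_part M d p))%E.
Proof.
move=> Xw; apply/ereal_supP => _ [j _ <-].
apply: le_trans (stage_le_tower nu M a w j _).
have wN i : w i != -oo%E := ultra_Nny Xw i.
rewrite /monomial_val /push; apply: gauss_ge => m; rewrite mcoeff_homog_part_shear.
case: eqP => _; first by apply: gauss_le.
by rewrite (nu0 nuP) addye ?leey // weight_Nny.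
Qed.

(** Parts of different weighted degrees have disjoint sets of monomials in each
    of the straightened coordinate systems, so they cannot cancel. *)
Lemma tower_homog_min w p : X w ->
  tower nu M a w p =
  \big[Order.min/+oo%E]_(d < wbound M p) tower nu M a w (homog_part M d p).
Proof.
move=> Xw; apply/eqP; rewrite eq_le; apply/andP; split.
  elim/big_ind: _ => [|x y h1 h2|d _]; first exact: leey.
    by rewrite le_min h1.
  exact: tower_homog_le.
rewrite [in leRHS](sum_homog_part M p); apply: (A2_sum nuP (A2_tower nuP Xw)) => d _ _.
by rewrite (bigD1 d) //= ge_min lexx.
Qed.

Lemma tower_continuous_all p : tower_continuous nu M a p.
Proof.
have bigmin (s : seq 'I_(wbound M p)) (F : 'I_(wbound M p) -> B -> \bar R) :
    (forall d, continuous (F d)) ->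
    continuous (fun w : B => \big[Order.min/+oo%E]_(d <- s) F d w).
  move=> cF; elim: s => [|d s IH].
    under eq_fun do rewrite big_nil.
    exact: cst_continuous.
  under eq_fun do rewrite big_cons.
  by move=> w; apply: (cvg_min (cF d w) (IH w)).
rewrite /tower_continuous (_ : (fun w : B => _) = fun w : B =>
   \big[Order.min/+oo%E]_(d < wbound M p) tower nu M a (set_val w) (homog_part M d p)).
  apply: bigmin => d.
  have [c [r [rs ->]]] := quasihomog_factor M_gt0 (@quasihomog_part K M d p).
  rewrite -mul_mpolyC; apply: tower_continuousM; [exact: nuP|exact: tower_continuousC|].
  apply: tower_continuousM; [exact: nuP| |].
    by apply: tower_continuousX => //; exact: tower_continuous_x.
  elim/big_ind: _ => [|q q' cq cq'|z _].
  - by rewrite -mpolyC1; exact: tower_continuousC.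
  - exact: tower_continuousM.
  - exact: tower_continuous_parabola.
by apply: funext => w; apply: tower_homog_min; exact: punctured_ultra.
Qed.

End TowerContinuity.

(** * Ultrametric trees and their tropical modifications *)

Section UltrametricTree.
Context (R : realType) (D : nat -> nat -> \bar R) (M : nat).

Definition ultrametric : Prop :=
  [/\ forall j, D j j = +oo%E, forall j l, j != l -> D j l \is a fin_num,
      forall j l, D j l = D l j
    & forall j k l, (Order.min (D j k) (D k l) <= D j l)%E].

Hypothesis DP : ultrametric.

Lemma Djj j : D j j = +oo%E. Proof. by case: DP. Qed.
Lemma Dfin j l : j != l -> D j l \is a fin_num. Proof. by case: DP => _ + _ _; apply. Qed.
Lemma Dsym j l : D j l = D l j. Proof. by case: DP. Qed.
Lemma Dtri j k l : (Order.min (D j k) (D k l) <= D j l)%E. Proof. by case: DP. Qed.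

Lemma D_Nny j l : D j l != -oo%E.
Proof. by have [->|/Dfin] := eqVneq j l; [rewrite Djj|rewrite fin_numE => /andP[]]. Qed.

Lemma D_le_fin (x : R) j l : (D j l <= x%:E)%E -> D j l \is a fin_num.
Proof.
by move=> h; rewrite fin_numE D_Nny; apply: contraTneq h => ->; rewrite leye_eq.
Qed.

Lemma Dtri_ge x j k l : (x <= D j k -> x <= D k l -> x <= D j l)%E.
Proof. by move=> h1 h2; apply: le_trans (Dtri j k l); rewrite le_min h1. Qed.

Lemma Dtri_eq j k l : (D j l < D j k)%E -> D k l = D j l.
Proof.
move=> h; apply/eqP; rewrite eq_le; apply/andP; split.
  by have := Dtri j k l; rewrite minElt; case: ifP => // _; rewrite leNgt h.
by apply: (@Dtri_ge _ k j l) => //; rewrite (Dsym k j) ltW.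
Qed.

(** The minimum of x and d as a real number; d is only infinite when it is the
    distance of an end to itself. *)
Definition cut (x : R) (d : \bar R) : R := fine (Order.min x%:E d).

Lemma cutE x d : d != -oo%E -> (cut x d)%:E = Order.min x%:E d.
Proof.
move=> dN; rewrite fineK // fin_numElt lt_min ltNyr ltNye dN /=.
by rewrite gt_min ltry.
Qed.

Lemma cut_l x d : (x%:E <= d)%E -> cut x d = x.
Proof. by move=> h; rewrite /cut min_l. Qed.

Lemma cut_r x d : (d <= x%:E)%E -> cut x d = fine d.
Proof. by move=> h; rewrite /cut min_r. Qed.

Lemma cutjj x j : cut x (D j j) = x.
Proof. by rewrite cut_l // Djj leey. Qed.

(** The paths to j and l coincide up to the height D j l. *)
Lemma cut_eq x j l k : (x%:E <= D j l)%E -> cut x (D j k) = cut x (D l k).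
Proof.
move=> xjl; apply: EFin_inj; rewrite !cutE ?D_Nny //.
have aux i i' : (x%:E <= D i i')%E ->
    (Order.min x%:E (D i k) <= Order.min x%:E (D i' k))%E.
  move=> xi; rewrite le_min ge_min lexx /=; apply: le_trans (Dtri i' i k).
  by rewrite le_min !ge_min lexx orbT andbT (Dsym i' i) xi.
by apply/eqP; rewrite eq_le !aux // (Dsym l j).
Qed.

(** The point at height x on the path to the end j of the tree, translated by t
    along the line spanned by (1, M, ..., M). *)
Definition pt n (t : R) (j : nat) (x : R) : 'rV[R]_n.+2 :=
  \row_i (if (i : nat) is l.+1 then t *+ M + cut x (D j l) else t).

(** The tree coordinate of the end l. *)
Definition height n (w : 'rV[R]_n.+2) (l : nat) : R :=
  w 0 (inord l.+1) - w 0 ord0 *+ M.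

Lemma row_height n (w w' : 'rV[R]_n.+2) :
  w 0 ord0 = w' 0 ord0 -> (forall l, (l < n.+1)%N -> height w l = height w' l) ->
  w = w'.
Proof.
move=> e0 eh; apply/rowP => i; case: (unliftP ord0 i) => [l|] -> //.
have := eh l (ltn_ord l); rewrite /height e0 => /addIr.
by have -> : inord l.+1 = lift ord0 l :> 'I_n.+2
  by apply: val_inj; rewrite /= inordK // ltnS.
Qed.

Lemma pt0 n t j x : pt n t j x 0 ord0 = t. Proof. by rewrite mxE. Qed.

Lemma ptS n t j x l : (l < n.+1)%N ->
  pt n t j x 0 (inord l.+1) = t *+ M + cut x (D j l).
Proof. by move=> ln; rewrite mxE inordK. Qed.

Lemma height_pt n t j x l : (l < n.+1)%N -> height (pt n t j x) l = cut x (D j l).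
Proof. by move=> ln; rewrite /height ptS // pt0 addrC addKr. Qed.

Lemma pt_eq n t j l x : (x%:E <= D j l)%E -> pt n t j x = pt n t l x.
Proof.
move=> xjl; apply: row_height => [|k kn]; first by rewrite !pt0.
by rewrite !height_pt // (cut_eq _ xjl).
Qed.

Lemma pt_inj n t t' j l x y : (j < n.+1)%N -> (l < n.+1)%N ->
  pt n t j x = pt n t' l y -> [/\ t = t', x = y & (x%:E <= D j l)%E].
Proof.
move=> jn ln e; have tt : t = t' by rewrite -(pt0 n t j x) e pt0.
have := congr1 (fun w => height w j) e; have := congr1 (fun w => height w l) e.
rewrite !height_pt // !cutjj => hl hj.
have := cutE x (D_Nny j l); have := cutE y (D_Nny l j).
rewrite -hj hl => /eqP xy /eqP yx.
have : (x%:E <= Order.min y%:E (D l j))%E by rewrite (eqP xy).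
rewrite le_min => /andP[_ xD].
split=> //; last by rewrite Dsym.
by rewrite -hl cut_l // Dsym.
Qed.

Definition above (j : nat) (r : R) (l : nat) : bool := (r%:E < D j l)%E.

(** The real number r is a sample point: the cell is the closed interval bounded
    by the two consecutive distances with r between them, the lower one included.
    Every r thus names a nondegenerate cell, and cells are compared by the signs
    [above]. *)
Definition cell (N j : nat) (r : R) : set R :=
  [set x | forall l, (l < N)%N ->
    if above j r l then (x%:E <= D j l)%E else (D j l <= x%:E)%E].

Definition stratum n (N j : nat) (r : R) : set 'rV[R]_n.+2 :=
  [set w | exists t x, cell N j r x /\ w = pt n t j x].

Definition line n (j : nat) (r : R) : set 'rV[R]_n.+2 :=
  [set w | exists t, w = pt n t j r].

Arguments stratum : clear implicits.
Arguments line : clear implicits.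
Arguments pt : clear implicits.

Lemma cell_self N j r : cell N j r r.
Proof. by move=> l _; rewrite /above; case: ltP => // /ltW. Qed.

Arguments cell_self : clear implicits.

Lemma above_self j r : above j r j. Proof. by rewrite /above Djj ltry. Qed.

Lemma cell_above N j r x l : cell N j r x -> (l < N)%N -> above j r l ->
  (x%:E <= D j l)%E.
Proof. by move=> /(_ l) + lN al; rewrite al; apply. Qed.

Lemma cell_below N j r x l : cell N j r x -> (l < N)%N -> ~~ above j r l ->
  (D j l <= x%:E)%E.
Proof. by move=> /(_ l) + lN /negPf al; rewrite al; apply. Qed.

Lemma cut_cell N j r x l : cell N j r x -> (l < N)%N ->
  cut x (D j l) = if above j r l then x else fine (D j l).
Proof.
move=> xc lN; case: ifPn => al; first by rewrite cut_l // (cell_above xc).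
by rewrite cut_r // (cell_below xc).
Qed.

Lemma eq_stratum n N j r r' : (forall l, (l < N)%N -> above j r l = above j r' l) ->
  stratum n N j r = stratum n N j r'.
Proof.
move=> e; have ec : cell N j r = cell N j r'.
  by apply/seteqP; split=> x xc l lN; have := xc l lN; rewrite e.
by rewrite /stratum ec.
Qed.

Lemma stratum_above n N j l r : (j < N)%N -> (l < N)%N -> above j r l ->
  stratum n N j r `<=` stratum n N l r.
Proof.
move=> jN lN jl _ [t [x [xc ->]]].
have xjl := cell_above xc lN jl.
exists t, x; split; last by rewrite (pt_eq _ _ xjl).
move=> k kN; have := xc k kN; rewrite /above in jl *.
have [rjk|jkr] := ltP r%:E (D j k); have [rlk|lkr] := ltP r%:E (D l k) => //.
- by move=> xjk; apply: (@Dtri_ge _ l j k) => //; rewrite Dsym.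
- move: lkr; rewrite leNgt => /negP; case; apply: lt_le_trans (Dtri l j k).
  by rewrite lt_min rjk Dsym jl.
- move: jkr; rewrite leNgt => /negP; case; apply: lt_le_trans (Dtri j l k).
  by rewrite lt_min rlk jl.
have e : D l k = D j k by apply: Dtri_eq; apply: le_lt_trans jl.
by rewrite e.
Qed.

Lemma stratum_eq n N j l r : (j < N)%N -> (l < N)%N -> above j r l ->
  stratum n N j r = stratum n N l r.
Proof.
move=> jN lN jl; apply/seteqP; split; apply: stratum_above => //.
by rewrite /above Dsym.
Qed.

Lemma line_eq n j l r : (r%:E <= D j l)%E -> line n j r = line n l r.
Proof.
by move=> h; apply/seteqP; split=> _ [t ->]; exists t; rewrite (pt_eq _ _ h).
Qed.

(** Finitely many distances leave a gap on both sides of a. *)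
Lemma gap N (a : R) : exists2 d : R, 0 < d & forall i l, (i < N)%N -> (l < N)%N ->
  [\/ (D i l < (a - d)%:E)%E, D i l = a%:E | ((a + d)%:E < D i l)%E].
Proof.
have [d d0 dP] : exists2 d : R, 0 < d & forall i l, (i < N)%N -> (l < N)%N ->
    fine (D i l) != a -> d < `|fine (D i l) - a|.
  pose s := [seq fine (D p.1 p.2) | p <- allpairs pair (iota 0 N) (iota 0 N)].
  have [d d0 dP] : exists2 d : R, 0 < d & forall y, y \in s -> y != a -> d < `|y - a|.
    elim: s => [|z s [d d0 dP]]; first by exists 1.
    have [->|za] := eqVneq z a.
      by exists d => // y; rewrite inE => /orP[/eqP ->|/dP //]; rewrite eqxx.
    have z0 : 0 < `|z - a| by rewrite normr_gt0 subr_eq0.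
    exists (Num.min d (`|z - a| / 2)); first by rewrite lt_min d0 divr_gt0.
    move=> y; rewrite inE => /orP[/eqP -> _|/dP h /h]; rewrite gt_min.
      by rewrite ltr_pdivrMr // mulr_natr mulr2n ltrDl z0 orbT.
    by move=> ->.
  exists d => // i l iN lN; apply: dP; apply/mapP; exists (i, l) => //.
  by apply/allpairsP; exists (i, l); rewrite /= !mem_iota.
exists d => // i l iN lN; have [e|/Dfin Df] := eqVneq i l.
  by rewrite e Djj; apply: Or33; exact: ltry.
have dil := dP i l iN lN; rewrite -(fineK Df) !lte_fin; move: dil; set y := fine _.
have [->|ya /(_ isT)] := eqVneq y a; first by move=> _; apply: Or32.
have [h|h] := leP 0 (y - a).
  by rewrite ger0_norm // ltrBrDl => ?; apply: Or33.
by rewrite ltr0_norm // opprB => ?; apply: Or31; lra.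
Qed.

Definition vec_t n : 'rV[int]_n.+2 :=
  \row_i (if (i : nat) is l.+1 then M%:Z else 1).

Definition vec_x n (f : pred nat) : 'rV[int]_n.+2 :=
  \row_i (if (i : nat) is l.+1 then (f l : nat)%:Z else 0).

Definition combo n (f : pred nat) (al be : R) : 'rV[R]_n.+2 :=
  al *: intr_row (vec_t n) + be *: intr_row (vec_x n f).

Arguments combo : clear implicits.

Lemma combo0 n f al be : combo n f al be 0 ord0 = al.
Proof. by rewrite !mxE /= mulr1 mulr0 addr0. Qed.

Lemma height_combo n f al be l : (l < n.+1)%N ->
  height (combo n f al be) l = be * (f l)%:R.
Proof.
move=> ln; rewrite /height combo0 !mxE inordK // -!pmulrn.
by rewrite [al * _]mulr_natr addrAC subrr add0r.
Qed.

Lemma comboZ n f c al be : c *: combo n f al be = combo n f (c * al) (c * be).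
Proof. by rewrite /combo scalerDr !scalerA. Qed.

Lemma pt_sub n N j r t t' x y : (n < N)%N -> cell N j r x -> cell N j r y ->
  pt n t j x - pt n t' j y = combo n (above j r) (t - t') (x - y).
Proof.
move=> nN xc yc; apply/rowP => -[[|l] li]; rewrite !mxE /=.
  by rewrite mulr1 mulr0 addr0.
have lN : (l < N)%N by apply: leq_ltn_trans nN; rewrite -ltnS -ltnS.
rewrite (cut_cell xc lN) (cut_cell yc lN) -!pmulrn !mulr_natr mulrnBl.
by case: above; rewrite ?mulr1n ?mulr0n; ring.
Qed.

(** The lower bound of a cell may be r itself, so room is only granted above. *)
Lemma cell_gap N j r : (j < N)%N -> exists2 d, 0 < d & cell N j r (r + d).
Proof.
move=> jN; have [d d0 dP] := gap N r; exists d => // l lN; rewrite /above.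
case: (dP j l jN lN) => [h|->|h]; case: ltP => // h'.
- by rewrite ltNge (le_trans (ltW h)) ?lee_fin ?gerBl ?ltW in h'.
- by apply: (le_trans h'); rewrite lee_fin lerDl ltW.
- by rewrite ltxx in h'.
- by rewrite lee_fin lerDl ltW.
- exact: ltW.
- by rewrite leNgt (lt_trans _ h) // lte_fin ltrDl in h'.
Qed.

Lemma direction_stratum n N j r v : (n < N)%N -> (j < N)%N ->
  direction (stratum n N j r) v <-> exists al be, v = combo n (above j r) al be.
Proof.
move=> nN jN; split=> [[c [_ [_ [[t [x [xc ->]]] [t' [y [yc ->]]] ->]]]]|[al [be ->]]].
  by rewrite (pt_sub _ _ nN xc yc) comboZ; eexists; eexists.
have rc := cell_self N j r; have [d d0 dc] := cell_gap r jN.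
have [->|be0] := eqVneq be 0.
  exists 1, (pt n al j r), (pt n 0 j r); split; [by exists al, r|by exists 0, r|].
  by rewrite (pt_sub _ _ nN rc rc) subrr subr0 scale1r.
exists (be / d), (pt n (al * d / be) j (r + d)), (pt n 0 j r).
split; [by exists (al * d / be), (r + d)|by exists 0, r|].
rewrite (pt_sub _ _ nN dc rc) subr0 [r + d]addrC addrK comboZ.
by rewrite divfK ?gt_eqF //; congr combo; field; rewrite be0 gt_eqF.
Qed.

Lemma direction_line n j r v :
  direction (line n j r) v <-> exists al, v = al *: intr_row (vec_t n).
Proof.
have sub t t' : pt n t j r - pt n t' j r = (t - t') *: intr_row (vec_t n).
  apply/rowP => -[[|l] li]; rewrite !mxE /=; first by rewrite mulr1.
  by rewrite -!pmulrn !mulr_natr mulrnBl; ring.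
split=> [[c [_ [_ [[t ->] [t' ->] ->]]]]|[al ->]].
  by rewrite sub scalerA; eexists.
exists 1, (pt n al j r), (pt n 0 j r).
by split; [exists al|exists 0|rewrite sub subr0 scale1r].
Qed.

Lemma combo_eq0 n (f : pred nat) al be l : (l < n.+1)%N -> f l -> combo n f al be = 0 ->
  al = 0 /\ be = 0.
Proof.
move=> ln fl e; have a0 : al = 0 by rewrite -(combo0 n f al be) e mxE.
split=> //; have := height_combo f al be ln.
by rewrite e fl mulr1 /height !mxE mul0rn subr0.
Qed.

Lemma has_dim_stratum n N j r : (n < N)%N -> (j < n.+1)%N ->
  has_dim (stratum n N j r) 2.
Proof.
move=> nN jn; have jN : (j < N)%N by apply: leq_trans nN.
pose B : 'M[R]_(1 + 1, n.+2) :=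
  col_mx (intr_row (vec_t n)) (intr_row (vec_x n (above j r))).
have BE (u : 'rV[R]_(1 + 1)) : u *m B =
    combo n (above j r) (u 0 (lshift 1 ord0)) (u 0 (rshift 1 ord0)).
  rewrite -[u in LHS]hsubmxK mul_row_col /combo.
  by rewrite [lsubmx u]mx11_scalar [rsubmx u]mx11_scalar !mul_scalar_mx !mxE.
exists (B : 'M_(2, _)).
  rewrite -kermx_eq0; apply/eqP/row_matrixP => i; rewrite row0.
  have := row_sub i (kermx B); move/sub_kermxP; rewrite BE.
  move/(combo_eq0 jn (above_self j r)) => [u0 u1].
  apply/rowP => k; rewrite [RHS]mxE.
  by case: (@split_ordP 1 1 k) => k' ->; rewrite ord1.
apply/seteqP; split=> v /=.
  move/(direction_stratum r v nN jN) => [al [be ->]].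
  apply/submxP; exists (row_mx al%:M be%:M : 'rV_(1 + 1)).
  by rewrite BE row_mxEl row_mxEr !mxE.
move=> /submxP[u ->]; apply/direction_stratum => //.
by rewrite BE; eexists; eexists.
Qed.

Lemma has_dim_line n j r : has_dim (line n j r) 1.
Proof.
exists (intr_row (vec_t n)).
  rewrite -kermx_eq0; apply/eqP/row_matrixP => i; rewrite row0.
  have := row_sub i (kermx (intr_row (vec_t n) : 'rV[R]_n.+2)); move/sub_kermxP.
  move: (row i _) => u; rewrite [u in u *m _]mx11_scalar mul_scalar_mx.
  move/rowP => /(_ ord0); rewrite !mxE /= mulr1 => e.
  by apply/rowP => k; rewrite ord1 mxE.
apply/seteqP; split=> v /=.
  by move/direction_line => [al ->]; rewrite scalemx_sub.
by move=> /sub_rVP[al ->]; apply/direction_line; exists al.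
Qed.

Lemma has_dim_inj n (s : set 'rV[R]_n) k k' : has_dim s k -> has_dim s k' -> k = k'.
Proof.
move=> [B fB e] [B' fB' e'].
move: fB fB'; rewrite /row_free => /eqP <- /eqP <-.
have BB (v : 'rV[R]_n) : (v <= B)%MS <-> (v <= B')%MS.
  by have /= -> := congr1 (fun S : set _ => S v) (etrans (esym e) e').
apply/eqP; rewrite eqn_leq !mxrankS //; apply/rV_subP => v; first by move/BB.
by move=> h; apply/BB.
Qed.

Definition height_col n (l : nat) : 'cV[int]_n.+2 :=
  delta_mx (inord l.+1) 0 - M%:Z *: delta_mx ord0 0.

Lemma mul_height_col n (w : 'rV[R]_n.+2) l :
  (w *m map_mx intr (height_col n l)) 0 0 = height w l.
Proof.
rewrite map_mxB map_mxZ !map_delta_mx mulmxBr -scalemxAr -!colE !mxE.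
by rewrite /height -mulr_natl.
Qed.

Lemma stratum_line n N j r a : cell N j r a -> line n j a `<=` stratum n N j r.
Proof. by move=> ac _ [t ->]; exists t, a. Qed.

(** The height over the end j is an integer linear form that restricts to the
    parameter x on the stratum. *)
Lemma face_extremal n N j r a : (j < n.+1)%N -> cell N j r a ->
  (forall x, cell N j r x -> x <= a) \/ (forall x, cell N j r x -> a <= x) ->
  face (line n j a) (stratum n N j r).
Proof.
move=> jn ac ext; split; first by exists (pt n 0 j a), 0.
pose h := map_mx intr (height_col n j) : 'cV[R]_n.+2.
have hE t x : (pt n t j x *m h) 0 0 = x by rewrite mul_height_col height_pt // cutjj.
have [sg sgP] : exists sg : R, forall x, cell N j r x -> sg * a <= sg * x /\
    (sg * x <= sg * a -> x = a).
  case: ext => ext; [exists (-1)|exists 1] => x /ext xa.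
    by rewrite !mulN1r !lerN2; split=> // ax; apply/eqP; rewrite eq_le xa.
  by rewrite !mul1r; split=> // ax; apply/eqP; rewrite eq_le xa ax.
have sE t x : (pt n t j x *m (sg *: h)) 0 0 = sg * x by rewrite -scalemxAr mxE hE.
exists (sg *: h); apply/seteqP; split=> w /=.
  move=> [t ->]; split=> [|_ [t' [x [xc ->]]]]; first exact: (stratum_line ac (ex_intro _ t erefl)).
  by rewrite !sE; exact: (sgP x xc).1.
move=> [[t [x [xc ->]]]] /(_ (pt n 0 j a)) h0.
exists t; congr pt; apply: (sgP x xc).2.
by have := h0 (stratum_line ac (ex_intro _ 0 erefl)); rewrite !sE.
Qed.

Lemma face_refl n (s : set 'rV[R]_n) : s !=set0 -> face s s.
Proof.
move=> s0; split=> //; exists 0; apply/seteqP; split=> [x sx|x [] //].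
by split=> // y _; rewrite !mulmx0.
Qed.

Lemma stratum_nonempty n N j r : stratum n N j r !=set0.
Proof. by exists (pt n 0 j r), 0, r; split=> //; exact: cell_self. Qed.

(** A proper face is cut out by an extremal value of the tree coordinate, which
    is a branch point. *)
Lemma edge_line n N j r t : (n < N)%N -> (j < n.+1)%N ->
  face t (stratum n N j r) -> has_dim t 1 ->
  exists2 a, t = line n j a & cell N j r a /\
    exists2 l, (l < N)%N & D j l = a%:E.
Proof.
move=> nN jn [[p tp] [u tE]] dt; have jN : (j < N)%N by exact: leq_trans nN.
have [[t0 [x0 [x0c pE]]] pmin] : [set x | stratum n N j r x /\
  forall y, stratum n N j r y -> (x *m u) 0 0 <= (y *m u) 0 0] p by rewrite -tE.
pose al := (intr_row (vec_t n) *m u) 0 0.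
pose be := (intr_row (vec_x n (above j r)) *m u) 0 0.
have diff t1 x1 t2 x2 : cell N j r x1 -> cell N j r x2 ->
    (pt n t1 j x1 *m u) 0 0 - (pt n t2 j x2 *m u) 0 0 = (t1 - t2) * al + (x1 - x2) * be.
  have evB (w w' : 'rV[R]_n.+2) : (w *m u) 0 0 - (w' *m u) 0 0 = ((w - w') *m u) 0 0.
    by rewrite mulmxBl !mxE.
  have evD (w w' : 'rV[R]_n.+2) : ((w + w') *m u) 0 0 = (w *m u) 0 0 + (w' *m u) 0 0.
    by rewrite mulmxDl !mxE.
  have evZ c (w : 'rV[R]_n.+2) : ((c *: w) *m u) 0 0 = c * (w *m u) 0 0.
    by rewrite -scalemxAl mxE.
  by move=> c1 c2; rewrite evB (pt_sub t1 t2 nN c1 c2) evD !evZ.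
have le t1 x1 : cell N j r x1 -> 0 <= (t1 - t0) * al + (x1 - x0) * be.
  move=> c1; rewrite -(diff t1 x1 t0 x0 c1 x0c) subr_ge0 -pE; apply: pmin.
  by exists t1, x1.
(* Otherwise the linear form is unbounded below along the line direction. *)
have al0 : al = 0.
  have := le (t0 + al * -1) x0 x0c; rewrite subrr mul0r addr0 addrC addKr mulrN1.
  by rewrite mulNr oppr_ge0 -expr2 => h; apply/eqP; rewrite -sqrf_eq0 eq_le h sqr_ge0.
(* Otherwise the face is the whole stratum. *)
have be0 : be != 0.
  apply/eqP => be0; suff e : t = stratum n N j r.
    by rewrite e in dt; have := has_dim_inj dt (has_dim_stratum r nN jn).
  rewrite tE; apply/seteqP; split=> [x []//|_ [t1 [x1 [c1 ->]]]].
  split=> [|_ [t2 [x2 [c2 ->]]]]; first by exists t1, x1.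
  by rewrite -subr_ge0 diff // al0 be0 !mulr0 addr0.
have ext x : cell N j r x -> 0 <= (x - x0) * be.
  by move=> /(le t0); rewrite subrr mul0r add0r.
exists x0.
  rewrite tE; apply/seteqP; split=> [_ [[t1 [x1 [c1 ->]]] m1]|_ [t1 ->]].
    exists t1; congr pt; apply/eqP; rewrite -subr_eq0.
    have := m1 (pt n t0 j x0) (ex_intro _ t0 (ex_intro _ x0 (conj x0c erefl))).
    rewrite -subr_le0 diff // al0 mulr0 add0r => h1.
    have /eqP : (x1 - x0) * be = 0 by apply/eqP; rewrite eq_le h1 ext.
    by rewrite mulf_eq0 (negPf be0) orbF.
  split=> [|_ [t2 [x2 [c2 ->]]]]; first by exists t1, x0.
  by rewrite -subr_ge0 diff // al0 mulr0 add0r ext.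
(* Away from the distances, the height can move both ways. *)
split=> //; apply: contrapT => nv.
have [d d0 dP] := gap N x0.
have cpm e : `|e| <= d -> cell N j r (x0 + e).
  rewrite ler_norml => /andP[e1 e2].
  have lo : x0 - d <= x0 + e by lra.
  have up : x0 + e <= x0 + d by lra.
  move=> l lN; have := x0c l lN.
  have nl : D j l != x0%:E by apply/eqP => h; apply: nv; exists l.
  case: (dP j l jN lN) => [h|h|h]; case: above => h'.
  - by have := le_lt_trans h' h; rewrite lte_fin ltNge gerBl ltW.
  - by apply: (le_trans (ltW h)); rewrite lee_fin.
  - by rewrite h eqxx in nl.
  - by rewrite h eqxx in nl.
  - by apply: (le_trans _ (ltW h)); rewrite lee_fin.
  - by have := lt_le_trans h h'; rewrite lte_fin ltNge lerDl ltW.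
have h1 := ext _ (cpm d _); have h2 := ext _ (cpm (- d) _).
have {}h1 : 0 <= d * be by rewrite -(addrK x0 d) [d + x0]addrC h1 // gtr0_norm.
have {}h2 : d * be <= 0.
  by rewrite -oppr_ge0 -mulNr -(addrK x0 (- d)) [- d + x0]addrC h2 // normrN gtr0_norm.
have /eqP : d * be = 0 by apply/eqP; rewrite eq_le h1 h2.
by rewrite mulf_eq0 (negPf be0) gt_eqF.
Qed.

Lemma rational_polyhedron_fin n (T : finType) (A : T -> 'cV[int]_n) (b : T -> R)
    (s : set 'rV[R]_n) : s !=set0 ->
  (forall x, s x <-> forall k, (x *m map_mx intr (A k)) 0 0 <= b k) ->
  rational_polyhedron s.
Proof.
move=> s0 sP; split=> //.
exists #|T|, (\matrix_(i, k) A (enum_val k) i 0), (\row_k b (enum_val k)).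
have E x k : (x *m map_mx intr (\matrix_(i, k) A (enum_val k) i 0)) 0 k =
    (x *m map_mx intr (A (enum_val k))) 0 0 :> R.
  by rewrite !mxE; apply: eq_bigr => i _; rewrite !mxE.
apply/seteqP; split=> x /=.
  by move=> /sP h k; rewrite E [leRHS]mxE; exact: h.
by move=> h; apply/sP => k; have := h (enum_rank k); rewrite E [leRHS]mxE enum_rankK.
Qed.

Lemma stratumP n N j r w : (n < N)%N -> (j < n.+1)%N ->
  stratum n N j r w <->
  (forall l, (l < n.+1)%N -> if above j r l then height w l = height w j
                           else height w l = fine (D j l)) /\
  cell N j r (height w j).
Proof.
move=> nN jn; split=> [[t [x [xc ->]]]|[wh wc]].
  split=> [l ln|]; last by rewrite height_pt // cutjj.
  rewrite !height_pt // cutjj (cut_cell xc) ?(leq_trans ln) //.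
  by case: above.
exists (w 0 ord0), (height w j); split=> //.
apply: row_height => [|l ln]; first by rewrite pt0.
rewrite height_pt // (cut_cell wc) ?(leq_trans ln) //.
by have := wh l ln; case: above.
Qed.

Lemma rational_stratum n N j r : (n < N)%N -> (j < n.+1)%N ->
  rational_polyhedron (stratum n N j r).
Proof.
move=> nN jn.
(* The equations fixing the height over each end, as pairs of inequalities, and
   the inequalities of the cell. *)
pose A (k : ('I_n.+1 * bool) + ('I_N)) : 'cV[int]_n.+2 := match k with
  | inl (l, s) => (-1) ^+ s *: (if above j r l
      then height_col n l - height_col n j else height_col n l)
  | inr l => if above j r l then (if l == j :> nat then 0 else height_col n j)
             else - height_col n j
  end.
pose b (k : ('I_n.+1 * bool) + ('I_N)) : R := match k with
  | inl (l, s) => (-1) ^+ s * (if above j r l then 0 else fine (D j l))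
  | inr l => if above j r l then (if l == j :> nat then 0 else fine (D j l))
             else - fine (D j l)
  end.
have HB (w : 'rV[R]_n.+2) (c c' : 'cV[int]_n.+2) :
    (w *m map_mx intr (c - c')) 0 0 =
    (w *m map_mx intr c) 0 0 - (w *m map_mx intr c') 0 0 :> R.
  by rewrite map_mxB mulmxBr !mxE.
have HN (w : 'rV[R]_n.+2) (c : 'cV[int]_n.+2) :
    (w *m map_mx intr (- c)) 0 0 = - (w *m map_mx intr c) 0 0 :> R.
  by rewrite map_mxN mulmxN mxE.
have H0 (w : 'rV[R]_n.+2) : (w *m map_mx intr (0 : 'cV[int]_n.+2)) 0 0 = 0 :> R.
  by rewrite map_mx0 mulmx0 mxE.
apply: (@rational_polyhedron_fin _ _ A b); first exact: stratum_nonempty.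
move=> w; split=> [/(stratumP _ _ nN jn)[wh wc]|h].
  move=> [[l s]|l] /=.
    have := wh l (ltn_ord l); case: above => e; case: s; rewrite /= ?expr0 ?expr1.
    - by rewrite scaleN1r HN HB !mul_height_col e subrr oppr0 mulr0.
    - by rewrite scale1r HB !mul_height_col e subrr mulr0.
    - by rewrite scaleN1r HN mul_height_col e mulN1r.
    - by rewrite scale1r mul_height_col e mul1r.
  have := wc l (ltn_ord l); case: above => e.
    have [|lj] := eqVneq (l : nat) j; first by rewrite H0.
    by rewrite mul_height_col -lee_fin fineK // Dfin // eq_sym.
  by rewrite HN mul_height_col lerN2 -lee_fin fineK // (D_le_fin e).
apply/stratumP => //; split=> [l ln|l lN].
  have := h (inl (Ordinal ln, true)); have := h (inl (Ordinal ln, false)) => /=.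
  rewrite /= expr0 expr1 scale1r scaleN1r mul1r mulN1r HN; case: above.
    rewrite HB !mul_height_col oppr0 oppr_le0 subr_le0 subr_ge0 => h1 h2.
    by apply/eqP; rewrite eq_le h1.
  by rewrite mul_height_col lerN2 => h1 h2; apply/eqP; rewrite eq_le h1.
have := h (inr (Ordinal lN)) => /=; case: ifPn => al.
  have [->|lj] := eqVneq l j; first by rewrite Djj leey.
  by rewrite mul_height_col -lee_fin fineK // Dfin // eq_sym.
rewrite HN mul_height_col lerN2 -lee_fin fineK //.
by move: al; rewrite /above -leNgt => /D_le_fin.
Qed.

Definition tree_complex n (N : nat) : wcomplex R n.+2 := fun s =>
  `[< exists j r, (j < n.+1)%N /\ s = stratum n N j r >] : nat.
Arguments tree_complex : clear implicits.

Lemma facets_tree n N s : facets (tree_complex n N) s <->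
  exists j r, (j < n.+1)%N /\ s = stratum n N j r.
Proof.
rewrite /facets /= /tree_complex; case: asboolP => // h; split=> // _.
Qed.

Lemma tree_complexE n N s : facets (tree_complex n N) s -> tree_complex n N s = 1%N.
Proof. by rewrite /facets /= /tree_complex; case: asboolP. Qed.

(** A stratum only depends on the end and on the signs of the finitely many
    distances. *)
Lemma finite_facets n N : finite_set (facets (tree_complex n N)).
Proof.
pose S (k : 'I_n.+1 * {ffun 'I_N -> bool}) : set 'rV[R]_n.+2 :=
  [set w | exists t x, (forall l : 'I_N, if k.2 l then (x%:E <= D k.1 l)%E
                        else (D k.1 l <= x%:E)%E) /\ w = pt n t k.1 x].
apply: (@sub_finite_set _ _ (S @` setT)); last exact/finite_image/finite_finset.
move=> s /facets_tree[j [r [jn ->]]].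
exists (Ordinal jn, [ffun l : 'I_N => above j r l]) => //.
apply/seteqP; split=> w [t [x [xc ->]]]; exists t, x; split=> //.
  by move=> l lN; have := xc (Ordinal lN); rewrite ffunE.
by move=> l; rewrite ffunE; exact: xc.
Qed.

Lemma above_sep j r r' l : r < r' -> above j r l != above j r' l ->
  exists v, [/\ D j l = v%:E, above j r l & ~~ above j r' l].
Proof.
move=> rr; rewrite /above; case: ltP => h; case: ltP => h' // _.
  by exists (fine (D j l)); rewrite fineK // (D_le_fin h').
by have := lt_trans h' (le_lt_trans h _); rewrite -(lte_fin r r') in rr; have := lt_le_trans (lt_trans rr h') h; rewrite ltxx.
Qed.

(** Two strata that meet are equal, or meet along the line over a branch point
    that is extremal in both. *)
Lemma strata_meet n N j l r r' : (n < N)%N -> (j < n.+1)%N -> (l < n.+1)%N ->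
  let s := stratum n N j r in let s' := stratum n N l r' in
  s `&` s' = set0 \/ face (s `&` s') s /\ face (s `&` s') s'.
Proof.
move=> nN jn ln s s'.
have jN : (j < N)%N by exact: leq_trans nN.
have lN : (l < N)%N by exact: leq_trans nN.
have [->|ne] := eqVneq s s'.
  by right; rewrite setIid; split; apply: face_refl; exact: stratum_nonempty.
have [|/set0P[w0 sw]] := eqVneq (s `&` s') set0; [by left|right].
(* The meeting height v is the only one, and is extremal in both cells. *)
have key i i' r1 r2 v : (i < n.+1)%N -> (i' < n.+1)%N ->
    (forall x, (x%:E <= D i i')%E -> cell N i r1 x -> cell N i' r2 x -> x = v) ->
    (forall x, cell N i r1 x -> x <= v) \/ (forall x, cell N i r1 x -> v <= x) ->
    (forall x, cell N i' r2 x -> x <= v) \/ (forall x, cell N i' r2 x -> v <= x) ->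
    (stratum n N i r1 `&` stratum n N i' r2) w0 ->
    let I := stratum n N i r1 `&` stratum n N i' r2 in
    face I (stratum n N i r1) /\ face I (stratum n N i' r2).
  move=> il i'l uniq e1 e2 [[t [x [xc we]]] [t' [y [yc we']]]] I.
  have := we; rewrite we' => /esym/(pt_inj il i'l)[_ xy xD]; subst y.
  have xv := uniq x xD xc yc; subst v.
  have -> : I = line n i x.
    apply/seteqP; split=> w.
      move=> [[t1 [x1 [c1 ->]]] [t2 [x2 [c2 /(pt_inj il i'l)[_ e D1]]]]]; subst x2.
      by exists t1; rewrite (uniq x1 D1 c1 c2).
    move=> [t1 ->]; split; exists t1, x; split=> //.
    by rewrite (pt_eq _ _ xD).
  split; first exact: face_extremal.
  by rewrite (line_eq _ xD); exact: face_extremal.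
have bnd i i' r1 : (i' < N)%N -> D i i' \is a fin_num ->
    (forall x, cell N i r1 x -> x <= fine (D i i')) \/
    (forall x, cell N i r1 x -> fine (D i i') <= x).
  move=> i'N Df; have [al|al] := boolP (above i r1 i'); [left|right] => x xc.
    by rewrite -lee_fin fineK // (cell_above xc).
  by rewrite -lee_fin fineK // (cell_below xc).
have apart i i' r1 : ~~ above i r1 i' -> D i i' \is a fin_num.
  by rewrite /above -leNgt => /D_le_fin.
(* If a stratum lies above the height where the paths part, they meet at that
   height; otherwise the second one lies on the path to j as well. *)
have [jl|jl] := boolP (above j r l); last first.
  have Df := apart _ _ _ jl.
  apply: (key j l r r' (fine (D j l))) => //; first 1 last.
  - exact: bnd.
  - by rewrite (Dsym j l); apply: bnd; rewrite // Dsym.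
  move=> x xD xc _; apply: EFin_inj; rewrite fineK //.
  by apply/eqP; rewrite eq_le xD (cell_below xc).
have [lj|lj] := boolP (above l r' j); last first.
  have Df := apart _ _ _ lj.
  apply: (key j l r r' (fine (D l j))) => //; first 1 last.
  - by rewrite (Dsym l j); apply: bnd; rewrite // Dsym.
  - exact: bnd.
  move=> x xD _ xc; apply: EFin_inj; rewrite fineK //.
  by apply/eqP; rewrite eq_le Dsym xD Dsym (cell_below xc).
have e' : s' = stratum n N j r' by exact: stratum_eq.
rewrite e' in sw ne *.
have [k [kN kne]] : exists k, (k < N)%N /\ above j r k != above j r' k.
  apply: contrapT => h; case/eqP: ne; apply: eq_stratum => k kN.
  by apply/eqP/negPn/negP => kne; apply: h; exists k.
have sep r1 r2 v : D j k = v%:E -> above j r1 k -> ~~ above j r2 k ->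
    (forall x, cell N j r1 x -> x <= v) /\ (forall x, cell N j r2 x -> v <= x).
  move=> Dv a1 a2; split=> x xc; rewrite -lee_fin -Dv.
    exact: (cell_above xc).
  exact: (cell_below xc).
have [rr|rr|rr] := ltgtP r r'; last by rewrite rr eqxx in kne.
  have [v [Dv a1 a2]] := above_sep rr kne; have [s1 s2] := sep _ _ _ Dv a1 a2.
  apply: (key j j r r' v) => //; [|by left|by right].
  by move=> x _ c1 c2; apply/eqP; rewrite eq_le s1 // s2.
rewrite eq_sym in kne.
have [v [Dv a1 a2]] := above_sep rr kne; have [s1 s2] := sep _ _ _ Dv a1 a2.
apply: (key j j r r' v) => //; [|by right|by left].
by move=> x _ c1 c2; apply/eqP; rewrite eq_le s1 // s2.
Qed.

Lemma tree_surface n N : (n < N)%N -> polyhedral_surface (tree_complex n N).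
Proof.
move=> nN; split; first exact: finite_facets.
  move=> s /facets_tree[j [r [jn ->]]].
  by split; [exact: rational_stratum|exact: has_dim_stratum].
move=> s s' /facets_tree[j [r [jn ->]]] /facets_tree[l [r' [ln ->]]].
exact: strata_meet.
Qed.

Lemma supp_tree n N w : supp (tree_complex n N) w <->
  exists t j x, (j < n.+1)%N /\ w = pt n t j x.
Proof.
split=> [[s /facets_tree[j [r [jn ->]]] [t [x [_ ->]]]]|[t [j [x [jn ->]]]]].
  by exists t, j, x.
exists (stratum n N j x); first by apply/facets_tree; exists j, x.
by exists t, x; split=> //; exact: cell_self.
Qed.

Lemma refines_tree n N N' : (N <= N')%N ->
  refines (tree_complex n N') (tree_complex n N).
Proof.
move=> NN; split.
  by apply/seteqP; split=> w /supp_tree h; apply/supp_tree.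
move=> s fs; have /facets_tree[j [r [jn es]]] := fs.
have fs' : facets (tree_complex n N) (stratum n N j r).
  by apply/facets_tree; exists j, r.
exists (stratum n N j r) => //; rewrite !tree_complexE //; split=> //.
rewrite es => _ [t [x [xc ->]]]; exists t, x; split=> // l lN.
by apply: xc; apply: leq_trans NN.
Qed.

(** The height over the end l is an integral coordinate transverse to the line,
    and it takes the value 1 or -1 on the generator. *)
Lemma int_normal n N j l r a (b : bool) : (n < N)%N -> (l < n.+1)%N ->
  (a%:E <= D j l)%E -> cell N l r a ->
  (exists2 e, 0 < e & cell N l r (a + (-1) ^+ b * e)) ->
  primitive_normal (line n j a) (stratum n N l r)
    ((-1) ^+ b *: vec_x n (above l r)).
Proof.
move=> nN ln ajl ac [e e0 ec]; have lN : (l < N)%N by exact: leq_trans nN.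
have vE : intr_row ((-1) ^+ b *: vec_x n (above l r)) =
    combo n (above l r) 0 ((-1) ^+ b) :> 'rV[R]_n.+2.
  rewrite /intr_row map_mxZ /combo scale0r add0r; congr (_ *: _).
  by case: b {ec}.
split.
- by rewrite vE; apply/direction_stratum => //; eexists; eexists.
- move=> u /(direction_stratum r _ nN lN)[al [be uE]].
  pose k : int := (-1) ^+ b * (u 0 (inord l.+1) - u 0 ord0 * M%:Z).
  exists k; apply/direction_line; exists al.
  have kE : k%:~R = (-1) ^+ b * be :> R.
    rewrite rmorphM rmorphB rmorphM /= rmorphXn rmorphN1; congr (_ * _).
    have := height_combo (above l r) al be ln; rewrite -uE above_self mulr1 => <-.
    by rewrite /height !mxE -mulr_natr.
  rewrite /intr_row map_mxB map_mxZ [map_mx _ u]uE [map_mx _ (_ *: _)]vE /=.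
  rewrite comboZ /combo mulr0 scale0r add0r kE mulrAC -expr2 sqrr_sign mul1r.
  by rewrite addrK.
exists (pt n 0 l a); first by exists 0; rewrite (pt_eq _ _ ajl).
exists e => //; exists 0, (a + (-1) ^+ b * e); split=> //.
have := pt_sub 0 0 nN ec ac; rewrite subr0 [a + _]addrC addrK => h.
by rewrite vE comboZ mulr0 [e * _]mulrC -h [LHS]addrC subrK.
Qed.

Lemma line_sub n N j l r a : (j < n.+1)%N -> (l < n.+1)%N ->
  line n j a `<=` stratum n N l r -> (a%:E <= D j l)%E /\ cell N l r a.
Proof.
move=> jn ln /(_ (pt n 0 j a)) []; first by exists 0.
by move=> t [x [xc /(pt_inj jn ln)[_ ax aD]]]; rewrite ax in aD *.
Qed.

Section Branching.
Context (n N j : nat) (a d : R).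
Hypotheses (nN : (n < N)%N) (jn : (j < n.+1)%N) (d0 : 0 < d).
Hypothesis dP : forall i l, (i < N)%N -> (l < N)%N ->
  [\/ (D i l < (a - d)%:E)%E, D i l = a%:E | ((a + d)%:E < D i l)%E].
Hypothesis vertex : exists2 l, (l < N)%N & D j l = a%:E.

Local Notation up l := (stratum n N l a).
Local Notation down := (stratum n N j (a - d)).

Let jN : (j < N)%N. Proof. exact: leq_trans nN. Qed.

Lemma below_gap i l : (i < N)%N -> (l < N)%N -> above i (a - d) l = (a%:E <= D i l)%E.
Proof.
move=> iN lN; rewrite /above; case: (dP iN lN) => [h|->|h].
- rewrite ltNge (ltW h) /=; apply/esym/negbTE; rewrite -ltNge.
  by apply: (lt_trans h); rewrite lte_fin gtrBl.
- by rewrite lexx lte_fin gtrBl.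
- rewrite (ltW (lt_trans _ h)) ?lte_fin ?ltrDl //.
  by apply: lt_trans h; rewrite lte_fin (@lt_trans _ _ a) ?gtrBl ?ltrDl.
Qed.

Lemma down_cell : cell N j (a - d) a.
Proof.
move=> l lN; rewrite below_gap //; case: ifPn => //; rewrite -ltNge.
exact: ltW.
Qed.

Lemma down_le x : cell N j (a - d) x -> x <= a.
Proof.
move=> xc; have [l lN Dl] := vertex.
by rewrite -lee_fin -Dl (cell_above xc) // below_gap // Dl.
Qed.

Lemma star_below l r : (l < n.+1)%N -> (a%:E <= D j l)%E -> cell N l r a ->
  r < a -> stratum n N l r = down.
Proof.
move=> ln ajl ac ra; have lN : (l < N)%N by exact: leq_trans nN.
rewrite (@stratum_eq n N j l) //; last by rewrite below_gap.
apply: eq_stratum => k kN; rewrite below_gap //.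
apply/idP/idP => [ak|]; first exact: cell_above ac _ _.
by apply: lt_le_trans; rewrite lte_fin.
Qed.

(** A facet through the edge has its sample point at or above it, and is then the
    branch starting there, or below it, and then lies on the path to j. *)
Lemma star_line s : facets (tree_complex n N) s -> line n j a `<=` s ->
  (exists l, [/\ (l < n.+1)%N, (a%:E <= D j l)%E & s = up l]) \/ s = down.
Proof.
move=> /facets_tree[l [r [ln ->]]] /(line_sub jn ln)[ajl ac].
have [ar|ra] := leP a r; last by right; exact: star_below.
left; exists l; split=> //; apply: eq_stratum => k kN; rewrite /above.
apply/idP/idP => [|ak]; first by apply: le_lt_trans; rewrite lee_fin.
rewrite ltNge; apply/negP => rk; have := cell_below ac kN.
by rewrite /above -leNgt => /(_ rk); rewrite leNgt ak.
Qed.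

Lemma up_facet_line l : (l < n.+1)%N -> (a%:E <= D j l)%E ->
  facets (tree_complex n N) (up l) /\ line n j a `<=` up l.
Proof.
move=> ln ajl; split; first by apply/facets_tree; exists l, a.
by rewrite (line_eq _ ajl); apply: stratum_line; exact: cell_self.
Qed.

Lemma down_facet_line : facets (tree_complex n N) down /\ line n j a `<=` down.
Proof.
split; first by apply/facets_tree; exists j, (a - d).
by apply: stratum_line; exact: down_cell.
Qed.

Lemma up_eq l l' : (l < n.+1)%N -> (l' < n.+1)%N -> (up l == up l') = above l a l'.
Proof.
move=> ln ln'; have lN : (l < N)%N by exact: leq_trans nN.
have lN' : (l' < N)%N by exact: leq_trans nN.
apply/eqP/idP => [e|]; last exact: stratum_eq.
have [b b0 bc] := cell_gap a lN.
have : up l (pt n 0 l (a + b)) by exists 0, (a + b).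
rewrite e => -[t [x [_ /(pt_inj ln ln')[_ _]]]].
by apply: lt_le_trans; rewrite lte_fin ltrDl.
Qed.

Lemma up_down l : (l < n.+1)%N -> (up l == down) = false.
Proof.
move=> ln; have lN : (l < N)%N by exact: leq_trans nN.
apply/eqP => e; have [b b0 bc] := cell_gap a lN.
have : up l (pt n 0 l (a + b)) by exists 0, (a + b).
rewrite e => -[t [x [xc /(pt_inj ln jn)[_ ex _]]]].
by have := down_le xc; rewrite -ex leNgt ltrDl b0.
Qed.

(** One vector for each facet around the edge, written so that the sum over the
    facets can be evaluated one coordinate at a time. *)
Definition branch_normal (s : set 'rV[R]_n.+2) : 'rV[int]_n.+2 :=
  \row_i (if (i : nat) is l.+1 then
    (if (a%:E <= D j l)%E then (s == up l)%:Z - (s == down)%:Z else 0) else 0).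

Lemma branch_normal_up l : (l < n.+1)%N -> (a%:E <= D j l)%E ->
  branch_normal (up l) = vec_x n (above l a).
Proof.
move=> ln ajl; apply/rowP => -[[|k] kn]; rewrite !mxE //=.
have {}kn : (k < n.+1)%N by [].
rewrite up_down // subr0 up_eq //; case: ifPn => // ajk.
case: (boolP (above l a k)) => // alk; case/negP: ajk.
by apply: (Dtri_ge ajl); exact: ltW.
Qed.

Lemma branch_normal_down : branch_normal down = - vec_x n (above j (a - d)).
Proof.
apply/rowP => -[[|k] kn]; rewrite !mxE //=.
have {}kn : (k < n.+1)%N by [].
have kN : (k < N)%N by exact: leq_trans nN.
by rewrite eq_sym up_down // eqxx below_gap //; case: ifP.
Qed.

(** In each coordinate, the branch containing that end of the tree cancels the
    facet below. *)
Lemma balanced_tree : balanced_at (tree_complex n N) (line n j a).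
Proof.
exists branch_normal.
  move=> s fs ts; have [[l [ln ajl ->]]|->] := star_line fs ts.
    have lN : (l < N)%N by exact: leq_trans nN.
    rewrite branch_normal_up // -[vec_x _ _]scale1r -(expr0 (-1)).
    apply: (@int_normal n N j l a a false) => //; first exact: cell_self.
    have [b b0 bc] := cell_gap a lN; exists b => //.
    by rewrite expr0 mul1r.
  rewrite branch_normal_down -scaleN1r -(expr1 (-1)).
  apply: (@int_normal n N j j (a - d) a true) => //; first by rewrite Djj leey.
    exact: down_cell.
  by exists d => //; rewrite expr1 mulN1r; exact: cell_self.
set A := [set s | _].
have fA : finite_set A.
  by apply: sub_finite_set (finite_facets n N) => s [].
apply/direction_line; exists 0; rewrite scale0r fsbig_finite //=.
have sum1 (x : set 'rV[R]_n.+2) : A x ->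
    \sum_(s <- fset_set A) (s == x)%:R = 1 :> R.
  move=> Ax; rewrite (bigD1_seq x) //=; last 2 first.
    by rewrite in_fset_set //; exact: mem_set.
    exact: fset_uniq.
  by rewrite eqxx big1 ?addr0 // => s /negPf ->.
apply/rowP => -[[|k] kn]; rewrite summxE !mxE.
  by rewrite big1 // => s _; rewrite !mxE mulr0.
have kn' : (k < n.+1)%N := kn.
have [ajk|ajk] := boolP (a%:E <= D j k)%E; last first.
  by rewrite big1 // => s _; rewrite !mxE /= (negPf ajk) mulr0.
transitivity (\sum_(s <- fset_set A) ((s == up k)%:R - (s == down)%:R : R)).
  rewrite big_seq [RHS]big_seq; apply: eq_bigr => s.
  rewrite in_fset_set // => /set_mem[fs _].
  by rewrite !mxE /= ajk tree_complexE // mul1r rmorphB.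
rewrite sumrB !sum1 ?subrr //; first exact: down_facet_line.
exact: up_facet_line kn' ajk.
Qed.

End Branching.

Lemma balanced_transfer n (C1 C2 : wcomplex R n) (t : set 'rV[R]_n) :
  (forall s, t `<=` s -> C1 s = C2 s) -> balanced_at C2 t -> balanced_at C1 t.
Proof.
move=> e [v vP vsum]; exists v.
  by move=> s fs ts; apply: vP => //; rewrite /facets /= -e.
have -> : [set s | facets C1 s /\ t `<=` s] = [set s | facets C2 s /\ t `<=` s].
  by apply/seteqP; split=> s [fs ts]; split=> //; move: fs; rewrite /facets /= e.
rewrite (eq_fsbigr (fun s => (C2 s)%:R *: intr_row (v s))) // => s /set_mem[_ ts].
by rewrite e.
Qed.

Section Modification.
Context (n j0 : nat).
Hypothesis j0n : (j0 < n.+1)%N.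
Hypothesis nearest : forall l, (l < n.+1)%N -> (D l n.+1 <= D j0 n.+1)%E.

Let d0 := fine (D j0 n.+1).

(** On the old ends this is the value of the curve with the new center, computed
    from the curve with the nearest old center j0. *)
Definition branch_poly : tpoly n.+2 := @TPoly R n.+2 1
  (fun i => if i == ord0 then 0 else d0)
  (fun i => if i == ord0 then U_(inord j0.+1)%MM else (U_(ord0) *+ M)%MM).

Local Notation P := branch_poly.
Local Notation C := (tree_complex n n.+2).
Local Notation C' := (tree_complex n.+1 n.+2).

Let d0E : D j0 n.+1 = d0%:E.
Proof. by rewrite /d0 fineK // Dfin // ltn_eqF. Qed.

Lemma branch_term0 w : @tp_term R _ P ord0 w = w 0 (inord j0.+1).
Proof.
rewrite /tp_term /= add0r (bigD1 (inord j0.+1)) //= mnm1E eqxx mulr1n.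
by rewrite big1 ?addr0 // => k kj; rewrite mnm1E eq_sym (negPf kj).
Qed.

Lemma branch_term1 w : @tp_term R _ P ord_max w = d0 + w 0 ord0 *+ M.
Proof.
rewrite /tp_term /=; congr (_ + _); rewrite (bigD1 ord0) //= mulmnE mnm1E eqxx mul1n.
by rewrite big1 ?addr0 // => k kj; rewrite mulmnE mnm1E eq_sym (negPf kj) mul0n.
Qed.

Lemma branch_eval w :
  tp_eval P w = Num.min (w 0 (inord j0.+1)) (d0 + w 0 ord0 *+ M).
Proof.
rewrite /tp_eval 2!big_ord_recl big_ord0 /=.
have -> : lift ord0 ord0 = ord_max :> 'I_2 by apply: val_inj.
by rewrite branch_term0 branch_term1 minCA minxx minC.
Qed.

(** Among the old ends, j0 is the nearest to the new one, so the path to j leaves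
    the new path either where it leaves the path to j0 or at height d0. *)
Lemma cut_nearest x j : (j < n.+1)%N ->
  Num.min (cut x (D j j0)) d0 = cut x (D j n.+1).
Proof.
move=> jn; apply: EFin_inj; rewrite EFin_min !cutE ?D_Nny // -d0E.
apply/eqP; rewrite eq_le; apply/andP; split.
  rewrite le_min; apply/andP; split; first by rewrite !ge_min lexx.
  by rewrite -minA ge_min Dtri orbT.
rewrite !le_min !ge_min lexx (nearest jn) orbT andbT /=; apply/orP; right.
by apply: (@Dtri_ge _ j n.+1 j0) => //; rewrite (Dsym n.+1) nearest.
Qed.

Lemma branch_eval_pt t j x : (j < n.+1)%N ->
  tp_eval P (pt n t j x) = t *+ M + cut x (D j n.+1).
Proof.
by move=> jn; rewrite branch_eval ptS // pt0 [d0 + _]addrC -addr_minr cut_nearest.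
Qed.

Lemma append_pt t j x : append (pt n t j x) (t *+ M + cut x (D j n.+1)) = pt n.+1 t j x.
Proof.
apply/rowP => i; rewrite mxE; case: (unliftP ord_max i) => [k|] -> /=.
  by rewrite !mxE /= /bump leqNgt ltn_ord.
by rewrite !mxE /=.
Qed.

Lemma graph_pt t j x : (j < n.+1)%N -> graph_map P (pt n t j x) = pt n.+1 t j x.
Proof. by move=> jn; rewrite /graph_map branch_eval_pt // append_pt. Qed.

Lemma truncate_pt t j x : truncate (pt n.+1 t j x) = pt n t j x.
Proof. by apply/rowP => i; rewrite !mxE /= /bump leqNgt ltn_ord. Qed.

Lemma graph_stratum N j r : (j < n.+1)%N ->
  graph_map P @` stratum n N j r = stratum n.+1 N j r.
Proof.
move=> jn; apply/seteqP; split.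
  by move=> _ [_ [t [x [xc ->]] <-]]; exists t, x; rewrite graph_pt.
move=> _ [t [x [xc ->]]]; exists (pt n t j x); last exact: graph_pt.
by exists t, x.
Qed.

Lemma graph_line j r : (j < n.+1)%N -> graph_map P @` line n j r = line n.+1 j r.
Proof.
move=> jn; apply/seteqP; split.
  by move=> _ [_ [t ->] <-]; exists t; rewrite graph_pt.
by move=> _ [t ->]; exists (pt n t j r); [exists t|exact: graph_pt].
Qed.

Lemma truncate_stratum N j r :
  @truncate R n.+2 @` stratum n.+1 N j r = stratum n N j r.
Proof.
apply/seteqP; split.
  by move=> _ [_ [t [x [xc ->]] <-]]; exists t, x; rewrite truncate_pt.
move=> _ [t [x [xc ->]]]; exists (pt n.+1 t j x); last exact: truncate_pt.
by exists t, x.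
Qed.

Lemma facets_graph s : facets (graph_complex C P) s <->
  exists j r, (j < n.+1)%N /\ s = stratum n.+1 n.+2 j r.
Proof.
rewrite /facets /= /graph_complex; split.
  case: asboolP => // sE /facets_tree[j [r [jn e]]].
  by exists j, r; split=> //; rewrite sE e graph_stratum.
move=> [j [r [jn ->]]]; rewrite truncate_stratum; case: asboolP => [_|].
  by apply/facets_tree; exists j, r.
by case; rewrite graph_stratum.
Qed.

Lemma graph_complexE s : facets (graph_complex C P) s -> graph_complex C P s = 1%N.
Proof.
rewrite /facets /= /graph_complex; case: asboolP => // _.
exact: tree_complexE.
Qed.

Local Notation new := (stratum n.+1 n.+2 n.+1 d0).

Let nearest' l : (l < n.+1)%N -> (D n.+1 l <= d0%:E)%E.
Proof. by move=> ln; rewrite Dsym -d0E nearest. Qed.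

Lemma new_cell x : cell n.+2 n.+1 d0 x <-> d0 <= x.
Proof.
split=> [xc|dx l]; last first.
  rewrite ltnS leq_eqVlt => /orP[/eqP ->|ln]; first by rewrite above_self Djj leey.
  rewrite /above ltNge nearest' //=; apply: (le_trans (nearest' ln)).
  by rewrite lee_fin.
rewrite -lee_fin -d0E Dsym; apply: cell_below xc _ _; first by rewrite ltnW.
by rewrite /above Dsym d0E ltxx.
Qed.

Lemma up_facet_new : up_facet P (line n j0 d0) = new.
Proof.
have ap t x : d0 <= x -> append (pt n t j0 d0) (t *+ M + x) = pt n.+1 t n.+1 x.
  move=> dx; rewrite -append_pt cutjj; congr append.
  apply: row_height => [|l ln]; first by rewrite !pt0.
  rewrite !height_pt // (@cut_eq d0 j0 n.+1) ?d0E // !cut_r ?nearest' //.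
  by apply: (le_trans (nearest' ln)); rewrite lee_fin.
apply/seteqP; split=> z.
  move=> [_ [y [[t ->] + ->]]]; rewrite branch_eval_pt // d0E cut_l ?lexx // => ty.
  have dx : d0 <= y - t *+ M by rewrite lerBrDl.
  by exists t, (y - t *+ M); split; [apply/new_cell|rewrite -ap // addrC subrK].
move=> [t [x [/new_cell dx ->]]]; exists (pt n t j0 d0), (t *+ M + x).
split; [by exists t| |by rewrite ap].
by rewrite branch_eval_pt // d0E cut_l ?lexx // lerD2l.
Qed.

(** Below d0 the path to the new end is the path to j0; only the ray above d0
    is new. *)
Lemma facets_new s : facets C' s ->
  (exists j r, (j < n.+1)%N /\ s = stratum n.+1 n.+2 j r) \/ s = new.
Proof.
move=> /facets_tree[j [r [jn ->]]].
move: jn; rewrite ltnS leq_eqVlt => /orP[/eqP ->|jn]; last by left; exists j, r.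
have [rd|dr] := ltP r d0.
  left; exists j0, r; split=> //; apply: stratum_eq => //; first exact: ltnW.
  by rewrite /above Dsym d0E lte_fin.
right; apply: eq_stratum => l; rewrite ltnS leq_eqVlt => /orP[/eqP ->|ln].
  by rewrite !above_self.
rewrite /above ![(_ < D _ _)%E]ltNge (nearest' ln); congr (~~ _).
by rewrite (le_trans (nearest' ln)) // lee_fin.
Qed.

Lemma new_facet : facets C' new.
Proof. by apply/facets_tree; exists n.+1, d0. Qed.

Lemma line_new j a : (j < n.+1)%N -> line n.+1 j a `<=` new ->
  line n j a = line n j0 d0.
Proof.
move=> jn /line_sub[]; [exact: ltnW|by []|] => aD /new_cell da.
have ad : a = d0.
  apply/eqP; rewrite eq_le da andbT -lee_fin; apply: (le_trans aD).
  by rewrite Dsym nearest'.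
rewrite ad in aD *; apply: line_eq.
by apply: (@Dtri_ge _ j n.+1 j0) => //; rewrite Dsym d0E.
Qed.

(** The graph and its completion have the same facets around all other edges, so
    balancing of the completion is balancing of the graph there. *)
Lemma graph_weight j a s : (j < n.+1)%N -> line n j a <> line n j0 d0 ->
  line n.+1 j a `<=` s -> graph_complex C P s = C' s.
Proof.
move=> jn ne ls.
have [/facets_graph[i [r [im e]]]|nG] := pselect (facets (graph_complex C P) s).
  rewrite graph_complexE ?tree_complexE //; last by apply/facets_graph; exists i, r.
  by apply/facets_tree; exists i, r; split=> //; exact: ltnW.
have -> : graph_complex C P s = 0%N by apply/eqP/negPn/negP.
apply/esym/eqP/negPn/negP => /facets_new[h|e]; first by apply/nG/facets_graph.
by apply: ne; apply: line_new => //; rewrite -e.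
Qed.

Lemma vertex_edge j a : (j < n.+1)%N -> (exists2 l, (l < n.+2)%N & D j l = a%:E) ->
  balanced_at C' (line n.+1 j a).
Proof.
move=> jn v; have [d dpos dP] := gap n.+2 a.
by apply: (@balanced_tree _ _ _ _ d) => //; exact: ltnW.
Qed.

Lemma edges_line t : edges C t -> exists j a,
  [/\ (j < n.+1)%N, t = line n j a & exists2 l, (l < n.+2)%N & D j l = a%:E].
Proof.
move=> [t1 [_ /facets_tree[j [r [jn ->]]] ft]].
have [a te [_ v]] := edge_line (ltnW (ltnSn n.+1)) jn ft t1.
by exists j, a.
Qed.

(** Over the branching edge, the height over the new end is constant on all
    facets of the graph but the one below. *)
Lemma branch_unbalanced :
  ~ balanced_at (graph_complex C P) (line n.+1 j0 d0).
Proof.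
have j0n2 : (j0 < n.+2)%N by exact: ltnW.
have [d dpos dP] := gap n.+2 d0.
have vx : exists2 l, (l < n.+2)%N & D j0 l = d0%:E by exists n.+1.
have bg := below_gap dpos dP.
pose down := stratum n.+1 n.+2 j0 (d0 - d).
have fdown : facets (graph_complex C P) down by apply/facets_graph; exists j0, (d0 - d).
have ldown : line n.+1 j0 d0 `<=` down.
  by have [] := down_facet_line (ltnSn n.+1) j0n2 dpos dP.
move=> [v vP]; set A := [set s | _].
have fA : finite_set A.
  apply: sub_finite_set (finite_facets n.+1 n.+2) => s [/facets_graph[j [r [jn ->]]] _].
  by apply/facets_tree; exists j, r; split=> //; exact: ltnW.
pose h (w : 'rV[R]_n.+3) := (w *m map_mx intr (height_col n.+1 n.+1)) 0 0.
have hE w : h w = height w n.+1 by exact: mul_height_col.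
have hc f al be : h (combo n.+1 f al be) = be * (f n.+1)%:R by rewrite hE height_combo.
have hB w w' : h (w - w') = h w - h w' by rewrite /h mulmxBl !mxE.
have hZ c w : h (c *: w) = c * h w by rewrite /h -scalemxAl mxE.
have hline w : direction (line n.+1 j0 d0) w -> h w = 0.
  move=> /direction_line[al ->].
  by have := hc xpred0 al 0; rewrite mul0r /combo scale0r addr0.
move=> /hline; rewrite fsbig_finite //= /h mulmx_suml summxE => sum0.
have := sum0; rewrite (bigD1_seq down) //=; last 2 first.
- by rewrite in_fset_set //; apply: mem_set.
- exact: fset_uniq.
rewrite big_seq_cond big1 => [|s /andP[]]; last first.
  rewrite in_fset_set // => /set_mem[fs ls] sd.
  have /facets_graph[j [r [jn se]]] := fs.
  have jn2 : (j < n.+2)%N by exact: ltnW.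
  have [dir _ _] := vP s fs ls; rewrite se in ls sd dir *.
  have [dj dc] := line_sub j0n2 jn2 ls.
  rewrite -scalemxAl mxE -/(h _).
  have [al [be ->]] := (direction_stratum r _ (ltnSn n.+1) jn2).1 dir.
  rewrite hc /above; have [dr|rd] := leP d0 r.
    rewrite [(r%:E < _)%E]ltNge (le_trans (nearest jn)) ?mulr0 //.
    by rewrite d0E lee_fin.
  by case/eqP: sd; apply: star_below rd.
rewrite addr0 graph_complexE // scale1r -/(h _) => v0.
(* The height over the new end is nonzero on a generator of the facet below. *)
have [_ gen _] := vP down fdown ldown.
have an : above j0 (d0 - d) n.+1 by rewrite bg // d0E.
have [|k /hline] := gen (vec_x n.+1 (above j0 (d0 - d))).
  apply/direction_stratum => //; exists 0, 1.
  by rewrite /combo scale0r add0r scale1r.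
have hx : h (intr_row (vec_x n.+1 (above j0 (d0 - d)))) = 1.
  have := hc (above j0 (d0 - d)) 0 1; rewrite /combo scale0r add0r scale1r => ->.
  by rewrite an mulr1.
rewrite /intr_row map_mxB map_mxZ hB hZ [h (map_mx _ (vec_x _ _))]hx.
by rewrite [h (map_mx _ _)]v0 mulr0 subr0 => /eqP; rewrite oner_eq0.
Qed.

Lemma unbalanced_line t : unbalanced_edge C P t <-> t = line n j0 d0.
Proof.
split=> [[/edges_line[j [a [jn -> v]]] nb]|->].
  apply: contrapT => ne; apply: nb; rewrite graph_line //.
  apply: (balanced_transfer (C2 := C')); last exact: vertex_edge.
  by move=> s; exact: graph_weight.
split; last by rewrite graph_line //; exact: branch_unbalanced.
split; first exact: has_dim_line.
exists (stratum n n.+2 j0 d0); first by apply/facets_tree; exists j0, d0.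
apply: face_extremal => //; first exact: cell_self.
right=> x xc; rewrite -lee_fin -d0E; apply: (cell_below xc) => //.
by rewrite /above d0E ltxx.
Qed.

Lemma branch_affine s : facets C s ->
  exists i, forall x, s x -> tp_eval P x = @tp_term R _ P i x.
Proof.
move=> /facets_tree[j [r [jn ->]]].
have jn1 : n.+1 != j by rewrite gtn_eqF.
have [al|al] := boolP (above j r n.+1).
  exists ord0 => _ [t [x [xc ->]]]; rewrite branch_eval_pt // branch_term0 ptS //.
  have xD := cell_above xc (ltnSn _) al; rewrite !cut_l //.
  by apply: (@Dtri_ge _ j n.+1 j0) => //; rewrite Dsym (le_trans xD) // nearest.
have eD x : cell n.+2 j r x -> (D j n.+1 <= x%:E)%E by move=> xc; exact: (cell_below xc (ltnSn _) al).
have [Dd|Dd] := eqVneq (D j n.+1) (D j0 n.+1).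
  exists ord_max => _ [t [x [xc ->]]]; rewrite branch_eval_pt // branch_term1 pt0.
  by rewrite cut_r ?eD // Dd addrC.
exists ord0 => _ [t [x [xc ->]]]; rewrite branch_eval_pt // branch_term0 ptS //.
have lt : (D n.+1 j < D n.+1 j0)%E.
  by rewrite (Dsym n.+1 j) (Dsym n.+1 j0) lt_neqAle Dd nearest.
by rewrite (Dsym j j0) (Dtri_eq lt) (Dsym n.+1 j).
Qed.

(** The old complex is first subdivided at the branch point of the new end, so
    that the polynomial is affine on each facet. *)
Lemma tree_modification :
  proper_modification (tree_complex n n.+1) branch_poly (tree_complex n.+1 n.+2).
Proof.
split.
  exists C; split; [exact: tree_surface|exact: refines_tree|split].
  - exact: branch_affine.
  - move=> s fs; rewrite (tree_complexE fs).
    have /facets_tree[j [r [jn ->]]] := fs; rewrite graph_stratum //.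
    by apply: tree_complexE; apply/facets_tree; exists j, r; split=> //; exact: ltnW.
  - move=> t /unbalanced_line ->; rewrite up_facet_new graph_line //.
    by rewrite (tree_complexE new_facet); split=> //; apply: vertex_edge => //; exists n.+1.
  move=> s /facets_new[[j [r [jn ->]]]|->].
    left; exists (stratum n n.+2 j r); last by rewrite graph_stratum.
    by apply/facets_tree; exists j, r.
  right; exists (line n j0 d0); last by rewrite up_facet_new.
  exact/unbalanced_line.
move=> /(_ (pt n.+1 0 n.+1 (d0 + 1))) []; first by apply/supp_tree; exists 0, n.+1, (d0 + 1).
move=> x _ e; have : tp_eval P x = d0 + 1.
  have := congr1 (fun w : 'rV[R]_n.+3 => w 0 ord_max) e.
  by rewrite !mxE unlift_none /= mul0rn add0r cutjj.
have := congr1 (fun w : 'rV[R]_n.+3 => w 0 ord0) e.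
rewrite pt0 !mxE; have -> : ord0 = lift ord_max ord0 :> 'I_n.+3 by apply: val_inj.
rewrite liftK /= => x0; rewrite branch_eval x0 mul0rn addr0 => h.
have : d0 + 1 <= d0 by rewrite -[leLHS]h ge_min lexx orbT.
by rewrite leNgt ltrDl ltr01.
Qed.

End Modification.

Lemma nearest_exists n : exists2 j0, (j0 < n.+1)%N &
  forall l, (l < n.+1)%N -> (D l n.+1 <= D j0 n.+1)%E.
Proof.
have [j _ jmax] := @arg_maxP _ _ 'I_n.+1 ord0 xpredT (fun l => D l n.+1) isT.
by exists j => // l ln; exact: (jmax (Ordinal ln)).
Qed.

Lemma tree_complex0 : tree_complex 0 1 = tropical_plane.
Proof.
have st r : stratum 0 1 0 r = setT.
  apply/seteqP; split=> // w _; exists (w 0 ord0), (height w 0); split.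
    by move=> [|l] //; rewrite above_self Djj leey.
  apply: row_height => [|[|l] //]; first by rewrite pt0.
  by rewrite height_pt // cutjj.
apply: funext => s; rewrite /tree_complex /tropical_plane; congr nat_of_bool.
apply/asboolP/eqP => [[[|j] [r [jn ->]]] //|->].
by exists 0%N, 0; rewrite st.
Qed.

End UltrametricTree.

Arguments pt {R} D M n t j x.
Arguments tree_complex {R} D M n N s.

(** * Closures and contracting maps *)

Section Closures.
Context (R : realType).

Lemma closure_le (T : topologicalType) (A : set T) (f g : T -> \bar R) t :
  {for t, continuous f} -> {for t, continuous g} ->
  (forall u, A u -> (f u <= g u)%E) -> closure A t -> (f t <= g t)%E.
Proof.
move=> cf cg Afg clA; rewrite leNgt; apply/negP => /(near_lt cg cf) /clA[u [Au]].
by move=> gf; have := Afg u Au; rewrite leNgt => /negP; apply.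
Qed.

Lemma closure_seq (T : topologicalType) (A : set T) (u : nat -> T) t :
  (forall k, A (u k)) -> u @ \oo --> t -> closure A t.
Proof.
move=> uA ut B /ut nB; have /filter_ex[k Bk] : \forall k \near \oo, B (u k) by exact: nB.
by exists (u k).
Qed.

Lemma cvg_coord_infty (F : nat -> R) (c : R) :
  (forall k, k%:R + c <= F k) -> (fun k => (F k)%:E) @ \oo --> +oo%E.
Proof.
move=> Fk; apply/cvgeyPge => A.
have := nbhs_infty_ger (A - c); apply: filterS => k h.
by rewrite lee_fin (le_trans _ (Fk k)) // -lerBlDr.
Qed.

Section Contracting.
Context (I : Type) (X : set (efun R I)) (F : efun R I -> efun R I).
Context (i0 i1 : I) (b : R -> R) (c0 c1 : R).
Hypotheses (c0_gt0 : 0 < c0) (c1_gt0 : 0 < c1).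
Hypothesis b_mono : {homo b : x y / x <= y}.

Let box (A : R) : set (efun R I) :=
  [set w | [/\ X w, (A%:E < w i0)%E & ((b A)%:E < w i1)%E]].

Hypothesis box_all : forall i B, exists A, forall w, box A w -> (B%:E < w i)%E.
Hypothesis F_expand : forall A w, box A w ->
  ((A + c0)%:E <= F w i0)%E /\ ((b A + c1)%:E <= F w i1)%E.

Lemma box_nbhs U : nbhs (tinfty I : efun R I) U -> exists A, box A `<=` U.
Proof.
move=> nU; pose Phi : set_system (efun R I) := filter_from setT box.
have le_box A B : A <= B -> box B `<=` box A.
  move=> AB w [Xw w0 w1]; split=> //; first by apply: le_lt_trans w0; rewrite lee_fin.
  by apply: le_lt_trans w1; rewrite lee_fin b_mono.
have FPhi : Filter Phi.
  apply: filter_from_filter; first by exists 0.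
  move=> A B _ _; exists (Num.max A B) => // w wb.
  by split; apply: le_box wb; rewrite le_max lexx ?orbT.
suff cPhi : Phi --> (tinfty I : efun R I).
  by have [A _ sA] := cPhi _ nU; exists A.
apply: efun_cvg => i; apply/cvgeyPgt => B.
have [A hA] := box_all i B; by exists A.
Qed.

(** The boxes form a basis of the neighbourhoods of infinity in X as soon as two
    coordinates bound all others from below; the image of a box under F lies in a
    strictly smaller closed box. *)
Lemma contracting_box : contracting_at X F (tinfty I).
Proof.
move=> U nU; have [A sA] := box_nbhs nU; exists (box A); split.
- have coord i B : nbhs (tinfty I : efun R I) [set w : efun R I | (B%:E < w i)%E].
    have nB : nbhs (+oo%E : \bar R) [set x | (B%:E < x)%E].
      by apply: open_nbhs_nbhs; split; [exact: open_ereal_gt_ereal|exact: ltry].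
    exact: (@eval_continuous R I i (tinfty I) _ nB).
  have n0 := coord i0 A; have n1 := coord i1 (b A).
  by apply: filterS2 n0 n1 => w w0 w1 Xw.
- by move=> w wA; split; [case: wA|apply: sA => //; case: wA].
move=> w [Xw clw]; split=> //.
  have : ((A + c0)%:E <= w i0)%E.
    apply: (closure_le (f := fun=> (A + c0)%:E) (g := fun w : efun R I => w i0) _ _ _ clw).
    - exact: cst_continuous.
    - exact: eval_continuous.
    - by move=> _ [v vA <-]; have [] := F_expand vA.
  by apply: lt_le_trans; rewrite lte_fin ltrDl.
have : ((b A + c1)%:E <= w i1)%E.
  apply: (closure_le (f := fun=> (b A + c1)%:E) (g := fun w : efun R I => w i1) _ _ _ clw).
  - exact: cst_continuous.
  - exact: eval_continuous.
  - by move=> _ [v vA <-]; have [] := F_expand vA.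
by apply: lt_le_trans; rewrite lte_fin ltrDl.
Qed.

End Contracting.
End Closures.

(** * Closures of the tree surfaces and their inverse limit *)

Section InverseLimit.
Context (R : realType) (D : nat -> nat -> \bar R) (M : nat).
Hypothesis DP : ultrametric D.
Hypothesis M_gt0 : (0 < M)%N.

Local Notation pt := (pt D M).

Lemma ultra_pt n t j x : (j < n.+1)%N ->
  ultra_rel D M (fun l => l < n.+1)%N (fun k => (pt n t j x 0 (inord k))%:E).
Proof.
move=> jn k l kn ln kl.
have e0 : pt n t j x 0 (inord 0) = t by rewrite mxE inordK.
rewrite e0 !ptS // -EFin_natmul -(fineK (Dfin DP kl)) -!EFinD -!EFin_min.
rewrite -!addr_minr !lee_fin !lerD2l -!lee_fin !EFin_min (fineK (Dfin DP kl)).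
rewrite !cutE ?D_Nny //; split.
  apply: le_trans (Dtri DP k j l); rewrite (Dsym DP k j) le_min !ge_min !lexx.
  by rewrite !orbT.
rewrite le_min -minA ge_min lexx /= ge_min; apply/orP; right.
by rewrite (Dsym DP k l) Dtri.
Qed.

Lemma ultra_closed (P : pred nat) I (c : nat -> I) (A : set (efun R I)) (w : efun R I) :
  (forall i, w i != -oo%E) ->
  (forall v, A v -> ultra_rel D M P (fun k => v (c k))) ->
  closure A w -> ultra_rel D M P (fun k => w (c k)).
Proof.
move=> wN hA clw j l Pj Pl jl.
have cc k : {for w, continuous (fun v : efun R I => v (c k))}.
  exact: eval_continuous.
have cq : {for w, continuous (fun v : efun R I => v (c 0%N) *+ M + D j l)%E}.
  apply: (@cvg_adde R (efun R I) (fun v => v (c 0%N) *+ M)%E (fun=> D j l)).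
  - by rewrite natmule_Nny.
  - exact: D_Nny.
  - apply: (@continuous_comp (efun R I) (\bar R) (\bar R) _ (fun x => x *+ M)%E).
      exact: eval_continuous.
    exact: continuous_natmule.
  - exact: cst_continuous.
split.
  apply: (closure_le (cvg_min (cc j.+1) (cc l.+1)) cq _ clw) => v vA.
  exact: (hA v vA j l Pj Pl jl).1.
apply: (closure_le (cvg_min (cc l.+1) cq) (cc j.+1) _ clw) => v vA.
exact: (hA v vA j l Pj Pl jl).2.
Qed.

Lemma coords_cvg n (u : nat -> 'rV[R]_n.+2) (w : efun R 'I_n.+2) :
  (fun k => (u k 0 ord0)%:E) @ \oo --> w ord0 ->
  (forall l, (l < n.+1)%N -> (fun k => (u k 0 (inord l.+1))%:E) @ \oo --> w (inord l.+1)) ->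
  (fun k => finite_point (u k)) @ \oo --> w.
Proof.
move=> c0 cS; apply: efun_cvg => i; case: (unliftP ord0 i) => [l|] -> //.
have -> : lift ord0 l = inord l.+1 :> 'I_n.+2 by apply: val_inj; rewrite /= inordK // ltnS.
exact: cS.
Qed.

Lemma cvg_eventually (u : nat -> \bar R) (l : \bar R) (B : R) :
  (forall k, B <= k%:R -> u k = l) -> u @ \oo --> l.
Proof.
move=> h; apply: cvg_near_cst; have := nbhs_infty_ger B.
by apply: filterS => k /h ->.
Qed.

(** A point satisfying the ultrametric relations is, when its first coordinate
    is finite, on the path of its largest coordinate; the points at infinity are
    approached along the paths. *)
Lemma tsurface_tree n (w : efun R 'I_n.+2) :
  tsurface (tree_complex D M n n.+1) w <->
  (forall i, w i != -oo%E) /\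
  ultra_rel D M (fun l => l < n.+1)%N (fun k => w (inord k)).
Proof.
split=> [[clw wN]|[wN wr]].
  split=> //; apply: (ultra_closed wN _ clw) => _ [v /supp_tree[t [j [x [jn ->]]]] <-].
  exact: ultra_pt.
split=> //.
have ptA t j x : (j < n.+1)%N ->
    (@finite_point R n.+2 @` supp (tree_complex D M n n.+1)) (finite_point (pt n t j x)).
  by move=> jn; exists (pt n t j x) => //; apply/supp_tree => //; exists t, j, x.
have i0 : inord 0 = ord0 :> 'I_n.+2 by apply: val_inj; rewrite /= inordK.
(* If w_0 is infinite, all other coordinates agree, and w is approached along
   the path to the end 0 with t tending to infinity. *)
have [wy|wf] := eqVneq (w ord0) +oo%E.
  have weq j l : (j < n.+1)%N -> (l < n.+1)%N -> w (inord j.+1) = w (inord l.+1).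
    have le i k : (i < n.+1)%N -> (k < n.+1)%N -> (w (inord k.+1) <= w (inord i.+1))%E.
      move=> im km; have [->|ik] := eqVneq i k; first exact: lexx.
      have [_] := wr i k im km ik; rewrite i0 wy -(prednK M_gt0) enatmul_pinfty.
      by rewrite addye ?D_Nny // min_l ?leey.
    by move=> jn ln; apply/eqP; rewrite eq_le !le.
  have [zy|zf] := eqVneq (w (inord 1)) +oo%E.
    apply: (@closure_seq _ _ (fun k => finite_point (pt n k%:R 0 0))).
      by move=> k; exact: ptA.
    apply: coords_cvg => [|l ln].
      rewrite wy; under eq_fun do rewrite pt0.
      by apply: (cvg_coord_infty (c := 0)) => k; rewrite addr0.
    rewrite -(weq 0%N) // zy; under eq_fun do rewrite ptS //.
    apply: (cvg_coord_infty (c := cut 0 (D 0 l))) => k.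
    rewrite lerD2r -(prednK M_gt0) mulrS lerDl.
    by rewrite mulrn_wge0.
  have zfin : w (inord 1) \is a fin_num by rewrite fin_numE wN.
  set z := fine (w (inord 1)).
  apply: (@closure_seq _ _ (fun k => finite_point (pt n k%:R 0 (z - k%:R *+ M)))).
    by move=> k; exact: ptA.
  apply: coords_cvg => [|l ln].
    rewrite wy; under eq_fun do rewrite pt0.
    by apply: (cvg_coord_infty (c := 0)) => k; rewrite addr0.
  rewrite -(weq 0%N) // -(fineK zfin) -/z; under eq_fun do rewrite ptS //.
  have [->|l0] := eqVneq l 0%N.
    apply: (@cvg_eventually _ _ 0) => k _.
    by rewrite cutjj // addrC subrK.
  apply: (@cvg_eventually _ _ (z - fine (D 0 l))) => k hk.
  rewrite cut_l; first by rewrite addrC subrK.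
  rewrite -(fineK (Dfin DP (j := 0) (l := l) _)) ?lee_fin; last by rewrite eq_sym.
  rewrite lerBlDr addrC -lerBlDr (le_trans hk) //.
  by rewrite -{1}(prednK M_gt0) mulrS lerDl mulrn_wge0.
have t0fin : w ord0 \is a fin_num by rewrite fin_numE wN.
(* If w_0 is finite, w lies on the path to the end of its largest coordinate. *)
set t := fine (w ord0).
have [jm _ jmax] := @arg_maxP _ _ 'I_n.+1 ord0 xpredT (fun l : 'I_n.+1 => w (inord l.+1)) isT.
have wE l : (l < n.+1)%N -> w (inord l.+1) =
    Order.min (w (inord jm.+1)) (w ord0 *+ M + D jm l)%E.
  move=> ln; have lm : (w (inord l.+1) <= w (inord jm.+1))%E by exact: (jmax (Ordinal ln)).
  have [->|jl] := eqVneq l jm.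
    by rewrite Djj // addey ?min_l ?leey // natmule_Nny.
  apply/eqP; rewrite eq_le le_min lm /=; apply/andP; split.
    have [+ _] := wr l jm ln (ltn_ord jm) jl; rewrite i0 min_l //.
    by rewrite (Dsym DP l).
  have [_] := wr l jm ln (ltn_ord jm) jl; by rewrite i0 (Dsym DP l).
have tME : (w ord0 *+ M)%E = (t *+ M)%:E by rewrite EFin_natmul fineK.
have [xy|xf] := eqVneq (w (inord jm.+1)) +oo%E.
  apply: (@closure_seq _ _ (fun k => finite_point (pt n t jm k%:R))).
    by move=> k; apply: ptA.
  apply: coords_cvg => [|l ln].
    by under eq_fun do rewrite pt0; rewrite -(fineK t0fin); exact: cvg_cst.
  rewrite wE // xy min_r ?leey // tME; under eq_fun do rewrite ptS //.
  have [->|jl] := eqVneq (jm : nat) l.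
    rewrite Djj // addey //.
    by apply: (cvg_coord_infty (c := t *+ M)) => k; rewrite cut_l ?leey // addrC.
  have Df := Dfin DP jl.
  apply: (@cvg_eventually _ _ (fine (D jm l))) => k hk.
  by rewrite -[in RHS](fineK Df) -EFinD cut_r // -(fineK Df) lee_fin.
have xfin : w (inord jm.+1) \is a fin_num by rewrite fin_numE wN.
apply: subset_closure; exists (pt n t jm (fine (w (inord jm.+1)) - t *+ M)).
  by apply/supp_tree => //; exists t, jm, (fine (w (inord jm.+1)) - t *+ M).
apply: funext => i; rewrite /finite_point; case: (unliftP ord0 i) => [l|] ->.
  have -> : lift ord0 l = inord l.+1 :> 'I_n.+2 by apply: val_inj; rewrite /= inordK // ltnS.
  rewrite ptS // EFinD cutE ?D_Nny // (wE l) // tME.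
  set x := fine _; rewrite -[w (inord jm.+1)](fineK xfin) -/x.
  have [->|jl] := eqVneq (jm : nat) l.
    by rewrite Djj // addey // !min_l ?leey // -EFinD addrC subrK.
  have Df := Dfin DP jl; rewrite -(fineK Df) -EFinD -!EFin_min -EFinD.
  by rewrite addr_minr [_ + (x - _)]addrC subrK.
by rewrite pt0 fineK.
Qed.

Lemma inverse_limit_tree :
  inverse_limit (fun i => tree_complex D M i i.+1) = ultra_space D M.
Proof.
apply/seteqP; split=> w.
  move=> h; split.
    move=> i; have /tsurface_tree[+ _] := h i => /(_ (inord i)).
    by rewrite inordK // ltnW.
  move=> j l _ _ jl; set n := maxn j l.
  have jn : (j < n.+1)%N by rewrite ltnS leq_maxl.
  have ln : (l < n.+1)%N by rewrite ltnS leq_maxr.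
  have /tsurface_tree[_ /(_ j l jn ln jl)] := h n.
  by rewrite !inordK.
move=> [wN wr] i; apply/tsurface_tree; split=> [k|j l ji li jl]; first exact: wN.
by rewrite !inordK //; exact: wr.
Qed.

End InverseLimit.

(** * Linear parts of conjugate germs *)

Section Linearization.
Context (K : closedFieldType).

Lemma mcoeffU_mul n (p q : {mpoly K[n]}) k :
  (p * q)@_U_(k) = p@_U_(k) * q@_0 + p@_0 * q@_U_(k).
Proof.
have dU (r : {mpoly K[n]}) : r@_U_(k) = (r^`M(k))@_0.
  by rewrite mcoeff_deriv add0m mnm0E mulr1n.
by rewrite !dU mderivM mcoeffD !(rmorphM (mcoeff 0%MM)).
Qed.

Lemma mcoeffU_exp n (p : {mpoly K[n]}) k e : p@_0 = 0 ->
  (p ^+ e)@_U_(k) = (e == 1)%:R * p@_U_(k).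
Proof.
move=> p0; elim: e => [|e IH].
  by rewrite expr0 mcoeff1 mnm1_eq0 mul0r.
rewrite exprS mcoeffU_mul p0 mul0r addr0 mulrC eqSS; congr (_ * _).
case: e {IH} => [|e]; first by rewrite expr0 mcoeff1 eqxx.
by rewrite (rmorphXn (mcoeff 0%MM)) /= p0 expr0n.
Qed.

(** Chain rule at the origin. *)
Lemma mcoeffU_comp (p : {mpoly K[2]}) (t : 2.-tuple {mpoly K[2]}) k :
  (forall j, (tnth t j)@_0 = 0) ->
  (p \mPo t)@_U_(k) = \sum_j p@_U_(j) * (tnth t j)@_U_(k).
Proof.
move=> t0.
have mono m : ('X_[m] \mPo t)@_U_(k) = \sum_j (m == U_(j)%MM)%:R * (tnth t j)@_U_(k).
  rewrite comp_mpolyX !big_ord_recl !big_ord0 mulr1 addr0.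
  rewrite mcoeffU_mul !mcoeffU_exp // !(rmorphXn (mcoeff 0%MM)) /= !t0 !expr0n.
  have U0 : (m == U_(ord0)%MM) = (m ord0 == 1)%N && (m (lift ord0 ord0) == 0)%N.
    apply/eqP/andP => [->|[/eqP a /eqP b]]; first by rewrite !mnm1E.
    apply/mnmP => i; case: (unliftP ord0 i) => [i'|] ->; rewrite mnm1E ?a //.
    by rewrite ord1 b.
  have U1 : (m == U_(lift ord0 ord0)%MM) = (m ord0 == 0)%N && (m (lift ord0 ord0) == 1)%N.
    apply/eqP/andP => [->|[/eqP a /eqP b]]; first by rewrite !mnm1E.
    apply/mnmP => i; case: (unliftP ord0 i) => [i'|] ->; rewrite mnm1E ?a //.
    by rewrite ord1 b.
  by rewrite U0 U1 -!mulnb !natrM; ring.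
rewrite [in LHS](mpolyE p) (raddf_sum (comp_mpoly t)) (raddf_sum (mcoeff U_(k)%MM)) /=.
under eq_bigr do rewrite comp_mpolyZ mcoeffZ mono mulr_sumr.
rewrite exchange_big /=; apply: eq_bigr => j _.
rewrite {3}(mpolyE p) (raddf_sum (mcoeff U_(j)%MM)) /= mulr_suml.
by apply: eq_bigr => m _; rewrite mcoeffZ mcoeffX mulrA.
Qed.

Lemma series_comp_linear (a : series2 K) (h : 'I_2 -> series2 K) k :
  (forall i, h i 0%MM = 0) ->
  series_comp a h U_(k)%MM = \sum_j a U_(j)%MM * h j U_(k)%MM.
Proof.
move=> h0; rewrite /series_comp mdeg1 mcoeffU_comp => [|j].
  by apply: eq_bigr => j _; rewrite tnth_mktuple /series_trunc !mcoeff_mpoly // mdeg1.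
by rewrite tnth_mktuple /series_trunc mcoeff_mpoly // mdeg0.
Qed.

Lemma conjugate_jacobian (f g phi : 'I_2 -> series2 K) :
  (forall i, f i 0%MM = 0) -> (forall i, phi i 0%MM = 0) ->
  (forall i m, series_comp (phi i) f m = series_comp (g i) phi m) ->
  jacobian phi *m jacobian f = jacobian g *m jacobian phi.
Proof.
move=> f0 p0 e; apply/matrixP => i k; rewrite [LHS]mxE [RHS]mxE.
have := e i U_(k)%MM; rewrite !series_comp_linear // => h.
rewrite (eq_bigr (fun j => phi i U_(j)%MM * f j U_(k)%MM)) ?h.
  by apply: eq_bigr => j _; rewrite !mxE.
by move=> j _; rewrite !mxE.
Qed.

Lemma eigenvalue_conj n (P A B : 'M[K]_n) a : P \in unitmx ->
  P *m A = B *m P -> eigenvalue B a -> eigenvalue A a.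
Proof.
move=> uP e /eigenvalueP[v vB v0]; apply/eigenvalueP; exists (v *m P).
  by rewrite -mulmxA e mulmxA vB scalemxAl.
by apply: contraNneq v0 => vP; rewrite -(mulmxK uP v) vP mul0mx.
Qed.

Lemma eigenvalue_unit n (A : 'M[K]_n) a : A \in unitmx -> eigenvalue A a -> a != 0.
Proof.
move=> uA /eigenvalueP[v vA v0]; apply: contraNneq v0 => a0.
by rewrite -(mulmxK uA v) vA a0 scale0r mul0mx.
Qed.

(** If m = 1 and lam <> mu, the relation eps (mu - lam^m) = 0 kills the entry
    below the diagonal. *)
Lemma normal_form_eigen (lam mu eps : K) m : (0 < m)%N ->
  eps * (mu - lam ^+ m) = 0 ->
  let J := jacobian (global_germ (normal_form_map lam mu eps m)) in
  eigenvalue J lam /\ eigenvalue J mu.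
Proof.
move=> m0 res J.
have J0 j : J ord0 j = if j == ord0 then lam else 0.
  rewrite mxE /global_germ (tnth_nth 0) /= mcoeffZ mcoeffXU eq_sym.
  by case: eqP; rewrite ?mulr1 ?mulr0.
have J1 j : J ord_max j = if j == ord0 then eps * (m == 1)%:R else mu.
  rewrite mxE /global_germ (tnth_nth 0) /= mcoeffD !mcoeffZ mcoeffU_exp; last first.
    by rewrite mcoeffX mnm1_eq0.
  rewrite !mcoeffXU; case: (unliftP ord0 j) => [j'|] ->.
    by rewrite ord1 /= !mulr0 addr0 mulr1.
  by rewrite eqxx /= mulr0 add0r mulr1.
have mulJ (v : 'rV[K]_2) j : (v *m J) 0 j = v 0 ord0 * J ord0 j + v 0 ord_max * J ord_max j.
  rewrite mxE big_ord_recl big_ord1; congr (_ + v 0 _ * J _ _); exact: val_inj.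
have lamP : eigenvalue J lam.
  apply/eigenvalueP; exists (delta_mx 0 ord0).
    apply/rowP => j; rewrite mulJ J0 J1 !mxE !eqxx /= mul1r mul0r addr0.
    by case: eqP; rewrite ?mulr1 ?mulr0.
  by apply/eqP => /rowP/(_ ord0)/eqP; rewrite !mxE !eqxx oner_eq0.
split=> //; have [<- //|lm] := eqVneq lam mu.
have e0 : eps * (m == 1)%:R = 0.
  case: eqP => [m1|_]; last by rewrite mulr0.
  move: res; rewrite m1 expr1 => /eqP; rewrite mulf_eq0 subr_eq0.
  by move=> /orP[/eqP ->|/eqP ml]; [rewrite mul0r|rewrite ml eqxx in lm].
apply/eigenvalueP; exists (delta_mx 0 ord_max).
  apply/rowP => j; rewrite mulJ J0 J1 e0 !mxE !eqxx /= mul1r mul0r add0r.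
  case: (unliftP ord0 j) => [j'|] ->; last by rewrite mulr0.
  by rewrite ord1 mulr1.
by apply/eqP => /rowP/(_ ord_max)/eqP; rewrite !mxE !eqxx oner_eq0.
Qed.

Lemma normal_form_contracting (R : realType) (nu : K -> \bar R)
    (f : 'I_2 -> series2 K) (lam mu eps : K) m :
  contracting_germ nu f -> poincare_dulac nu f lam mu eps m ->
  [/\ lam != 0, mu != 0, (0 < nu lam)%E & (0 < nu mu)%E].
Proof.
move=> [[f0 _ Jf] ctr] [m0 res [phi [p0 _ Jp] e]].
have [l1 l2] := normal_form_eigen m0 res.
have conj := conjugate_jacobian f0 p0 e.
have {}l1 := eigenvalue_conj Jp conj l1; have {}l2 := eigenvalue_conj Jp conj l2.
by split; [exact: eigenvalue_unit l1|exact: eigenvalue_unit l2|exact: ctr|exact: ctr].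
Qed.

End Linearization.

(** * Normal forms, the origin and the tropical plane *)

Section NormalForm.
Context (K : closedFieldType).

Lemma normal_form_comp (lam mu eps lam' mu' eps' : K) m p :
  lam * lam' = 1 -> mu * mu' = 1 -> mu * eps' + eps * lam' ^+ m = 0 ->
  (p \mPo normal_form_map lam mu eps m) \mPo normal_form_map lam' mu' eps' m = p.
Proof.
move=> l1 m1 e0; apply: comp_mpoly_cancel; rewrite !(tnth_nth 0) /=.
  by rewrite comp_mpolyZ comp_mpolyX0 scalerA l1 scale1r.
rewrite linearD /= !comp_mpolyZ rmorphXn /= comp_mpolyX0 comp_mpolyX1.
rewrite scalerDr !scalerA m1 scale1r exprZn scalerA -addrA -scalerDl e0.
by rewrite scale0r addr0.
Qed.

Lemma normal_form_origin (lam mu eps : K) m i : (0 < m)%N ->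
  (tnth (normal_form_map lam mu eps m) i).@[fun=> 0] = 0.
Proof.
move=> m0; case: (unliftP ord0 i) => [j|] ->; rewrite (tnth_nth 0) /=; last first.
  by rewrite mevalZ mevalXU mulr0.
rewrite ord1 /= mevalD !mevalZ rmorphXn /= !mevalXU expr0n (gtn_eqF m0).
by rewrite !mulr0 addr0.
Qed.

Lemma meval_origin (p : {mpoly K[2]}) : p.@[fun=> 0] = p@_0.
Proof.
rewrite mevalE [in RHS](mpolyE p) (raddf_sum (mcoeff 0%MM)) /=.
apply: eq_bigr => m _; rewrite mcoeffZ mcoeffX; congr (_ * _).
rewrite big_ord_recl big_ord1 !expr0n -natrM mulnb; congr (nat_of_bool _)%:R.
apply/andP/eqP => [[/eqP a /eqP b]|->]; last by rewrite !mnm0E.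
apply/mnmP => i; rewrite mnm0E; case: (unliftP ord0 i) => [i'|] -> //.
by rewrite ord1.
Qed.

End NormalForm.

Section Origin.
Context (R : realType) (K : closedFieldType) (nu : K -> \bar R).
Hypothesis nuP : valuation nu.

(** Modulo its constant term, every polynomial is a combination of monomials of
    infinite value. *)
Lemma A2_origin (v : efun R {mpoly K[2]}) : A2an nu v ->
  v 'X_ord0 = +oo%E -> v 'X_ord_max = +oo%E -> v = A2an_origin nu.
Proof.
move=> vA v0 v1; apply: funext => p; rewrite /A2an_origin meval_origin.
set c := p@_0.
have rest : v (p - c%:MP) = +oo%E.
  apply/eqP; rewrite -leye_eq.
  apply: le_trans (gauss_min nuP (t := +oo%E) (s := +oo%E) _ _ _ vA _ _) => //;
    rewrite ?v0 ?v1 //.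
  apply: gauss_ge => m; rewrite mcoeffB mcoeffC.
  have [->|m0] := eqVneq m 0%MM; first by rewrite mulr1 subrr (nu0 nuP) addye ?weight_Nny.
  have -> : weight +oo%E +oo%E m = +oo%E :> \bar R.
    rewrite /weight; case e0 : (m ord0) => [|k].
      case e1 : (m ord_max) => [|k].
        case/eqP: m0; apply/mnmP => i; rewrite mnm0E.
        by case: (unliftP ord_max i) => [j|] -> //; rewrite ord1 -[RHS]e0; congr (m _); apply: val_inj.
      by rewrite enatmul_pinfty addey ?natmule_Nny.
    by rewrite enatmul_pinfty addye ?natmule_Nny.
  by rewrite addey ?nu_neqNy.
apply/eqP; rewrite eq_le; apply/andP; split.
  have e : p - (p - c%:MP) = c%:MP by exact: subKr.
  by have := A2D vA p (- (p - c%:MP)); rewrite e (A2N nuP vA) (A2C vA) rest min_l ?leey.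
have e : c%:MP + (p - c%:MP) = p by rewrite addrC subrK.
by have := A2D vA c%:MP (p - c%:MP); rewrite e (A2C vA) rest min_l ?leey.
Qed.

Lemma gauss_continuous (T : topologicalType) (f0 f1 : T -> \bar R) p :
  (forall x, f0 x != -oo%E) -> (forall x, f1 x != -oo%E) ->
  continuous f0 -> continuous f1 -> continuous (fun x => gauss nu (f0 x) (f1 x) p).
Proof.
move=> N0 N1 c0 c1; rewrite /gauss; elim: (msupp p : seq _) => [|m s IH].
  by under eq_fun do rewrite big_nil; exact: cst_continuous.
under eq_fun do rewrite big_cons.
have pow (f : T -> \bar R) k x : continuous f -> {for x, continuous (fun x => f x *+ k)%E}.
  move=> cf; apply: (@continuous_comp T (\bar R) (\bar R) f (fun y => y *+ k)%E).
    exact: cf.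
  exact: continuous_natmule.
move=> x; apply: (cvg_min _ (IH x)).
apply: (@cvg_adde R T (fun=> nu p@_m) (fun x => weight (f0 x) (f1 x) m)).
- exact: nu_neqNy.
- exact: weight_Nny.
- exact: cst_continuous.
apply: (@cvg_adde R T (fun x => f0 x *+ m ord0)%E (fun x => f1 x *+ m ord_max)%E).
- exact: natmule_Nny.
- exact: natmule_Nny.
- exact: pow.
- exact: pow.
Qed.

End Origin.

Section Plane.
Context (R : realType).

Lemma supp_plane : supp (@tropical_plane R) = setT.
Proof.
apply/seteqP; split=> // x _; exists setT => //.
by rewrite /facets /= /tropical_plane eqxx.
Qed.

(** The plane is the Bergman fan of the free matroid on three elements; psi
    subtracts the last coordinate, and phi puts 0 there. *)
Lemma plane_nonsingular : nonsingular (@tropical_plane R).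
Proof.
split=> [s|x _]; first by rewrite /tropical_plane leq_b1.
exists 3%N, finset.set0, (\matrix_(i, j) ((i == j :> nat) : nat)%:Z),
  (\matrix_(i, j) if (i == 2 :> nat) then -1 else ((i == j :> nat) : nat)%:Z).
move=> phiR psiR.
have psi0 (w : 'rV[R]_3) j :
    (w *m psiR) 0 j = w 0 (widen_ord (isT : 2 <= 3)%N j) - w 0 ord_max.
  rewrite mxE !big_ord_recl big_ord0 !mxE /=.
  case: j => [[|[|j]] hj] //=; rewrite ?mulr1 ?mulr0 ?add0r ?addr0 ?mulrN1;
    by congr (w 0 _ - w 0 _); apply: val_inj.
have phi0 (v : 'rV[R]_2) (j : 'I_3) :
    (v *m phiR) 0 j = if (j == 2 :> nat) then 0 else v 0 (inord j).
  rewrite mxE !big_ord_recl big_ord0 !mxE /=.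
  case: j => [[|[|[|j]]] hj] //=; rewrite ?mulr1 ?mulr0 ?add0r ?addr0 //;
    by congr (v 0 _); apply: val_inj; rewrite /= inordK.
split.
- by split=> [|A B|A B y]; rewrite inE.
- by apply/rowP => j; rewrite psi0 !mxE subrr.
- move=> v _; split=> [A|]; first by rewrite inE.
  apply/rowP => j; rewrite psi0 !phi0 /= subr0.
  by rewrite ltn_eqF ?ltn_ord // inord_val.
move=> w _; split.
  by exists 1 => // t _; rewrite supp_plane.
exists (- w 0 ord_max); apply/rowP => j; rewrite phi0 [RHS]mxE [X in _ + X]mxE.
have [j2|j2] := eqVneq (j : nat) 2.
  by have -> : j = ord_max by [apply: val_inj]; rewrite subrr.
have jn : (j < 2)%N by have := ltn_ord j; rewrite ltnS leq_eqVlt (negPf j2).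
rewrite psi0; congr (w 0 _ - _); by apply: val_inj; rewrite /= inordK.
Qed.

Lemma plane_tsurface : tspace 'I_2 = tsurface (@tropical_plane R).
Proof.
apply/seteqP; split=> [w wN|w []//]; split=> //; rewrite supp_plane.
pose u k : 'rV[R]_2 := \row_i if w i \is a fin_num then fine (w i) else k%:R.
apply: (@closure_seq _ _ (fun k => finite_point (u k))); first by move=> k; exists (u k).
apply: efun_cvg => i; rewrite /finite_point.
have [wf|wf] := boolP (w i \is a fin_num).
  by apply: (@cvg_eventually _ _ _ 0) => k _; rewrite mxE wf fineK.
have -> : w i = +oo%E by apply/eqP; move: wf; rewrite fin_numE (wN i) /= negbK.
apply: (cvg_coord_infty (c := 0)) => k; by rewrite mxE (negPf wf) addr0.
Qed.

End Plane.

(** * The diagonal case *)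

Section Diagonal.
Context (R : realType) (K : closedFieldType) (nu : K -> \bar R).
Hypothesis nuP : valuation nu.

Lemma nu_inv x : x != 0 -> nu x^-1 = (- nu x)%E.
Proof.
move=> x0; have := nuM nuP x x^-1; rewrite divff // (nu1 nuP).
have xf := nu_fin nuP x0; rewrite -(fineK xf) -(fineK (nu_fin nuP (invr_neq0 x0))).
by move=> [] /eqP; rewrite eq_sym addrC addr_eq0 => /eqP ->.
Qed.

Lemma diagonal_retracts (lam mu : K) m : (0 < m)%N -> lam != 0 -> mu != 0 ->
  (0 < nu lam)%E -> (0 < nu mu)%E ->
  retracts_to_tropical_hopf nu (normal_form_map lam mu 0 m).
Proof.
move=> m0 l0 u0 lpos upos.
pose h : 2.-tuple {mpoly K[2]} := [tuple 'X_ord0; 'X_ord_max].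
pose c (i : 'I_2) := fine (nu (if i == ord0 then lam else mu)).
have cE (i : 'I_2) : (c i)%:E = nu (if i == ord0 then lam else mu).
  by rewrite /c fineK // (nu_fin nuP) //; case: ifP.
have cpos i : 0 < c i by rewrite -lte_fin cE; case: ifP.
pose X : set (efun R 'I_2) := tspace 'I_2.
pose F := perm_translation (R := R) 1%g c.
pose F' := perm_translation (R := R) 1%g (fun i => - c i).
have ext (P : 'I_2 -> Prop) : P ord0 -> P ord_max -> forall i, P i.
  move=> P0 P1 i; case: (unliftP ord_max i) => [j|] -> //; rewrite ord1.
  by have -> : lift ord_max ord0 = ord0 :> 'I_2 by apply: val_inj.
have h0 : tnth h ord0 = 'X_ord0 by rewrite (tnth_nth 0).
have h1 : tnth h ord_max = 'X_ord_max by rewrite (tnth_nth 0).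
exists 2%N, h, X, F; split.
- exists (@tropical_plane R), 1%g, c; split => //.
  + by split; [exact: iterated_modification0|exact: plane_nonsingular].
  + exact: plane_tsurface.
  + apply: (@contracting_box _ _ _ _ ord0 ord_max id (c ord0) (c ord_max)) => //.
      by move=> i B; exists B; move: i; apply: ext => w [].
    move=> A w [_ w0 w1]; rewrite /F /perm_translation !perm1 !EFinD.
    by rewrite !leeD2r // ltW.
  apply/seteqP; split=> [_ [w wN <-] i|w wN].
    by rewrite /F /perm_translation adde_Nny.
  exists (F' w); first by move=> i; rewrite /F' /perm_translation adde_Nny.
  apply: funext => i; rewrite /F /F' /perm_translation !perm1 -addeA -EFinD.
  by rewrite addNr adde0.
- by move=> p; exists p; rewrite comp_mpoly_id2.
have gK (lam' mu' : K) : lam' != 0 -> mu' != 0 -> forall p, (p \mPo normal_form_map lam' mu' 0 m) \mPo normal_form_map lam'^-1 mu'^-1 0 m = p.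
  by move=> l'0 u'0 p; apply: normal_form_comp; rewrite ?divff // mulr0 mul0r addr0.
have tropF lam' mu' (v : efun R {mpoly K[2]}) : A2an nu v ->
    tropicalization (tnth h) (push (normal_form_map lam' mu' 0 m) v) =
    fun i => (tropicalization (tnth h) v i + nu (if i == ord0 then lam' else mu'))%E.
  move=> vA; apply: funext; apply: ext; rewrite /tropicalization /push ?h0 ?h1.
    by rewrite comp_mpolyX0 (A2Z vA) addeC.
  by rewrite comp_mpolyX1 scale0r addr0 (A2Z vA) addeC.
have punctured_Nny (w : X `\ tinfty 'I_2) i : (set_val w : 'I_2 -> \bar R) i != -oo%E.
  by have [wX _] := set_valP w; exact: wX.
apply: (@least_section_retraction R K nu nuP _ (normal_form_map lam^-1 mu^-1 0 m) _ _ X F F'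
  (fun w : efun R 'I_2 => gauss nu (w ord0) (w ord_max))).
- exact: gK.
- by move=> p; have := gK lam^-1 mu^-1; rewrite !invr_eq0 !invrK => ->.
- by move=> i; exact: normal_form_origin.
- by apply: ext; rewrite ?h0 ?h1 mevalXU.
- move=> v vA vO; split=> [i|e]; first exact: A2_Nny vA _.
  apply: vO; apply: A2_origin => //.
    by rewrite -h0; exact: (congr1 (fun w : 'I_2 -> \bar R => w ord0) e).
  by rewrite -h1; exact: (congr1 (fun w : 'I_2 -> \bar R => w ord_max) e).
- move=> v vA; rewrite tropF //; apply: funext => i.
  by rewrite /F /perm_translation perm1 cE.
- move=> v vA; rewrite tropF //; apply: funext => i.
  rewrite /F' /perm_translation perm1 EFinN cE; congr (_ + _)%E.
  by case: ifP => _; rewrite nu_inv.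
- by move=> w wX _; exact: A2_gauss.
- move=> w wX _; apply: funext; apply: ext; rewrite /tropicalization ?h0 ?h1.
    by rewrite gaussX // /weight !mnm1E /= ?mule0n adde0.
  by rewrite gaussX // /weight !mnm1E /= ?mule0n add0e.
- move=> w v p wX _ vA e; apply: gauss_min => //.
    by rewrite -e /tropicalization h0.
  by rewrite -e /tropicalization h1.
move=> p; apply: gauss_continuous => //.
  move=> w; apply: (@continuous_comp (X `\ tinfty 'I_2) (efun R 'I_2) (\bar R) set_val (fun v : efun R 'I_2 => v ord0)).
    exact: initial_continuous.
  exact: eval_continuous.
move=> w; apply: (@continuous_comp (X `\ tinfty 'I_2) (efun R 'I_2) (\bar R) set_val (fun v : efun R 'I_2 => v ord_max)).
  exact: initial_continuous.
exact: eval_continuous.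
Qed.

End Diagonal.

(** * The resonant case *)

Section Resonant.
Context (R : realType) (K : closedFieldType) (nu : K -> \bar R).
Hypothesis nuP : valuation nu.

Lemma nuN x : nu (- x) = nu x.
Proof. by rewrite -mulN1r (nuM nuP) (nuN1 nuP) add0e. Qed.

Lemma nuX x n : nu (x ^+ n) = (nu x *+ n)%E.
Proof.
by elim: n => [|n IH]; rewrite ?expr0 ?(nu1 nuP) ?mule0n // exprS (nuM nuP) IH muleS.
Qed.

Lemma nuD x y : (Order.min (nu x) (nu y) <= nu (x + y)%R)%E.
Proof. by case: nuP. Qed.

Lemma nu_int_ge0 (z : int) : (0 <= nu z%:~R)%E.
Proof.
have nat_ge0 n : (0 <= nu n%:R)%E.
  elim: n => [|n IH]; first by rewrite (nu0 nuP) leey.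
  by rewrite mulrS; apply: le_trans (nuD _ _); rewrite le_min (nu1 nuP) lexx IH.
case: z => n; first exact: nat_ge0.
by rewrite NegzE mulrNz nuN; exact: nat_ge0.
Qed.

Definition int_of_code (n : nat) : int := if odd n then Negz n./2 else Posz n./2.

Definition code_of_int (z : int) : nat :=
  match z with Posz k => k.*2 | Negz k => k.*2.+1 end.

Lemma int_of_codeK : cancel int_of_code code_of_int.
Proof.
move=> n; rewrite /int_of_code -[RHS]odd_double_half.
by case: (odd n).
Qed.

Lemma code_of_intK : cancel code_of_int int_of_code.
Proof.
case=> k; rewrite /int_of_code /= odd_double /=; first by rewrite doubleK.
by rewrite uphalf_double.
Qed.

Definition code_shift (d : int) (n : nat) : nat := code_of_int (int_of_code n + d).

Lemma code_shiftK d : cancel (code_shift d) (code_shift (- d)).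
Proof. by move=> n; rewrite /code_shift code_of_intK addrK int_of_codeK. Qed.

Context (M : nat) (c : K).
Hypotheses (M_gt0 : (0 < M)%N) (c_neq0 : c != 0).
Hypothesis char0 : [pchar K] =i pred0.

Definition centers (n : nat) : K := (int_of_code n)%:~R * c.

Local Notation D := (val_dist nu centers).
Local Notation X := (ultra_space D M).
Local Notation h := (parabolas M centers).
Local Notation trop := (@tropicalization R K nat h).

Lemma centers_sub j l : centers j - centers l = (int_of_code j - int_of_code l)%:~R * c.
Proof. by rewrite /centers -mulrBl intrB. Qed.

Lemma centers0 : centers 0 = 0. Proof. by rewrite /centers mul0r. Qed.

Lemma centers_shift d l : centers (code_shift d l) = centers l + d%:~R * c.
Proof. by rewrite /centers /code_shift code_of_intK intrD mulrDl. Qed.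

Lemma val_dist_shift d j l : D (code_shift d j) (code_shift d l) = D j l.
Proof. by rewrite /val_dist !centers_shift opprD addrACA subrr addr0. Qed.

Lemma val_dist_ge j l : (nu c <= D j l)%E.
Proof.
by rewrite /val_dist centers_sub (nuM nuP) -[leLHS]add0e leeD2r // nu_int_ge0.
Qed.

Lemma int_neq0 (z : int) : z != 0 -> z%:~R != 0 :> K.
Proof.
have ch n : (n%:R == 0 :> K) = (n == 0%N) by have /pcharf0P := char0; apply.
case: z => n n0; first by rewrite -[n%:~R]/(n%:R : K) ch.
by rewrite NegzE mulrNz oppr_eq0 -[n.+1%:~R]/(n.+1%:R : K) ch.
Qed.

(** In characteristic 0 the multiples of c by distinct integers are distinct. *)
Lemma centers_ultrametric : ultrametric D.
Proof.
split=> [j|j l jl|j l|j k l].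
- by rewrite /val_dist subrr (nu0 nuP).
- apply: (nu_fin nuP); rewrite centers_sub mulf_neq0 // int_neq0 // subr_eq0.
  by rewrite (can_eq int_of_codeK).
- by rewrite /val_dist -nuN opprB.
by rewrite /val_dist; apply: le_trans (nuD _ _) _; rewrite addrA subrK.
Qed.

Definition shift (d : int) (r : R) (w : efun R nat) : efun R nat :=
  fun i => if i is l.+1 then (w (code_shift d l).+1 + (r *+ M)%:E)%E
           else (w 0%N + r%:E)%E.

Lemma shiftK d r : cancel (shift d r) (shift (- d) (- r)).
Proof.
move=> w; apply: funext => -[|l]; rewrite /shift.
  by rewrite -addeA -EFinD subrr adde0.
have e : code_shift d (code_shift (- d) l) = l.
  by have := code_shiftK (- d) l; rewrite opprK.
by rewrite e -addeA -EFinD mulNrn subrr adde0.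
Qed.

Lemma min_adder (x y : \bar R) (r : R) :
  (Order.min x y + r%:E = Order.min (x + r%:E) (y + r%:E))%E.
Proof.
case: (leP x y) => xy; first by rewrite min_l // leeD2r.
by rewrite min_r // leeD2r // ltW.
Qed.

Lemma shift_ultra d r w : X w -> X (shift d r w).
Proof.
move=> [wN wr]; split=> [[|l]|j l _ _ jl]; try by rewrite /shift adde_Nny.
have jl' : code_shift d j != code_shift d l by rewrite (can_eq (code_shiftK d)).
have [h1 h2] := wr _ _ isT isT jl'; rewrite val_dist_shift in h1 h2.
rewrite /shift natmuleD addeAC -EFin_natmul -!min_adder !leeD2rE //.
Qed.

Lemma shift_continuous d r : continuous (shift d r).
Proof.
have add_cts i (s : R) : continuous (fun w : efun R nat => w i + s%:E)%E.
  move=> w; apply: (@cvgeD _ (nbhs w) (nbhs_filter w) R (fun v : efun R nat => v i) (fun=> s%:E)).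
  - exact: fin_num_adde_defl.
  - exact: eval_continuous.
  - exact: (@cst_continuous (efun R nat)).
by apply: efun_continuous => -[|l]; exact: add_cts.
Qed.

Lemma shift_affine d r : integer_affine_map X (shift d r).
Proof.
split; [exact: shift_ultra|exact/continuous_subspaceT/shift_continuous|].
have coord k (s : R) (w : efun R nat) : (forall j, w j \is a fin_num) ->
    (w k + s%:E)%E = (s + \sum_(j < k.+1) ((j == k :> nat) : int)%:~R * fine (w j))%:E.
  move=> wf; rewrite (bigD1 ord_max) //= eqxx mul1r big1 ?addr0 => [|j jk].
    by rewrite addrC EFinD fineK.
  by rewrite -val_eqE /= in jk; rewrite (negPf jk) mul0r.
move=> [|l].
  by exists 1%N, (fun j => (j == 0 :> nat) : int), r => w _ wf; exact: coord.
exists (code_shift d l).+2, (fun j => (j == (code_shift d l).+1 :> nat) : int), (r *+ M).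
by move=> w _ wf; exact: coord.
Qed.

Lemma shift_automorphism d r : integer_affine_automorphism X (shift d r).
Proof.
split; first exact: shift_affine.
exists (shift (- d) (- r)); first exact: shift_affine.
move=> w _; split; first exact: shiftK.
by have := shiftK (- d) (- r) w; rewrite !opprK.
Qed.

(** Integers have nonnegative value, so all distances are at least nu c, and each
    coordinate is bounded below by the minimum of w_1 and M w_0 + nu c. *)
Lemma shift_contracting d r : 0 < r -> contracting_at X (shift d r) (tinfty nat).
Proof.
move=> r0; pose ga := fine (nu c); have gaE : ga%:E = nu c by rewrite fineK // (nu_fin nuP).
pose b (A : R) := A *+ M + ga.
have low A (w : efun R nat) l : X w -> (A%:E < w 0%N)%E -> ((b A)%:E < w 1%N)%E ->
    ((b A)%:E <= w l.+1)%E.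
  move=> [wN wr] w0 w1; have [->|l0] := eqVneq l 0%N; first exact: ltW.
  have [_] := wr l 0%N isT isT l0; apply: le_trans.
  rewrite le_min (ltW w1) /= EFinD leeD //.
    by rewrite EFin_natmul le_natmule // ltW.
  by rewrite gaE val_dist_ge.
apply: (@contracting_box _ _ _ _ 0%N 1%N b r (r *+ M)) => //.
- by rewrite pmulrn_lgt0.
- by move=> x y xy; rewrite lerD2r lerMn2r xy orbT.
- move=> i B; exists (`|B| + `|ga| + 1) => w [Xw w0 w1].
  have n0 := normr_ge0 B; have n1 := normr_ge0 ga.
  have le1 := ler_norm B; have le2 := ler_norm (- ga); rewrite normrN in le2.
  case: i => [|l].
    by apply: le_lt_trans w0; rewrite lee_fin; lra.
  apply: lt_le_trans (low _ _ l Xw w0 w1); rewrite lte_fin /b.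
  have : `|B| + `|ga| + 1 <= (`|B| + `|ga| + 1) *+ M.
    by rewrite -(prednK M_gt0) mulrS lerDl mulrn_wge0 //; lra.
  lra.
move=> A w [Xw w0 w1]; rewrite /shift; split; rewrite EFinD leeD2r //.
  exact: ltW.
exact: low.
Qed.

Lemma comp_parabola (lam d b : K) : lam != 0 ->
  parabola M b \mPo normal_form_map lam (lam ^+ M) (d * lam ^+ M) M =
  lam ^+ M *: parabola M (b + d).
Proof.
move=> l0; rewrite /parabola linearD linearZ rmorphXn /= comp_mpolyX0 comp_mpolyX1.
rewrite exprZn scalerA -addrA -scalerDl scalerDr scalerA; congr (_ + _ *: _).
by ring.
Qed.

Lemma trop_normal_form (lam : K) (d : int) (v : efun R {mpoly K[2]}) : lam != 0 -> A2an nu v ->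
  trop (push (normal_form_map lam (lam ^+ M) (d%:~R * c * lam ^+ M) M) v) =
  shift d (fine (nu lam)) (trop v).
Proof.
move=> l0 vA; have nf : (fine (nu lam))%:E = nu lam by rewrite fineK // (nu_fin nuP).
apply: funext => -[|l]; rewrite /tropicalization /push /shift /=.
  by rewrite comp_mpolyX0 (A2Z vA) nf addeC.
by rewrite comp_parabola // (A2Z vA) nuX centers_shift EFin_natmul nf addeC.
Qed.

Lemma resonant_retracts (lam : K) : lam != 0 -> (0 < nu lam)%E ->
  retracts_to_noncompact_tropical_hopf nu
    (normal_form_map lam (lam ^+ M) (c * lam ^+ M) M).
Proof.
move=> l0 lpos; pose r := fine (nu lam).
have rE : r%:E = nu lam by rewrite fineK // (nu_fin nuP).
have r0 : 0 < r by rewrite -lte_fin rE.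
have x1E : parabola M (centers 0) = 'X_ord_max :> {mpoly K[2]}.
  by rewrite /parabola centers0 scale0r addr0.
have DP := centers_ultrametric.
exists h, X, (shift 1 r); split.
- exists (fun i => tree_complex D M i i.+1); split.
  + exact: tree_complex0.
  + move=> i; have [j0 j0i near] := nearest_exists D i.
    by eexists; exact: (tree_modification M DP j0i near).
  + by rewrite inverse_limit_tree.
  + exact: shift_automorphism.
  + exact: shift_contracting.
- move=> i p; exists (p \mPo [tuple 'X_ord0; 'X_(inord 1)]).
  rewrite comp_mpoly_tuple comp_mpoly_id2 // tnth_mktuple (tnth_nth 0) /=.
    by rewrite comp_mpolyXU -tnth_nth tnth_mktuple.
  by rewrite comp_mpolyXU -tnth_nth tnth_mktuple inordK.
have lV : lam^-1 != 0 by rewrite invr_eq0.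
have lM : lam ^+ M != 0 by rewrite expf_neq0.
pose g' := normal_form_map lam^-1 (lam^-1 ^+ M) ((-1)%:~R * c * lam^-1 ^+ M) M.
apply: (@least_section_retraction R K nu nuP _ g' _ h X (shift 1 r) (shift (-1) (- r))
  (tower nu M centers)).
- move=> p; apply: normal_form_comp; rewrite ?divff // exprVn ?divff //.
  by rewrite mulrN1z; field.
- move=> p; apply: normal_form_comp; rewrite ?mulVf // exprVn ?mulVf //.
  by rewrite mulrN1z; field.
- by move=> i; exact: normal_form_origin.
- move=> [|l]; first by rewrite /= mevalXU.
  by rewrite /= /parabola mevalD mevalZ rmorphXn /= !mevalXU expr0n gtn_eqF // mulr0 addr0.
- move=> v vA vO; split=> [|e]; first exact: A2_ultra.
  apply: vO; apply: A2_origin => //.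
    exact: (congr1 (fun w : nat -> \bar R => w 0%N) e).
  by rewrite -x1E; exact: (congr1 (fun w : nat -> \bar R => w 1%N) e).
- by move=> v vA; have := trop_normal_form 1 l0 vA; rewrite mulr1z mul1r.
- by move=> v vA; have := trop_normal_form (-1) lV vA; rewrite (nu_inv nuP l0) -rE.
- by move=> w Xw _; exact: A2_tower.
- by move=> w Xw _; exact: trop_tower.
- by move=> w v p Xw _ vA; exact: tower_min.
by move=> p; exact: tower_continuous_all.
Qed.

End Resonant.

Theorem theoremE (R : realType) (K : closedFieldType) (nu : K -> \bar R)
  (f : 'I_2 -> series2 K) (lam mu eps : K) (m : nat) :
  [pchar K] =i pred0 ->
  valuation nu ->
  nontrivial_valuation nu ->
  contracting_germ nu f ->
  poincare_dulac nu f lam mu eps m ->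
  let g := normal_form_map lam mu eps m in
  (eps = 0 -> retracts_to_tropical_hopf nu g) /\
  (eps <> 0 -> retracts_to_noncompact_tropical_hopf nu g).
Proof.
move=> char0 nuP _ ctr pd g.
have [l0 u0 lpos upos] := normal_form_contracting ctr pd.
have [m0 res _] := pd; split=> [e0|/eqP e0]; rewrite /g.
  by rewrite e0; exact: diagonal_retracts.
have muE : mu = lam ^+ m.
  by apply/eqP; move/eqP: res; rewrite mulf_eq0 (negPf e0) subr_eq0.
have lm : lam ^+ m != 0 by rewrite -muE.
rewrite muE -{1}(divfK lm eps); apply: resonant_retracts => //.
by rewrite mulf_neq0 // invr_eq0.
Qed.
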